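(* Let $\alpha\ge\beta\ge-\frac12$, $\alpha>-\frac12$, let $\zeta\ge0$, $1<p,q<\infty$ and $\kappa,\sigma\in\mathbb R$, and set $$\tilde{\mathcal I}^\zeta_{\kappa,\sigma}F(t)=t^{-\sigma}\int_0^\infty(\lambda^2+\zeta^2)^{-\frac\kappa2}F(\lambda)\tilde\varphi_\lambda(t)n(\lambda)\,d\lambda .$$ Suppose that there is a constant $C$ such that $$\left(\int_0^\infty|\tilde{\mathcal I}^\zeta_{\kappa,\sigma}F(t)|^q\tilde m(t)\,dt\right)^{\frac1q}\le C\left(\int_0^\infty|F(\lambda)|^p n(\lambda)\,d\lambda\right)^{\frac1p}$$ for all $F\in C_c^\infty(\mathbb R_+)$. Then the following conditions are necessary: (1) if $\zeta\ne0$, then $\sigma q<2(\alpha+1)$, $\ \sigma-\kappa\le2(\alpha+1)\left(\frac1p+\frac1q-1\right)$, and $\ \sigma\ge3\left(\frac1p+\frac1q-1\right)$; (2) if $\zeta=0$, then $\sigma q<2(\alpha+1)$, $\ \kappa p'<3$, $\ \sigma-\kappa\le2(\alpha+1)\left(\frac1p+\frac1q-1\right)$, and $\ \sigma-\kappa\ge3\left(\frac1p+\frac1q-1\right)$.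
   Context: Let $\rho=\alpha+\beta+1$. The Jacobi functions are $\varphi_\lambda(t)=\varphi_\lambda^{(\alpha,\beta)}(t)={}_2F_1\!\left(\frac{\rho+i\lambda}2,\frac{\rho-i\lambda}2;\alpha+1;-(\sinh t)^2\right)$, $t\ge0$, with ${}_2F_1$ the Gauss hypergeometric function. The weights are $$m(t)=(2\pi)^{-1/2}2^{2\rho}(\sinh t)^{2\alpha+1}(\cosh t)^{2\beta+1},\qquad n(\lambda)=(2\pi)^{-1/2}|\mathbf c(\lambda)|^{-2},$$ $$\mathbf c(\lambda)=\frac{2^{\rho-i\lambda}\Gamma(\alpha+1)\Gamma(i\lambda)}{\Gamma\left(\frac{\rho+i\lambda}2\right)\Gamma\left(\frac{\rho+i\lambda}2-\beta\right)}.$$ The modified quantities are $\tilde\varphi_\lambda(t)=\varphi_\lambda(t)/\varphi_0(t)$ and $\tilde m(t)=\varphi_0(t)^2m(t)$. $\mathbb R_+=(0,\infty)$ and $p'=p/(p-1)$. *)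

(* Defs.v *)
From HB Require Import structures.
From mathcomp Require Import all_boot all_order all_algebra.
From mathcomp Require Export complex.
From mathcomp Require Import all_classical all_reals all_analysis.

Set Implicit Arguments.
Unset Strict Implicit.
Unset Printing Implicit Defensive.

Import Order.TTheory GRing.Theory Num.Theory numFieldNormedType.Exports.

Local Open Scope classical_set_scope.
Local Open Scope ring_scope.
Local Open Scope complex_scope.

Section ComplexFunctions.
Variable R : realType.
Implicit Types (a b c z : R[i]) (x : R).

Definition cabs z : R := Normc.normc z.

Definition cexp z : R[i] :=
  (expR (complex.Re z))%:C * (cos (complex.Im z) +i* sin (complex.Im z)).

(** [cpow x z] is [x ^ z] for a positive real base [x]. *)
Definition cpow x z : R[i] := cexp (z * (ln x)%:C).

(** Gauss's limit formula, valid for every [z] that is not a pole. *)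
Definition cGamma z : R[i] :=
  lim ((fun n : nat => (n`!)%:R * cpow n%:R z / \prod_(k < n.+1) (z + k%:R))
         @ \oo : set_system R[i]^o).

(** The limit is taken in [R[i]^o], which is [R[i]] with the topology of its
    norm. *)
Definition csums_to (u : nat -> R[i]) (l : R[i]) : Prop :=
  series (u : nat -> R[i]^o) @ \oo --> (l : R[i]^o).

Definition analytic_at (f : R -> R[i]) (x0 : R) : Prop :=
  exists (u : nat -> R[i]) (r : R), 0 < r /\
    forall x, `|x - x0| < r ->
      csums_to (fun n => u n * ((x - x0) ^+ n)%:C) (f x).

Definition pochhammer z (n : nat) : R[i] := \prod_(k < n) (z + k%:R).

Definition hyp2F1_coef a b c (n : nat) : R[i] :=
  pochhammer a n * pochhammer b n / (pochhammer c n * (n`!)%:R).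

(** [f] is given by the Gauss series on the unit interval and by its analytic
    continuation on the rest of the half-line [x < 1]. *)
Definition is_hyp2F1 a b c (f : R -> R[i]) : Prop :=
  (forall x, `|x| < 1 ->
     csums_to (fun n => hyp2F1_coef a b c n * (x ^+ n)%:C) (f x)) /\
  (forall x, x < 1 -> analytic_at f x).

(** The restriction of 2F1(a, b; c; .) to the real half-line [x < 1], which is
    all of the cut plane that Jacobi functions see; by the identity theorem
    [is_hyp2F1] determines it there. Its values at [x >= 1] are unspecified. *)
Definition hyp2F1 a b c : R -> R[i] := xget (fun=> 0) (is_hyp2F1 a b c).

Definition cintegral (D : set R) (f : R -> R[i]) : R[i] :=
  Rintegral lebesgue_measure D (fun x => complex.Re (f x)) +i*
  Rintegral lebesgue_measure D (fun x => complex.Im (f x)).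

Definition smooth (f : R -> R) : Prop :=
  forall (n : nat) (x : R), derivable (derive1n n f) x 1.

(** Complex-valued C_c^oo(]0, +oo[), each function being extended by zero to
    the real line. *)
Definition test_function (F : R -> R[i]) : Prop :=
  [/\ smooth (fun x => complex.Re (F x)),
      smooth (fun x => complex.Im (F x)),
      compact (closure [set x | F x != 0]) &
      closure [set x | F x != 0] `<=` `]0, +oo[].

End ComplexFunctions.

Section JacobiTransform.
Variables (R : realType) (alpha beta : R).
Implicit Types (t lambda : R).

Definition sinh t : R := (expR t - expR (- t)) / 2.
Definition cosh t : R := (expR t + expR (- t)) / 2.

Definition rho : R := alpha + beta + 1.

(** The value of 2F1 is real here: its first two parameters are complex
    conjugates, and the third one and the argument are real. *)
Definition jacobi lambda t : R :=
  complex.Re (hyp2F1 ((rho +i* lambda) / 2) ((rho -i* lambda) / 2)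
                (alpha + 1)%:C (- (sinh t ^+ 2))).

Definition jacobi_mod lambda t : R := jacobi lambda t / jacobi 0 t.

Definition m_weight t : R :=
  (2 * pi) `^ (- (1 / 2)) * 2 `^ (2 * rho)
  * sinh t `^ (2 * alpha + 1) * cosh t `^ (2 * beta + 1).

Definition m_weight_mod t : R := jacobi 0 t ^+ 2 * m_weight t.

Definition c_function lambda : R[i] :=
  cpow 2 (rho -i* lambda) * cGamma (alpha + 1)%:C * cGamma (0 +i* lambda)
  / (cGamma ((rho +i* lambda) / 2)
     * cGamma ((rho +i* lambda) / 2 - beta%:C)).

Definition n_weight lambda : R :=
  (2 * pi) `^ (- (1 / 2)) * (cabs (c_function lambda)) ^- 2.

Definition jacobi_op (zeta kappa sigma : R) (F : R -> R[i]) t : R[i] :=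
  (t `^ (- sigma))%:C *
  cintegral `]0, +oo[ (fun lambda =>
    ((lambda ^+ 2 + zeta ^+ 2) `^ (- (kappa / 2)))%:C
    * F lambda * (jacobi_mod lambda t)%:C * (n_weight lambda)%:C).

End JacobiTransform.

(* Main.v *)
Require Import Defs.
From HB Require Import structures.
From mathcomp Require Import all_boot all_order all_algebra.
From mathcomp Require Import complex.
From mathcomp Require Import all_classical all_reals all_analysis.
From mathcomp Require Import measurable_realfun ring lra.

(** The inequality is tested on sums of nonnegative bumps, each carried by a
    dyadic interval of frequencies ]s, 2 s[. What makes this efficient is the
    absence of oscillation near the origin: phi_lambda(t) / phi_0(t) lies between
    1 / 2 and 2 as soon as lambda t <= 1 / 2 ([jacobi_mod_bound]). For such t the
    operator is, up to a constant, at least what it would be with this quotient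
    replaced by 1 ([jacobi_op_lower]), and both sides of the inequality are then
    estimated from the sizes of the weights:
    - n(lambda) is of order lambda^2 for lambda <= 1, and of order
      lambda^(2 alpha + 1) for lambda >= 1 ([n_weight_dyadic_small],
      [n_weight_dyadic_large]);
    - phi_0(t)^2 m(t) is at least of order t^(2 alpha + 1) for t <= 1, and of
      order t^2 for t >= 1 ([m_weight_mod_small], [m_weight_mod_large]).

    One bump at scale s, tested on t ~ 1 / s, gives s^e <= C with
    e = sigma + A + d (1 - 1 / p - 1 / q), where s^A is the size of the weight
    (lambda^2 + zeta^2)^(- kappa / 2) and d is the local dimension: 2 (alpha + 1)
    for large s, and 3 for small s ([scaling_inequality]). The signs of these two
    exponents are two of the conditions. A fixed bump tested near t = 0 gives
    sigma q < 2 (alpha + 1) ([origin_necessary]). For zeta = 0, superposing K bumps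
    at the scales 1 / 2, ..., 1 / 2^K with amplitudes that make their norms equal
    gives K <= C K^(1 / p) for t ~ 1 unless kappa p' < 3
    ([logarithmic_necessary]).

    The estimates of phi come from Pfaff's transformation
    phi_lambda(t) = (cosh t)^(- rho) v_lambda(tanh^2 t), where v_lambda is a real
    power series of radius 1. That this is the hypergeometric function results
    from the differential equation, which both sides satisfy, and from the
    identity theorem for real analytic functions ([gauss_pfaff], [hypf_series],
    [hyp2F1E]). At lambda = 0 the series has positive coefficients, which gives
    the growth of phi_0 ([profile_0_lower]); the quotient v_lambda / v_0 is
    controlled by the Wronskian of the two functions ([profile_ratio_bound]).

    The size of n is that of |Gamma(x1 + i y) Gamma(x2 + i y) / Gamma(2 i y)|^2
    with x1 + x2 = alpha + 1 and y = lambda / 2. By Gauss's limit formula, whose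
    convergence is proved in [gamma_cvg], this is a limit of finite products,
    whose factors telescope up to errors that are summable uniformly in y
    ([ln_dens_factor], [n_weight_bounds]). *)

Set Implicit Arguments.
Unset Strict Implicit.
Unset Printing Implicit Defensive.

Import Order.TTheory GRing.Theory Num.Theory numFieldNormedType.Exports.

Local Open Scope classical_set_scope.
Local Open Scope ring_scope.

(** * Differentiation rules *)

Section Calculus.
Variable R : realType.
Implicit Types (f g : R -> R) (x a b : R).

(** In the rules below the function is an explicit lambda term, so that they
    compose by mere application; the expressions found are matched with the
    wanted ones once, at the end, by this lemma. *)
Lemma dv_ext f g x a b : is_derive x 1 f a -> f = g -> a = b ->
  is_derive x 1 g b.
Proof. by move=> ? <- <-. Qed.

Lemma dvD f g x a b : is_derive x 1 f a -> is_derive x 1 g b ->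
  is_derive x 1 (fun y => f y + g y) (a + b).
Proof. by move=> fa gb; exact: (is_deriveD fa gb). Qed.

Lemma dvB f g x a b : is_derive x 1 f a -> is_derive x 1 g b ->
  is_derive x 1 (fun y => f y - g y) (a - b).
Proof. by move=> fa gb; exact: (is_deriveB fa gb). Qed.

Lemma dvN f x a : is_derive x 1 f a -> is_derive x 1 (fun y => - f y) (- a).
Proof. by move=> fa; exact: (is_deriveN fa). Qed.

Lemma dvM f g x a b : is_derive x 1 f a -> is_derive x 1 g b ->
  is_derive x 1 (fun y => f y * g y) (a * g x + f x * b).
Proof.
move=> fa gb; apply: (dv_ext (is_deriveM fa gb)) => //.
by rewrite /GRing.scale/= addrC; congr (_ + _); rewrite mulrC.
Qed.

Lemma dvC (c : R) x : is_derive x 1 (fun _ : R => c) 0.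
Proof. exact: is_derive_cst. Qed.

Lemma dvI x : is_derive x 1 (fun y : R => y) 1.
Proof. exact: is_derive_id. Qed.

Lemma dvc f g x a b : is_derive (g x) 1 f a -> is_derive x 1 g b ->
  is_derive x 1 (fun y => f (g y)) (a * b).
Proof. by move=> fa gb; exact: (is_derive1_comp fa gb). Qed.

Lemma dvZ (c : R) f x a : is_derive x 1 f a ->
  is_derive x 1 (fun y => c * f y) (c * a).
Proof.
by move=> fa; apply: (dv_ext (dvM (dvC c x) fa)) => //; rewrite mul0r add0r.
Qed.

Lemma dvV f x a : f x != 0 -> is_derive x 1 f a ->
  is_derive x 1 (fun y => (f y)^-1) (- a / f x ^+ 2).
Proof.
move=> f0 fa; apply: (dv_ext (is_deriveV f0 fa)) => //.
by rewrite /GRing.scale/= mulNr mulrC mulNr.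
Qed.

Lemma dvX f x a n : is_derive x 1 f a ->
  is_derive x 1 (fun y => f y ^+ n.+1) (n.+1%:R * f x ^+ n * a).
Proof.
move=> fa; by apply: (dv_ext (is_deriveX n.+1 fa)) => //; rewrite exprfctE.
Qed.

Lemma dv_powR f x a (r : R) : 0 < f x -> is_derive x 1 f a ->
  is_derive x 1 (fun y => f y `^ r) (r * f x `^ r / f x * a).
Proof.
move=> f0 fa.
apply: (dv_ext (dvc (f := fun y => y `^ r) (is_derive1_powR r f0) fa)) => //.
rewrite powRB; last by apply/implyP => _; rewrite gt_eqF.
by rewrite powRr1 ?ltW// mulrA.
Qed.

Lemma dv_near f g x a : (exists2 e, 0 < e & forall y, `|y - x| < e -> f y = g y) ->
  is_derive x 1 f a -> is_derive x 1 g a.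
Proof.
move=> [e e0 fg] fa; apply: (@near_eq_is_derive R R R f g x 1 a) => //.
near=> y; apply: fg.
by rewrite distrC; near: y; exact: nbhsx_ballx.
Unshelve. all: by end_near. Qed.

Lemma dv_cts f x a : is_derive x 1 f a -> {for x, continuous f}.
Proof.
by move=> [fx _]; apply/differentiable_continuous/derivable1_diffP.
Qed.

Lemma mvt f (df : R -> R) a b : a < b ->
  (forall x, a <= x <= b -> is_derive x 1 f (df x)) ->
  exists2 c, a < c < b & f b - f a = df c * (b - a).
Proof.
move=> ab fd; have [||c cab E] := @MVT _ f df a b ab.
- by move=> x; rewrite in_itv/= => /andP[? ?]; apply: fd; rewrite !ltW.
- apply: derivable_within_continuous => x; rewrite in_itv/= => /fd h.
  exact: ex_derive.
by exists c => //; move: cab; rewrite in_itv.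
Qed.

Lemma deriv_ge0_le f (df : R -> R) a b : a <= b ->
  (forall x, a <= x <= b -> is_derive x 1 f (df x)) ->
  (forall x, a < x < b -> 0 <= df x) -> f a <= f b.
Proof.
rewrite le_eqVlt => /orP[/eqP ->//|ab] fd d0.
have [c cab E] := mvt ab fd; rewrite -subr_ge0 E mulr_ge0 ?d0//.
by rewrite subr_ge0 ltW.
Qed.

Lemma deriv0_eq f (df : R -> R) a b : a <= b ->
  (forall x, a <= x <= b -> is_derive x 1 f (df x)) ->
  (forall x, a < x < b -> df x = 0) -> f a = f b.
Proof.
rewrite le_eqVlt => /orP[/eqP ->//|ab] fd d0.
have [c cab E] := mvt ab fd; apply/eqP; rewrite eq_sym -subr_eq0 E d0//.
by rewrite mul0r.
Qed.

End Calculus.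

(** * Power series *)

Section PowerSeries.
Variable R : realType.
Implicit Types (u v : nat -> R) (x r s : R).

Definition ps u x : R := limn (pseries u x).

(** Boundedness of the terms, rather than convergence, at every smaller radius:
    this passes to the differentiated series by an elementary estimate, and is
    what the growth of a recurrence gives. *)
Definition radius_ge u r :=
  forall s, 0 <= s < r -> exists M, forall n, `|u n| * s ^+ n <= M.

(** A factor [n], as produced by differentiation, costs an arbitrarily small
    loss of radius. *)
Lemma natX_bound (q : R) n : 0 <= q < 1 -> n.+1%:R * q ^+ n * (1 - q) <= 1.
Proof.
move=> /andP[q0 q1].
apply: (@le_trans _ _ (1 - q ^+ n.+1)); last by rewrite lerBlDr lerDl exprn_ge0.
elim: n => [|n IH]; first by rewrite expr0 mul1r mul1r expr1.
have -> : n.+2%:R * q ^+ n.+1 * (1 - q) =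
   q * (n.+1%:R * q ^+ n * (1 - q)) + q ^+ n.+1 * (1 - q).
  by rewrite -(natr1 n.+1) exprS; ring.
apply: (le_trans (lerD (ler_wpM2l q0 IH) (lexx _))).
have : q ^+ n.+1 * (1 - q) <= 1 * (1 - q).
  by apply: ler_wpM2r; [rewrite subr_ge0 ltW | apply: exprn_ile1 => //; exact: ltW].
rewrite (exprS q n.+1); set z := q ^+ n.+1; lra.
Qed.

Lemma radius_ge_diffs u r : radius_ge u r -> radius_ge (pseries_diffs u) r.
Proof.
move=> ur s /andP[s0 sr]; have [s' /andP[ss' s'r]] : exists s', s < s' < r.
  by exists ((s + r) / 2); apply/andP; split; lra.
have s'0 : 0 < s' by exact: le_lt_trans ss'.
have [|M HM] := ur s'; first by rewrite ltW.
have q1 : 0 <= s / s' < 1 by rewrite divr_ge0 ?(ltW s'0)//= ltr_pdivrMr// mul1r.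
have q1' : 0 < 1 - s / s' by rewrite subr_gt0; case/andP: q1.
exists (M / s' * (1 - s / s')^-1) => n.
rewrite /pseries_diffs normrM normr_nat ler_pdivlMr//.
have -> : n.+1%:R * `|u n.+1| * s ^+ n * (1 - s / s') =
  (`|u n.+1| * s' ^+ n.+1 / s') * (n.+1%:R * (s / s') ^+ n * (1 - s / s')).
  have s'n : s' ^+ n != 0 by rewrite expf_neq0// gt_eqF.
  by rewrite exprMn exprVn exprS; field; rewrite s'n gt_eqF.
have h1 : 0 <= `|u n.+1| * s' ^+ n.+1 / s'.
  by rewrite divr_ge0 ?mulr_ge0// ?exprn_ge0// ltW.
rewrite -[leRHS]mulr1; apply: ler_pM => //; last exact: natX_bound.
- by rewrite mulr_ge0 ?(ltW q1')// mulr_ge0// exprn_ge0//; case/andP: q1.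
- by apply: ler_wpM2r; [rewrite invr_ge0 ltW | exact: HM].
Qed.

Lemma ps_cvg u r x : radius_ge u r -> `|x| < r -> cvgn (pseries u x).
Proof.
move=> ur xr; have [s /andP[xs sr]] : exists s, `|x| < s < r.
  by exists ((`|x| + r) / 2); apply/andP; split; lra.
have s0 : 0 < s by exact: le_lt_trans xs.
have [|M HM] := ur s; first by rewrite ltW.
have M0 : 0 <= M by apply: le_trans (HM 0%N); rewrite mulr_ge0// exprn_ge0// ltW.
apply: normed_cvg; apply: (@series_le_cvg _ _ (geometric M (`|x| / s))).
- by move=> n /=.
- by move=> n /=; rewrite mulr_ge0// exprn_ge0// divr_ge0// ltW.
- move=> n /=; rewrite normrM normrX exprMn exprVn mulrA ler_pdivlMr ?exprn_gt0//.
  by rewrite mulrAC ler_wpM2r// exprn_ge0.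
apply: is_cvg_geometric_series.
by rewrite ger0_norm ?divr_ge0 ?(ltW s0)// ltr_pdivrMr// mul1r.
Qed.

Lemma is_derive_ps u r x : radius_ge u r -> `|x| < r ->
  is_derive x 1 (ps u) (ps (pseries_diffs u) x).
Proof.
move=> ur xr; have [s /andP[xs sr]] : exists s, `|x| < s < r.
  by exists ((`|x| + r) / 2); apply/andP; split; lra.
have s0 : 0 < s by exact: le_lt_trans xs.
have sr' : `|s| < r by rewrite gtr0_norm.
apply: (@pseries_snd_diffs _ _ s).
- exact: ps_cvg sr'.
- exact: ps_cvg (radius_ge_diffs ur) sr'.
- exact: ps_cvg (radius_ge_diffs (radius_ge_diffs ur)) sr'.
- by rewrite (gtr0_norm s0).
Qed.

Lemma psl_ps u r x : radius_ge u r -> `|x| < r ->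
  pseries u x @ \oo --> ps u x.
Proof. by move=> ur xr; exact: ps_cvg ur xr. Qed.

(** A linear relation between power series, with coefficients polynomial in the
    variable, is proved by writing it as one series with this lemma and
    [psl_shift], and by checking that all coefficients vanish ([psl_zero]). *)
Lemma psl_lin u v (a b : R) x (l m : R) :
  pseries u x @ \oo --> l -> pseries v x @ \oo --> m ->
  pseries (fun n => a * u n + b * v n) x @ \oo --> a * l + b * m.
Proof.
move=> cu cv; rewrite [X in X @ \oo --> _](_ : _ =
   (fun n => a * pseries u x n + b * pseries v x n)).
  by apply: cvgD; apply: cvgMr.
apply/funext => n; rewrite /pseries /series/= !mulr_sumr -big_split/=.
by apply: eq_bigr => i _; rewrite mulrDl !mulrA.
Qed.

Definition shift_seq u n := if n is n'.+1 then u n' else 0.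

Lemma psl_shift u x (l : R) : pseries u x @ \oo --> l ->
  pseries (shift_seq u) x @ \oo --> x * l.
Proof.
move=> cu; rewrite -cvg_shiftS.
rewrite [X in X @ \oo --> _](_ : _ = (fun n => x * pseries u x n)).
  exact: cvgMr.
apply/funext => n; rewrite /pseries /series /= big_nat_recl//= mul0r add0r.
by rewrite mulr_sumr; apply: eq_bigr => i _; rewrite exprS mulrCA.
Qed.

Lemma psl_zero u x (l : R) : pseries u x @ \oo --> l -> (forall n, u n = 0) ->
  l = 0.
Proof.
move=> ul u0; suff H : pseries u x @ \oo --> (0 : R) by exact: (cvg_unique _ ul H).
rewrite [X in X @ \oo --> _](_ : _ = (fun=> 0)); first exact: cvg_cst.
by apply/funext => n; rewrite /pseries/series/= big1// => i _; rewrite u0 mul0r.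
Qed.

Lemma psl_0 x : pseries (fun=> 0 : R) x @ \oo --> (0 : R).
Proof.
rewrite [X in X @ \oo --> _](_ : _ = (fun=> 0)); first exact: cvg_cst.
by apply/funext => n; rewrite /pseries/series/= big1// => i _; rewrite mul0r.
Qed.

Lemma ps_at0 u : ps u 0 = u 0%N.
Proof.
rewrite /ps; apply: cvg_lim => //; rewrite -cvg_shiftS.
rewrite [X in X @ \oo --> _](_ : _ = (fun=> u 0%N)); first exact: cvg_cst.
apply/funext => n; rewrite /pseries/series/= big_nat_recl//= expr0 mulr1.
by rewrite big1 ?addr0// => i _; rewrite exprS mul0r mulr0.
Qed.

Lemma cts_eps (f : R -> R) x : {for x, continuous f} -> forall e, 0 < e ->
  exists2 d, 0 < d & forall y, `|y - x| < d -> `|f y - f x| < e.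
Proof.
move=> /cvgrPdist_lt fx e /fx [d /= d0 H]; exists d => // y yx.
by rewrite distrC; apply: H; rewrite /= distrC.
Qed.

Lemma bounded_near0 (f : R -> R) : {for 0, continuous f} ->
  exists M d : R, 0 < d /\ forall t, `|t| < d -> `|f t| <= M.
Proof.
move=> fc; have [d d0 Hd] := cts_eps fc ltr01.
exists (`|f 0| + 1), d; split => // t td.
have := Hd t; rewrite subr0 => /(_ td) /ltW h.
by rewrite -[X in `|X|](subrK (f 0)) addrC; apply: le_trans (ler_normD _ _) _; rewrite lerD2l.
Qed.

Lemma dv_uniq (f : R -> R) x a b : is_derive x 1 f a -> is_derive x 1 f b -> a = b.
Proof. by move=> [_ <-] [_ <-]. Qed.

Lemma radius_geW u r s : s <= r -> radius_ge u r -> radius_ge u s.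
Proof.
move=> sr ur t /andP[t0 ts]; apply: ur; rewrite t0/=; exact: lt_le_trans sr.
Qed.

(** The constant coefficient vanishes by continuity at 0; the next ones are
    constant coefficients of derivatives, which vanish on ]0, r[ as well. *)
Lemma ps_coef0 u r : 0 < r -> radius_ge u r ->
  (forall x, 0 < x < r -> ps u x = 0) -> forall n, u n = 0.
Proof.
move=> r0 + + n; elim: n u => [|n IH] u ur u0.
  have c0 : {for 0, continuous (ps u)}.
    by apply: dv_cts (is_derive_ps (x := 0) ur _); rewrite normr0.
  apply/eqP; apply: contraT => un0.
  have [|d d0 H] := cts_eps c0 (e := `|u 0%N|); first by rewrite normr_gt0.
  pose x := Num.min d r / 2.
  have m0 : 0 < Num.min d r by rewrite lt_min d0.
  have x0 : 0 < x by rewrite divr_gt0.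
  have xm : x < Num.min d r by rewrite /x; lra.
  have := H x; rewrite subr0 gtr0_norm// (lt_le_trans xm) ?ge_min ?lexx//.
  rewrite ps_at0 u0; last by rewrite x0 (lt_le_trans xm)// ge_min lexx orbT.
  by rewrite sub0r normrN ltxx => /(_ isT).
have /IH : radius_ge (pseries_diffs u) r by exact: radius_ge_diffs.
rewrite /pseries_diffs => H; have : n.+1%:R * u n.+1 = 0.
  apply: H => x /andP[x0 xr]; apply: (@dv_uniq (ps u) x).
    by apply: is_derive_ps ur _; rewrite gtr0_norm.
  apply: dv_near (dvC 0 x).
  exists (Num.min x (r - x)); first by rewrite lt_min x0 subr_gt0.
  move=> y; rewrite lt_min => /andP[yx yr]; rewrite u0//.
  move: yx yr; rewrite !ltr_norml => /andP[y1 y2] /andP[y3 y4].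
  by apply/andP; split; lra.
by move/eqP; rewrite mulf_eq0 pnatr_eq0/= => /eqP.
Qed.

End PowerSeries.

Arguments psl_lin {R u v} a b {x l m}.

(** * Complex limits *)

Section ComplexLimits.
Variable R : realType.
Local Open Scope complex_scope.
Implicit Types (w : nat -> R[i]) (l z : R[i]).

Lemma Re_le_cabs z : `|complex.Re z| <= cabs z.
Proof.
by case: z => a b; rewrite /cabs /= -sqrtr_sqr ler_wsqrtr// lerDl sqr_ge0.
Qed.

Lemma Im_le_cabs z : `|complex.Im z| <= cabs z.
Proof.
by case: z => a b; rewrite /cabs /= -[X in X <= _]sqrtr_sqr ler_wsqrtr// lerDr sqr_ge0.
Qed.

Lemma cabs_le z : cabs z <= `|complex.Re z| + `|complex.Im z|.
Proof.
case: z => a b; rewrite /cabs /=.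
rewrite -(ger0_norm (addr_ge0 (normr_ge0 a) (normr_ge0 b))) -sqrtr_sqr.
apply: ler_wsqrtr; rewrite sqrrD !real_normK ?num_real// addrAC lerDl.
by rewrite mulrn_wge0// mulr_ge0.
Qed.

Lemma cvgC_ReIm w l : ((w : nat -> R[i]^o) @ \oo --> (l : R[i]^o)) <->
  ((fun n => complex.Re (w n)) @ \oo --> complex.Re l) /\
  ((fun n => complex.Im (w n)) @ \oo --> complex.Im l).
Proof.
split.
  move=> /cvgrPdist_lt H; split; apply/cvgrPdist_lt => e e0.
    have /H : (0 : R[i]) < e%:C by rewrite ltcR.
    apply: filterS => n; rewrite /Num.Def.normr/= ltcR; apply: le_lt_trans.
    by apply: le_trans (Re_le_cabs _); rewrite raddfB.
  have /H : (0 : R[i]) < e%:C by rewrite ltcR.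
  apply: filterS => n; rewrite /Num.Def.normr/= ltcR; apply: le_lt_trans.
  by apply: le_trans (Im_le_cabs _); rewrite raddfB.
move=> [/cvgrPdist_lt H1 /cvgrPdist_lt H2]; apply/cvgrPdist_lt => e e0.
have [e1 [e10 ->]] : exists e1 : R, 0 < e1 /\ e = e1%:C.
  case: e e0 => a b; rewrite ltcE/= => /andP[/eqP -> a0].
  by exists a.
have e2 : 0 < e1 / 2 by rewrite divr_gt0.
near=> n.
rewrite /Num.Def.normr/= ltcR; apply: le_lt_trans (cabs_le _) _.
rewrite !raddfB/= (splitr e1); apply: ltrD; near: n.
  exact: H1.
exact: H2.
Unshelve. all: by end_near. Qed.

Lemma csums_to_ReIm (u : nat -> R[i]) (x : R) l :
  csums_to (fun n => u n * (x ^+ n)%:C) l <->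
  (pseries (fun n => complex.Re (u n)) x @ \oo --> complex.Re l) /\
  (pseries (fun n => complex.Im (u n)) x @ \oo --> complex.Im l).
Proof.
rewrite /csums_to cvgC_ReIm.
have E1 : (fun n => complex.Re (series ((fun n => u n * (x ^+ n)%:C) : nat -> R[i]^o) n))
   = pseries (fun n => complex.Re (u n)) x.
  apply/funext => n; rewrite /pseries /series /= raddf_sum.
  by apply: eq_bigr => i _; case: (u i) => a b /=; rewrite mulr0 subr0.
have E2 : (fun n => complex.Im (series ((fun n => u n * (x ^+ n)%:C) : nat -> R[i]^o) n))
   = pseries (fun n => complex.Im (u n)) x.
  apply/funext => n; rewrite /pseries /series /= raddf_sum.
  by apply: eq_bigr => i _; case: (u i) => a b /=; rewrite mulr0 add0r mulrC.
by rewrite E1 E2.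
Qed.

Lemma natC n : (n%:R : R[i]) = (n%:R : R)%:C.
Proof. by rewrite rmorph_nat. Qed.

Lemma complex_half (a b : R) : (a +i* b) / 2 = (a / 2) +i* (b / 2).
Proof.
rewrite natC -fmorphV; apply/eqP; rewrite eq_complex /=.
by rewrite !mulr0 subr0 add0r !eqxx.
Qed.

End ComplexLimits.

(** * Solutions of the hypergeometric equation *)

Section Growth.
Variable R : realType.
Implicit Types (u : nat -> R).

Lemma archi_mul (e B : R) : 0 < e -> exists N : nat, forall n, (N <= n)%N -> B <= e * n%:R.
Proof.
move=> e0; exists (Num.bound (B / e)) => n Nn.
rewrite mulrC -ler_pdivrMr//; have [B0|B0] := leP 0 (B / e); last by apply: le_trans (ltW B0) _.
by apply: (le_trans (ltW (archi_boundP B0))); rewrite ler_nat.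
Qed.

(** If a recurrence propagates the bound [K * q ^+ n] from some rank on, the
    finitely many first terms only affect the constant. *)
Lemma growth u (q : R) (N : nat) : 0 < q ->
  (forall K n, 0 <= K -> (N <= n)%N ->
     (forall j, (j <= n)%N -> `|u j| <= K * q ^+ j) -> `|u n.+1| <= K * q ^+ n.+1) ->
  exists K, forall n, `|u n| <= K * q ^+ n.
Proof.
move=> q0 H; pose K := \sum_(j < N.+1) `|u j| / q ^+ j.
have K0 : 0 <= K by apply: sumr_ge0 => i _; rewrite divr_ge0// exprn_ge0// ltW.
exists K => n; elim/ltn_ind: n => n IH.
have [nN|Nn] := leqP n N.
  rewrite -ler_pdivrMr ?exprn_gt0// /K (bigD1 (inord n : 'I_N.+1))//= inordK//.
  by rewrite lerDl; apply: sumr_ge0 => i _; rewrite divr_ge0// exprn_ge0// ltW.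
case: n Nn IH => // n Nn IH; apply: H => // j jn; exact: IH.
Qed.

Lemma radius_of_growth u (q K : R) : 0 < q -> (forall n, `|u n| <= K * q ^+ n) ->
  radius_ge u q^-1.
Proof.
move=> q0 H s /andP[s0 sq]; exists K => n.
have K0 : 0 <= K by have := H 0%N; rewrite expr0 mulr1; apply: le_trans.
apply: (@le_trans _ _ (K * q ^+ n * s ^+ n)).
  by rewrite ler_wpM2r// exprn_ge0.
rewrite -mulrA -exprMn -[leRHS]mulr1 ler_wpM2l// exprn_ile1//.
  by rewrite mulr_ge0// ltW.
by rewrite mulrC -ler_pdivlMr// div1r ltW.
Qed.

Lemma radius_one u :
  (forall q, 1 < q -> exists K, forall n, `|u n| <= K * q ^+ n) -> radius_ge u 1.
Proof.
move=> H s /andP[s0 s1]; have q1 : 1 < 2 / (1 + s).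
  by rewrite ltr_pdivlMr; lra.
have [K /radius_of_growth Hr] := H _ q1.
apply: (Hr (lt_trans ltr01 q1)); rewrite s0 invf_div ltr_pdivlMr//; lra.
Qed.

End Growth.

Section Hypergeometric.
Variable R : realType.
Variables (c rho l2 : R).
Hypothesis c0 : 0 < c.
Implicit Types (x y z : R).

Let ab := (rho ^+ 2 + l2) / 4.
Let A := rho * (2 * c - rho).

Lemma nc_gt0 (n : nat) : 0 < (n%:R + c : R).
Proof. by rewrite ltr_wpDl. Qed.

Lemma nc_neq0 (n : nat) : (n%:R + c : R) != 0.
Proof. by rewrite gt_eqF// nc_gt0. Qed.

(** For a = (rho + i lambda) / 2 and b its conjugate,
    (a + n) (b + n) = (rho / 2 + n)^2 + lambda^2 / 4 is real; [l2] stands for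
    lambda^2. *)
Fixpoint gauss_coef (n : nat) : R :=
  if n is m.+1 then
    ((rho / 2 + m%:R) ^+ 2 + l2 / 4) / (m.+1%:R * (m%:R + c)) * gauss_coef m
  else 1.

Lemma gauss_rec n : n.+1%:R * (n%:R + c) * gauss_coef n.+1 =
  ((rho / 2 + n%:R) ^+ 2 + l2 / 4) * gauss_coef n.
Proof.
by rewrite [gauss_coef n.+1]/= mulrA mulrCA mulfV ?mulr1// mulf_neq0 ?nc_neq0// pnatr_eq0.
Qed.

Lemma gauss_radius : radius_ge gauss_coef 1.
Proof.
apply: radius_one => q q1.
pose B := `|rho| + (rho ^+ 2 + `|l2|) / 4.
have B1 : 0 <= (rho ^+ 2 + `|l2|) / 4 by rewrite divr_ge0// addr_ge0// sqr_ge0.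
have q0 : 0 < q by exact: lt_trans q1.
have [N HN] := @archi_mul R (q - 1) B ltac:(lra).
apply: (@growth _ _ q N.+1) => // K n K0 Nn Hj.
have n1 : (1 : R) <= n%:R by rewrite ler1n; exact: leq_trans Nn.
have nn0 : 0 < n.+1%:R * (n%:R + c) by rewrite mulr_gt0// nc_gt0.
rewrite -(ler_pM2l nn0) -[X in X * `|_|]gtr0_norm// -normrM gauss_rec normrM.
have bnd : `|(rho / 2 + n%:R) ^+ 2 + l2 / 4| <= q * (n.+1%:R * (n%:R + c)).
  have := HN n (ltnW Nn); rewrite /B; set b := (_ + `|l2|) / 4 => hb.
  have e1 : `|(rho / 2 + n%:R) ^+ 2 + l2 / 4| <= n%:R ^+ 2 + `|rho| * n%:R + b.
    apply: le_trans (ler_normD _ _) _.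
    rewrite (ger0_norm (sqr_ge0 _)) normrM (ger0_norm (_ : 0 <= 4^-1))//.
    have := ler_norm rho; rewrite /b; nra.
  apply: le_trans e1 _; rewrite -natr1; set m := n%:R in hb n1 *.
  have h1 := ler_wpM2r (le_trans ler01 n1) hb.
  have h2 : 0 <= b * (m - 1) by rewrite mulr_ge0// subr_ge0.
  have h3 : 0 <= q * (m * c + m + c).
    have m0 : 0 <= m by exact: le_trans n1.
    by rewrite mulr_ge0 ?(ltW q0)// !addr_ge0// ?mulr_ge0// ltW.
  by move: h1 h2 h3; lra.
apply: le_trans (ler_pM _ _ bnd (Hj n (leqnn n))) _ => //.
by rewrite le_eqVlt exprS; apply/orP; left; apply/eqP; ring.
Qed.

(** Coefficients, paired with their partial sums, of the function v such that
    F(a, b; c; x) = (1 - x)^(- rho / 2) v(x / (x - 1)). In the usual form of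
    Pfaff's transformation the exponent is the complex number - a; with its real
    part instead, v is real, but its equation involves v(z) / (1 - z), whence
    the partial sums in the recurrence. *)
Fixpoint pfaff_pair (n : nat) : R * R :=
  if n is m.+1 then
    let: (v, s) := pfaff_pair m in
    let w := ((m%:R * (m%:R + c) + A / 4) * v - l2 / 4 * s)
              / (m.+1%:R * (m%:R + c)) in (w, s + w)
  else (1, 1).

Definition pfaff_coef n := (pfaff_pair n).1.
Definition pfaff_sum n := (pfaff_pair n).2.

Lemma pfaff_rec n : n.+1%:R * (n%:R + c) * pfaff_coef n.+1 =
  (n%:R * (n%:R + c) + A / 4) * pfaff_coef n - l2 / 4 * pfaff_sum n.
Proof.
rewrite /pfaff_coef /pfaff_sum /=; case: (pfaff_pair n) => v s /=.
by rewrite mulrCA mulfV ?mulr1// mulf_neq0 ?nc_neq0// pnatr_eq0.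
Qed.

Lemma pfaff_sumS n : pfaff_sum n.+1 = pfaff_sum n + pfaff_coef n.+1.
Proof. by rewrite /pfaff_coef /pfaff_sum /=; case: (pfaff_pair n). Qed.

Lemma pfaff_sumE n : pfaff_sum n = \sum_(j < n.+1) pfaff_coef j.
Proof.
elim: n => [|n IH]; first by rewrite big_ord1.
by rewrite pfaff_sumS IH [RHS]big_ord_recr.
Qed.

Lemma geo_sum_le (q : R) n : 1 < q -> \sum_(j < n.+1) q ^+ j <= q ^+ n * (q / (q - 1)).
Proof.
move=> q1; have q10 : 0 < q - 1 by lra.
have q0 : 0 < q by lra.
elim: n => [|n IH]; first by rewrite big_ord1 expr0 mul1r ler_pdivlMr//; lra.
rewrite big_ord_recr/=; apply: le_trans (lerD IH (lexx _)) _.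
rewrite exprS le_eqVlt; apply/orP; left; apply/eqP; field; rewrite gt_eqF//.
Qed.

Lemma pfaff_growth q : 1 < q ->
  exists K, forall n, `|pfaff_coef n| <= K * q ^+ n.
Proof.
move=> q1; have q0 : 0 < q by lra.
have q10 : 0 < q - 1 by lra.
pose B := `|A| / 4 + `|l2| / 4 * (q / (q - 1)).
have B0 : 0 <= B by rewrite addr_ge0// ?mulr_ge0// ?invr_ge0 ltW.
have [N HN] := @archi_mul R (q - 1) B q10.
apply: (@growth _ _ q N.+1) => // K n K0 Nn Hj.
have n1 : (1 : R) <= n%:R by rewrite ler1n; exact: leq_trans Nn.
have nn0 : 0 < n.+1%:R * (n%:R + c) by rewrite mulr_gt0// nc_gt0.
rewrite -(ler_pM2l nn0) -[X in X * `|_|]gtr0_norm// -normrM pfaff_rec.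
have hS : `|pfaff_sum n| <= K * (q ^+ n * (q / (q - 1))).
  rewrite pfaff_sumE; apply: le_trans (ler_norm_sum _ _ _) _.
  apply: (@le_trans _ _ (\sum_(j < n.+1) K * q ^+ j)).
    by apply: ler_sum => j _; apply: Hj; rewrite -ltnS.
  by rewrite -mulr_sumr ler_wpM2l// geo_sum_le.
apply: le_trans (ler_normB _ _) _; rewrite !normrM.
have hv := Hj n (leqnn n).
have hA : `|n%:R * (n%:R + c) + A / 4| <= n%:R * (n%:R + c) + `|A| / 4.
  apply: le_trans (ler_normD _ _) _; rewrite ger0_norm; last by rewrite mulr_ge0// ltW// nc_gt0.
  by rewrite lerD2l normrM (ger0_norm (_ : 0 <= 4^-1)).
apply: (le_trans (lerD (ler_pM _ _ hA hv) (ler_wpM2l _ hS))) => //.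
have -> : n.+1%:R * (n%:R + c) * (K * q ^+ n.+1) = (q * (n.+1%:R * (n%:R + c))) * (K * q ^+ n).
  by rewrite exprS; ring.
have -> : (n%:R * (n%:R + c) + `|A| / 4) * (K * q ^+ n) +
   `|l2| * `|4^-1| * (K * (q ^+ n * (q / (q - 1)))) = (n%:R * (n%:R + c) + B) * (K * q ^+ n).
  by rewrite (ger0_norm (_ : 0 <= 4^-1))// /B; ring.
apply: ler_wpM2r; first by rewrite mulr_ge0// exprn_ge0// ltW.
have := HN n (ltnW Nn); rewrite -natr1; set m := n%:R in n1 * => hb.
have m0 : 0 <= m by exact: le_trans n1.
have h1 := ler_wpM2r m0 hb.
have h2 : 0 <= B * (m - 1) by rewrite mulr_ge0// subr_ge0.
have h3 : 0 <= (q - 1) * (m * c) + q * (m + c).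
  by rewrite addr_ge0// mulr_ge0 ?(ltW q0) ?(ltW q10)// ?addr_ge0// ?mulr_ge0// ltW.
by move: h1 h2 h3; lra.
Qed.

Lemma pfaff_radius : radius_ge pfaff_coef 1.
Proof. by apply: radius_one => q; exact: pfaff_growth. Qed.

Lemma pfaff_sum_radius : radius_ge pfaff_sum 1.
Proof.
apply: radius_one => q q1; have [K HK] := pfaff_growth q1.
exists (K * (q / (q - 1))) => n; rewrite pfaff_sumE.
apply: le_trans (ler_norm_sum _ _ _) _.
apply: (@le_trans _ _ (\sum_(j < n.+1) K * q ^+ j)); first exact: ler_sum.
have K0 : 0 <= K by have := HK 0%N; rewrite expr0 mulr1; apply: le_trans.
by rewrite -mulr_sumr -mulrA [_ / _ * _]mulrC; apply: ler_wpM2l => //; exact: geo_sum_le.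
Qed.

Definition gauss x := ps gauss_coef x.
Definition gauss1 x := ps (pseries_diffs gauss_coef) x.

Definition hyp_rhs x y y1 := (ab * y - (c - (rho + 1) * x) * y1) / (x * (1 - x)).

(** The derivative is carried along, which makes the equation a first order
    system, and solutions with their derivatives easy to glue and subtract. *)
Definition hyp_sol (y y1 : R -> R) x :=
  is_derive x 1 y (y1 x) /\ is_derive x 1 y1 (hyp_rhs x (y x) (y1 x)).

Lemma gauss_sol x : `|x| < 1 -> x != 0 -> hyp_sol gauss gauss1 x.
Proof.
move=> x1 x0; have r1 := radius_ge_diffs gauss_radius.
have r2 := radius_ge_diffs r1.
split; first exact: is_derive_ps gauss_radius x1.
apply: dv_ext (is_derive_ps r1 x1) _ _ => //.
have L0 := psl_ps gauss_radius x1; have L1 := psl_ps r1 x1; have L2 := psl_ps r2 x1.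
have := psl_lin 1 1 (psl_lin 1 (-1) (psl_shift L2) (psl_shift (psl_shift L2)))
   (psl_lin 1 (- ab) (psl_lin c (- (rho + 1)) L1 (psl_shift L1)) L0).
move=> /psl_zero; rewrite /hyp_rhs /gauss /gauss1.
set y2 := ps _ _; set y1 := ps _ _; set y := ps _ _ => E.
have {}E : x * (1 - x) * y2 = ab * y - (c - (rho + 1) * x) * y1.
  apply/eqP; rewrite -subr_eq0 -{}E; first by apply/eqP; ring.
  have grec := gauss_rec; move: (gauss_coef) grec => g grec n.
  rewrite -[RHS](subrr (n.+1%:R * (n%:R + c) * g n.+1)) [X in _ = _ - X]grec.
  by case: n => [|[|n]] /=; rewrite /pseries_diffs /ab /= -?(natr1 n.+2) -?(natr1 n.+1) -?(natr1 n);
    field.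
rewrite -E mulrAC mulfV ?mul1r// mulf_neq0//.
by rewrite subr_eq0 eq_sym lt_eqF//; move: x1; rewrite ltr_norml => /andP[].
Qed.

Definition pf z := ps pfaff_coef z.
Definition pf1 z := ps (pseries_diffs pfaff_coef) z.
Definition pf2 z := ps (pseries_diffs (pseries_diffs pfaff_coef)) z.

Lemma is_derive_pf z : `|z| < 1 -> is_derive z 1 pf (pf1 z).
Proof. exact: is_derive_ps pfaff_radius. Qed.

Lemma is_derive_pf1 z : `|z| < 1 -> is_derive z 1 pf1 (pf2 z).
Proof. exact: is_derive_ps (radius_ge_diffs pfaff_radius). Qed.

Lemma pfaff_ode z : `|z| < 1 ->
  z * (1 - z) ^+ 2 * pf2 z + (1 - z) * (c - (c + 1) * z) * pf1 z =
  (A / 4 * (1 - z) - l2 / 4) * pf z.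
Proof.
move=> z1; have r1 := radius_ge_diffs pfaff_radius.
have r2 := radius_ge_diffs r1.
have L0 := psl_ps pfaff_radius z1; have L1 := psl_ps r1 z1; have L2 := psl_ps r2 z1.
have LS := psl_ps pfaff_sum_radius z1.
have := psl_lin 1 (-1) (psl_lin 1 (-1) LS (psl_shift LS)) L0.
move=> /psl_zero ES.
have := psl_lin 1 1 (psl_lin 1 (-1) (psl_shift L2) (psl_shift (psl_shift L2)))
   (psl_lin 1 1 (psl_lin c (- (c + 1)) L1 (psl_shift L1)) (psl_lin (- (A / 4)) (l2 / 4) L0 LS)).
move=> /psl_zero; rewrite /pf /pf1 /pf2.
set y2 := ps _ z; set y1 := ps _ z; set y := ps _ z; set S := ps _ z => E.
have {}ES : (1 - z) * S = y.
  apply/eqP; rewrite -subr_eq0 -{}ES; first by apply/eqP; rewrite /y /S; ring.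
  move=> [|n] /=; first by rewrite /pfaff_sum /pfaff_coef/=; ring.
  by rewrite pfaff_sumS; ring.
have {}E : z * (1 - z) * y2 + (c - (c + 1) * z) * y1 = A / 4 * y - l2 / 4 * S.
  apply/eqP; rewrite -subr_eq0 -{}E; first by apply/eqP; ring.
  move=> n; rewrite -[RHS](subrr (n.+1%:R * (n%:R + c) * pfaff_coef n.+1)).
  rewrite [X in _ = _ - X]pfaff_rec.
  by case: n => [|[|n]] /=; rewrite /pseries_diffs /= -?(natr1 n.+2) -?(natr1 n.+1) -?(natr1 n);
    ring.
have -> : (A / 4 * (1 - z) - l2 / 4) * y = (1 - z) * (A / 4 * y - l2 / 4 * S).
  by rewrite -ES; ring.
by rewrite -E; ring.
Qed.

(** With i = 1 / (1 - x), the argument x / (x - 1) of the series is 1 - i. *)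
Definition pfaff x := (1 - x) `^ (- (rho / 2)) * pf (1 - (1 - x)^-1).
Definition pfaff1 x := (1 - x) `^ (- (rho / 2)) *
  (rho / 2 * (1 - x)^-1 * pf (1 - (1 - x)^-1) - (1 - x)^-1 ^+ 2 * pf1 (1 - (1 - x)^-1)).
Definition pfaff2 x := (1 - x) `^ (- (rho / 2)) *
  (let i := (1 - x)^-1 in
   rho / 2 * i * (rho / 2 * i * pf (1 - i) - i ^+ 2 * pf1 (1 - i)) +
   (rho / 2 * (i ^+ 2 * pf (1 - i) - i ^+ 3 * pf1 (1 - i))
     - (2 * i ^+ 3 * pf1 (1 - i) - i ^+ 4 * pf2 (1 - i)))).

Lemma mobius_lt1 x : x < 1 / 2 -> `|1 - (1 - x)^-1| < 1.
Proof.
move=> x2; have x1 : 0 < 1 - x by lra.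
have i0 : 0 < (1 - x)^-1 by rewrite invr_gt0.
rewrite ltr_norml; apply/andP; split; last by rewrite ltrBlDr ltrDl.
have : (1 - x)^-1 < 2 by rewrite invf_plt ?posrE//; lra.
lra.
Qed.

Lemma dv_one_sub x : is_derive x 1 (fun y : R => 1 - y) (-1).
Proof. by apply: (dv_ext (dvB (dvC 1 x) (dvI x))) => //; rewrite sub0r. Qed.

Lemma dv_inv_one_sub x : x < 1 ->
  is_derive x 1 (fun y : R => (1 - y)^-1) ((1 - x)^-1 ^+ 2).
Proof.
move=> x1; have h : 1 - x != 0 by rewrite gt_eqF// subr_gt0.
apply: (dv_ext (dvV (f := fun y => 1 - y) h (dv_one_sub x))) => //.
by rewrite opprK exprVn mul1r.
Qed.

Lemma dv_pow_one_sub x s : x < 1 ->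
  is_derive x 1 (fun y : R => (1 - y) `^ s) (- s * (1 - x)^-1 * (1 - x) `^ s).
Proof.
move=> x1; have h : 0 < 1 - x by rewrite subr_gt0.
apply: (dv_ext (dv_powR (f := fun y => 1 - y) s h (dv_one_sub x))) => //; ring.
Qed.

Lemma dv_mobius x : x < 1 ->
  is_derive x 1 (fun y : R => 1 - (1 - y)^-1) (- (1 - x)^-1 ^+ 2).
Proof.
move=> x1; apply: (dv_ext (dvB (dvC 1 x) (dv_inv_one_sub x1))) => //.
by rewrite sub0r.
Qed.

Lemma is_derive_pfaff x : x < 1 / 2 -> is_derive x 1 pfaff (pfaff1 x).
Proof.
move=> x2; have x1 : x < 1 by lra.
have D := dvc (g := fun y => 1 - (1 - y)^-1) (is_derive_pf (mobius_lt1 x2)) (dv_mobius x1).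
apply: (dv_ext (dvM (dv_pow_one_sub (- (rho / 2)) x1) D)) => //.
by rewrite /pfaff1; ring.
Qed.

Lemma is_derive_pfaff1 x : x < 1 / 2 -> is_derive x 1 pfaff1 (pfaff2 x).
Proof.
move=> x2; have x1 : x < 1 by lra.
have D := dvc (g := fun y => 1 - (1 - y)^-1) (is_derive_pf (mobius_lt1 x2)) (dv_mobius x1).
have D1 := dvc (g := fun y => 1 - (1 - y)^-1) (is_derive_pf1 (mobius_lt1 x2)) (dv_mobius x1).
have I := dv_inv_one_sub x1.
have := dvM (dv_pow_one_sub (- (rho / 2)) x1)
  (dvB (dvM (dvZ (rho / 2) I) D) (dvM (dvX 1 I) D1)).
move/dv_ext; apply => //.
by rewrite /pfaff2 /=; ring.
Qed.

Lemma pfaff_sol x : x < 1 / 2 -> x != 0 -> hyp_sol pfaff pfaff1 x.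
Proof.
move=> x2 x0; split; first exact: is_derive_pfaff.
apply: (dv_ext (is_derive_pfaff1 x2)) => //.
have := pfaff_ode (mobius_lt1 x2).
have x1 : 1 - x != 0 by rewrite gt_eqF//; lra.
rewrite /hyp_rhs /pfaff /pfaff1 /pfaff2 /=; set i := (1 - x)^-1.
set e := _ `^ _; set v := pf _; set v1 := pf1 _; set v2 := pf2 _ => E.
have i0 : i != 0 by rewrite invr_eq0.
have xi : x = 1 - i^-1 by rewrite /i invrK; ring.
apply: (mulIf (_ : x * (1 - x) != 0)); first by rewrite mulf_neq0.
rewrite divfK; last by rewrite mulf_neq0.
apply/eqP; rewrite -subr_eq0; apply/eqP.
transitivity (- e * ((1 - i) * (1 - (1 - i)) ^+ 2 * v2 +
   (1 - (1 - i)) * (c - (c + 1) * (1 - i)) * v1 -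
   (A / 4 * (1 - (1 - i)) - l2 / 4) * v)); last by rewrite E subrr mulr0.
by rewrite xi /ab /A; field.
Qed.

(** The energy E = y^2 + y'^2 satisfies |E'| <= L E. Thus E exp(- L x) is
    nonincreasing and E exp(L x) nondecreasing: an energy that vanishes at [x0]
    vanishes on both sides. *)
Lemma energy_unique (y y1 P Q : R -> R) (a b x0 K : R) :
  a <= x0 <= b ->
  (forall x, a <= x <= b -> is_derive x 1 y (y1 x) /\
     is_derive x 1 y1 (Q x * y x + P x * y1 x)) ->
  (forall x, a <= x <= b -> `|P x| <= K /\ `|Q x| <= K) ->
  y x0 = 0 -> y1 x0 = 0 -> forall x, a <= x <= b -> y x = 0 /\ y1 x = 0.
Proof.
move=> /andP[ax0 x0b] H HK y0 y10.
pose L := 1 + 3 * K; pose E x := y x * y x + y1 x * y1 x.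
pose dE x := y1 x * y x + y x * y1 x + ((Q x * y x + P x * y1 x) * y1 x
   + y1 x * (Q x * y x + P x * y1 x)).
have DE x : a <= x <= b -> is_derive x 1 E (dE x).
  by move=> /H[d1 d2]; exact: dvD (dvM d1 d1) (dvM d2 d2).
have BE x : a <= x <= b -> `|dE x| <= L * E x.
  move=> /HK[hP hQ]; have -> : dE x = (1 + Q x) * (2 * (y x * y1 x)) + 2 * P x * (y1 x ^+ 2).
    by rewrite /dE; ring.
  have K0 : 0 <= K by exact: le_trans hP.
  have h1 : `|2 * (y x * y1 x)| <= E x.
    rewrite ler_norml /E; apply/andP; split.
      by have := sqr_ge0 (y x + y1 x); lra.
    by have := sqr_ge0 (y x - y1 x); lra.
  have h2 : `|1 + Q x| <= 1 + K by apply: le_trans (ler_normD _ _) _; rewrite normr1 lerD2l.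
  apply: le_trans (ler_normD _ _) _; rewrite normrM.
  apply: (le_trans (lerD (ler_pM (normr_ge0 _) (normr_ge0 _) h2 h1) (lexx _))).
  rewrite (normrM (2 * P x)) (normrM 2) (ger0_norm (sqr_ge0 (y1 x))) (ger0_norm (_ : 0 <= 2))//.
  have := ler_wpM2r (sqr_ge0 (y1 x)) hP; have := mulr_ge0 K0 (sqr_ge0 (y x)).
  by rewrite /L /E; lra.
have EN x : 0 <= E x by rewrite /E -!expr2 addr_ge0// sqr_ge0.
have E0 : E x0 = 0 by rewrite /E y0 y10 !mulr0 addr0.
have dexp (k x : R) : is_derive x 1 (fun t => expR (k * t)) (expR (k * x) * k).
  apply: (dv_ext (dvc (is_derive_expR (k * x)) (dvZ k (dvI x)))) => //.
  by rewrite mulr1.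
suff EZ x : a <= x <= b -> E x <= 0.
  move=> x /EZ; rewrite /E -!expr2 => e0.
  have h1 := sqr_ge0 (y x); have h2 := sqr_ge0 (y1 x).
  by split; apply/eqP; rewrite -sqrf_eq0; apply/eqP; lra.
move=> /andP[ax xb]; have [xx0|/ltW x0x] := leP x x0.
  have : E x * expR (L * x) <= E x0 * expR (L * x0).
    apply: (deriv_ge0_le xx0 (f := fun t => E t * expR (L * t))
      (df := fun t => dE t * expR (L * t) + E t * (expR (L * t) * L))).
      move=> t /andP[xt tx0]; apply: dvM (dexp _ _).
      by apply: DE; rewrite (le_trans ax xt) (le_trans tx0).
    move=> t /andP[/ltW xt /ltW tx0].
    have /BE : a <= t <= b by rewrite (le_trans ax xt) (le_trans tx0).
    rewrite ler_norml => /andP[h _].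
    have -> : dE t * expR (L * t) + E t * (expR (L * t) * L) = (dE t + L * E t) * expR (L * t) by ring.
    by rewrite mulr_ge0 ?expR_ge0//; lra.
  by rewrite E0 mul0r pmulr_lle0// expR_gt0.
have : - (E x0 * expR (- L * x0)) <= - (E x * expR (- L * x)).
  apply: (deriv_ge0_le x0x (f := fun t => - (E t * expR (- L * t)))
    (df := fun t => - (dE t * expR (- L * t) + E t * (expR (- L * t) * - L)))).
    move=> t /andP[xt tx0]; apply/dvN/(dvM _ (dexp _ _)).
    by apply: DE; rewrite (le_trans ax0 xt) (le_trans tx0).
  move=> t /andP[/ltW xt /ltW tx0].
  have /BE : a <= t <= b by rewrite (le_trans ax0 xt) (le_trans tx0).
  rewrite ler_norml => /andP[_ h].
  have -> : - (dE t * expR (- L * t) + E t * (expR (- L * t) * - L)) = (L * E t - dE t) * expR (- L * t) by ring.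
  by rewrite mulr_ge0 ?expR_ge0//; lra.
by rewrite E0 mul0r oppr0 oppr_ge0 pmulr_lle0// expR_gt0.
Qed.

(** Away from the singular points 0 and 1 the equation has bounded
    coefficients. *)
Lemma hyp_unique (y y1 : R -> R) (a b x0 : R) :
  (0 < a /\ b < 1) \/ b < 0 -> a <= x0 <= b ->
  (forall x, a <= x <= b -> hyp_sol y y1 x) ->
  y x0 = 0 -> y1 x0 = 0 -> forall x, a <= x <= b -> y x = 0 /\ y1 x = 0.
Proof.
move=> side x0ab H.
have [m m0 Hm] : exists2 m, 0 < m & forall x, a <= x <= b -> m <= `|x * (1 - x)|.
  case: side => [[a0 b1]|b0].
    exists (a * (1 - b)) => [|x /andP[ax xb]]; first by rewrite mulr_gt0// subr_gt0.
    rewrite ger0_norm; first by apply: ler_pM; lra.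
    by rewrite mulr_ge0; lra.
  exists (- b * 1) => [|x /andP[ax xb]]; first by rewrite mulr1 oppr_gt0.
  by rewrite normrM ler0_norm ?ger0_norm; try lra; apply: ler_pM; lra.
pose K := (`|ab| + (c + `|rho + 1| * (`|a| + `|b|))) / m.
apply: (@energy_unique y y1 (fun x => - (c - (rho + 1) * x) / (x * (1 - x)))
   (fun x => ab / (x * (1 - x))) a b x0 K) => //.
  move=> x /H[h1 h2]; split => //; apply: (dv_ext h2) => //.
  by rewrite /hyp_rhs; ring.
move=> x xab; have mx := Hm x xab.
have M N B : `|N| <= B -> `|N / (x * (1 - x))| <= B / m.
  move=> NB; rewrite normrM normfV; apply: ler_pM => //.
  by rewrite lef_pV2 ?posrE//; apply: lt_le_trans mx.
have xm : `|x| <= `|a| + `|b|.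
  case/andP: xab => ax xb; rewrite ler_norml; apply/andP; split.
    by have := ler_norm (- a); rewrite normrN; have := normr_ge0 b; lra.
  by have := ler_norm b; have := normr_ge0 a; lra.
have h : `|c - (rho + 1) * x| <= c + `|rho + 1| * (`|a| + `|b|).
  apply: le_trans (ler_normB _ _) _; rewrite gtr0_norm// lerD2l normrM.
  exact: ler_wpM2l.
split; apply: M.
  by rewrite normrN; apply: le_trans h _; rewrite lerDr.
rewrite lerDl addr_ge0// ?mulr_ge0 ?addr_ge0//; exact: ltW.
Qed.

Section LocalSeries.
Variables (x0 y0 y0' : R).
Hypotheses (x01 : x0 < 1) (x00 : x0 != 0).
Let A0 := x0 * (1 - x0).
Let A1 := 1 - 2 * x0.
Let B0 := c - (rho + 1) * x0.

(** Taylor coefficients at [x0] of the solution with Cauchy data [y0], [y0'].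
    The recurrence has order two, whence the pairs of consecutive
    coefficients. *)
Fixpoint local_pair (n : nat) : R * R :=
  if n is m.+1 then
    let: (u, v) := local_pair m in
    (v, ((m%:R * (m%:R - 1) + (rho + 1) * m%:R + ab) * u
         - (A1 * m%:R + B0) * m.+1%:R * v) / (A0 * m.+2%:R * m.+1%:R))
  else (y0, y0').

Definition local_coef n := (local_pair n).1.

Lemma local_pairE n : local_pair n = (local_coef n, local_coef n.+1).
Proof. by rewrite /local_coef /=; case: (local_pair n). Qed.

Lemma A0_neq0 : A0 != 0.
Proof. by rewrite mulf_neq0// subr_eq0 eq_sym lt_eqF. Qed.

Lemma local_rec n : A0 * n.+2%:R * n.+1%:R * local_coef n.+2 =
  (n%:R * (n%:R - 1) + (rho + 1) * n%:R + ab) * local_coef n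
  - (A1 * n%:R + B0) * n.+1%:R * local_coef n.+1.
Proof.
rewrite {1}/local_coef [local_pair n.+2]/= local_pairE /=.
have D0 : A0 * n.+2%:R * n.+1%:R != 0.
  by rewrite mulf_neq0 ?pnatr_eq0// mulf_neq0 ?pnatr_eq0// A0_neq0.
by rewrite mulrCA mulfV ?mulr1.
Qed.

Lemma local_growth : exists2 q, 0 < q & exists K, forall n, `|local_coef n| <= K * q ^+ n.
Proof.
have A00 := A0_neq0; have nA0 : 0 < `|A0| by rewrite normr_gt0.
pose k1 := (`|A1| + `|B0|) / `|A0|; pose k2 := (1 + `|rho + 1| + `|ab|) / `|A0|.
have k10 : 0 <= k1 by rewrite divr_ge0// addr_ge0.
have k20 : 0 <= k2 by rewrite divr_ge0// !addr_ge0.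
pose q := 1 + k1 + k2; have q1 : 1 <= q by rewrite /q; lra.
have q0 : 0 < q by lra.
exists q => //; apply: (@growth _ _ q 1) => // K [//|n] K0 _ Hj.
have h1 := Hj n (leqnSn n); have h2 := Hj n.+1 (leqnn _).
have D0 : 0 < `|A0| * n.+2%:R * n.+1%:R by rewrite !mulr_gt0.
rewrite -(ler_pM2l D0).
have -> : `|A0| * n.+2%:R * n.+1%:R * `|local_coef n.+2| =
   `|A0 * n.+2%:R * n.+1%:R * local_coef n.+2| by rewrite !normrM !normr_nat.
rewrite local_rec; apply: le_trans (ler_normB _ _) _; rewrite (normrM _ (local_coef n)) (normrM _ (local_coef n.+1)).
set M := n.+2%:R * n.+1%:R : R; set m := n%:R : R.
have m0 : 0 <= m by [].
have ME : M = m ^+ 2 + 3 * m + 2 by rewrite /M -(natr1 n.+1) -(natr1 n) -/m; ring.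
have T2 : `|m * (m - 1) + (rho + 1) * m + ab| <= (1 + `|rho + 1| + `|ab|) * M.
  apply: le_trans (ler_normD _ _) _; rewrite !(mulrDl _ _ M); apply: lerD; last first.
    by rewrite ler_peMr// ME; have := mulr_ge0 m0 m0; lra.
  apply: le_trans (ler_normD _ _) _; apply: lerD.
    by rewrite ler_norml; apply/andP; split; rewrite ME; have := mulr_ge0 m0 m0; lra.
  by rewrite normrM (ger0_norm m0) ler_wpM2l// ME; have := mulr_ge0 m0 m0; lra.
have T1 : `|(A1 * m + B0) * n.+1%:R| <= (`|A1| + `|B0|) * M.
  rewrite normrM normr_nat /M mulrA ler_wpM2r//.
  apply: le_trans (ler_normD _ _) _; rewrite (mulrDl `|A1|) normrM (ger0_norm m0).
  have m2 : n.+2%:R = m + 2 by rewrite -(natr1 n.+1) -(natr1 n) -/m; ring.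
  apply: lerD; first by rewrite ler_wpM2l// m2; lra.
  by rewrite ler_peMr// m2; lra.
apply: (le_trans (lerD (ler_pM _ _ T2 h1) (ler_pM _ _ T1 h2))) => //.
have -> : (1 + `|rho + 1| + `|ab|) = k2 * `|A0| by rewrite /k2 divfK// gt_eqF.
have -> : (`|A1| + `|B0|) = k1 * `|A0| by rewrite /k1 divfK// gt_eqF.
have -> : k2 * `|A0| * M * (K * q ^+ n) + k1 * `|A0| * M * (K * q ^+ n.+1) =
   (k2 + k1 * q) * (`|A0| * M * (K * q ^+ n)) by rewrite exprS; ring.
have -> : `|A0| * n.+2%:R * n.+1%:R * (K * q ^+ n.+2) =
   (q * q) * (`|A0| * M * (K * q ^+ n)) by rewrite 2!exprS /M; ring.
apply: ler_wpM2r.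
  by rewrite mulr_ge0// ?mulr_ge0// ?exprn_ge0 ?(ltW q0)// /M mulr_ge0.
have h3 := mulr_ge0 k20 (_ : 0 <= q - 1); rewrite {2}/q; have := h3 ltac:(lra); lra.
Qed.

Lemma local_solution : exists u r, [/\ 0 < r, radius_ge u r, ps u 0 = y0,
  ps (pseries_diffs u) 0 = y0' &
  forall x, `|x - x0| < r -> hyp_sol (fun x => ps u (x - x0))
                                     (fun x => ps (pseries_diffs u) (x - x0)) x].
Proof.
have [q q0 [K HK]] := local_growth.
pose r := Num.min q^-1 (Num.min `|x0| (1 - x0)).
have r0 : 0 < r by rewrite !lt_min invr_gt0 q0 normr_gt0 x00 subr_gt0.
have ur : radius_ge local_coef r.
  by apply: radius_geW (radius_of_growth q0 HK); rewrite ge_min lexx.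
exists local_coef, r; split => //; try by rewrite ps_at0 ?/pseries_diffs ?mul1r.
move=> x xr.
have r1 := radius_ge_diffs ur; have r2 := radius_ge_diffs r1.
have dsub : is_derive x 1 (fun t : R => t - x0) 1.
  by apply: (dv_ext (dvB (dvI x) (dvC x0 x))) => //; rewrite subr0.
split; first by apply: (dv_ext (dvc (g := fun t => t - x0) (is_derive_ps ur xr) dsub)) => //; rewrite mulr1.
apply: (dv_ext (dvc (g := fun t => t - x0) (is_derive_ps r1 xr) dsub)) => //; rewrite mulr1.
move: xr; set h := x - x0 => xr.
have L0 := psl_ps ur xr; have L1 := psl_ps r1 xr; have L2 := psl_ps r2 xr.
have := psl_lin 1 1 (psl_lin 1 (-1) (psl_lin A0 A1 L2 (psl_shift L2)) (psl_shift (psl_shift L2)))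
   (psl_lin 1 (- ab) (psl_lin B0 (- (rho + 1)) L1 (psl_shift L1)) L0).
move=> /psl_zero; rewrite /hyp_rhs.
set y2 := ps _ _; set y1 := ps _ _; set y := ps _ _ => E.
have xE : x = x0 + h by rewrite /h; ring.
have xr' : `|h| < r by [].
have {}E : x * (1 - x) * y2 = ab * y - (c - (rho + 1) * x) * y1.
  apply/eqP; rewrite -subr_eq0 -{}E; first by rewrite xE /A0 /A1 /B0; apply/eqP; ring.
  have grec := local_rec; move: (local_coef) grec => g grec n.
  rewrite -[RHS](subrr (A0 * n.+2%:R * n.+1%:R * g n.+2)) [X in _ = _ - X]grec.
  by case: n => [|[|n]] /=; rewrite /pseries_diffs /ab /= -?(natr1 n.+3) -?(natr1 n.+2) -?(natr1 n.+1) -?(natr1 n);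
    field.
have [x_0 x_1] : x != 0 /\ 1 - x != 0.
  move: xr'; rewrite /r !lt_min => /and3P[_ h1 h2]; split.
    by apply: contraTneq h1 => x_0; rewrite /h x_0 sub0r normrN ltxx.
  apply: contraTneq h2 => x_1; rewrite -leNgt /h.
  by apply: le_trans (ler_norm _); lra.
by rewrite -E mulrAC mulfV ?mul1r// mulf_neq0.
Qed.

End LocalSeries.

Lemma hyp_sol_lin (k : R) (y y1 w w1 : R -> R) x :
  hyp_sol y y1 x -> hyp_sol w w1 x ->
  hyp_sol (fun t => y t - k * w t) (fun t => y1 t - k * w1 t) x.
Proof.
move=> [a1 a2] [b1 b2]; split; first exact: dvB a1 (dvZ k b1).
by apply: (dv_ext (dvB a2 (dvZ k b2))) => //; rewrite /hyp_rhs; ring.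
Qed.

Lemma gauss_cts : {for 0, continuous gauss}.
Proof. by apply: dv_cts (is_derive_ps gauss_radius _); rewrite normr0. Qed.

Lemma pfaff_cts : {for 0, continuous pfaff}.
Proof. by apply: dv_cts (is_derive_pfaff _); lra. Qed.

Lemma gauss0 : gauss 0 = 1. Proof. by rewrite /gauss ps_at0. Qed.

Lemma pf_0 : pf 0 = 1. Proof. by rewrite /pf ps_at0. Qed.

Lemma pfaff_0 : pfaff 0 = 1.
Proof. by rewrite /pfaff subr0 powR1 mul1r invr1 subrr pf_0. Qed.

(** Near a singular point, a bound by a positive power of the distance forces the
    sign of a quantity that is constant or monotone along the way. *)
Lemma powR_small (w M p d : R) : 0 < p -> 0 < d ->
  (forall s, 0 < s < d -> w <= M * s `^ p) -> w <= 0.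
Proof.
move=> p0 d0 H; rewrite leNgt; apply/negP => w0.
have M0 : 0 < M.
  have /H : 0 < d / 2 < d by apply/andP; split; lra.
  move=> /(lt_le_trans w0); rewrite pmulr_lgt0// powR_gt0//; lra.
pose e := w / (2 * M); have e0 : 0 < e by rewrite divr_gt0// mulr_gt0.
pose s := Num.min (d / 2) (e `^ p^-1).
have s0 : 0 < s by rewrite lt_min divr_gt0//= powR_gt0.
have sd : 0 < s < d by rewrite s0/= (@le_lt_trans _ _ (d / 2)) ?ge_min ?lexx//; lra.
have : s `^ p <= e.
  rewrite -[leRHS]powRr1 ?(ltW e0)// -(mulVf (_ : p != 0)) ?gt_eqF// powRrM.
  apply: ge0_ler_powR; rewrite ?nnegrE ?(ltW p0) ?(ltW s0) ?powR_ge0//.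
  by rewrite ge_min lexx orbT.
move=> /(ler_wpM2l (ltW M0)) /(le_trans (H s sd)).
have -> : M * e = w / 2 by rewrite /e; field; rewrite gt_eqF.
lra.
Qed.

(** Abel's identity: (- x)^c (1 - x)^(rho + 1 - c) times the Wronskian is constant
    on ]-1, 0[. Both solutions being differentiable at 0, it is O((- x)^c) there,
    so the constant is 0. *)
Lemma wronskian_zero x : -1 < x < 0 -> gauss x * pfaff1 x = pfaff x * gauss1 x.
Proof.
move=> /andP[xm x0].
pose W t := (- t) `^ c * (1 - t) `^ (rho + 1 - c) * (gauss t * pfaff1 t - pfaff t * gauss1 t).
have DW (t : R) : -1 < t < 0 -> is_derive t 1 W 0.
  move=> /andP[tm t0]; have t1 : `|t| < 1 by rewrite ltr_norml tm; lra.
  have [g1 g2] := gauss_sol t1 (ltac:(by rewrite lt_eqF) : t != 0).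
  have [p1 p2] := @pfaff_sol t ltac:(lra) (ltac:(by rewrite lt_eqF) : t != 0).
  have nt : 0 < - t by lra.
  have dn : is_derive t 1 (fun u : R => - u) (-1) by exact: dvN (dvI t).
  apply: (dv_ext (dvM (dvM (dv_powR (f := fun u => - u) c nt dn)
    (dv_pow_one_sub (rho + 1 - c) (ltac:(lra) : t < 1)))
    (dvB (dvM g1 p2) (dvM p1 g2)))) => //.
  rewrite /hyp_rhs; field.
  by rewrite (lt_eqF t0) andbT gt_eqF//; lra.
have [M [d [d0 HB]]] : exists M d : R, 0 < d /\ forall t : R, `|t| < d ->
    `|(1 - t) `^ (rho + 1 - c) * (gauss t * pfaff1 t - pfaff t * gauss1 t)| <= M.
  pose B t := (1 - t) `^ (rho + 1 - c) * (gauss t * pfaff1 t - pfaff t * gauss1 t).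
  have cB : {for 0, continuous B}.
    have c1 := dv_cts (dv_pow_one_sub (rho + 1 - c) (ltr01 : (0:R) < 1)).
    have c2 := dv_cts (@is_derive_pfaff1 0 ltac:(lra)).
    have n0 : `|0 : R| < 1 by rewrite normr0.
    have c3 := dv_cts (is_derive_ps (radius_ge_diffs gauss_radius) n0).
    apply: (@continuousM R R _ _ 0 c1).
    exact: (@continuousB _ _ R _ _ 0 (continuousM gauss_cts c2) (continuousM pfaff_cts c3)).
  exact: bounded_near0 cB.
have Wc (t : R) : -1 < t < 0 -> W t = W x.
  move=> /andP[tm t0]; have [tx|/ltW xt] := leP t x.
    apply: (deriv0_eq tx (df := fun=> 0)) => // u /andP[u1 u2].
    by apply: DW; rewrite (lt_le_trans tm u1) (le_lt_trans u2).
  apply/esym/(deriv0_eq xt (df := fun=> 0)) => // u /andP[u1 u2].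
  by apply: DW; rewrite (lt_le_trans xm u1) (le_lt_trans u2).
have : `|W x| <= 0.
  apply: (@powR_small _ M c (Num.min 1 d)) => //; first by rewrite lt_min ltr01.
  move=> s /andP[s0]; rewrite lt_min => /andP[s1 sd].
  rewrite -(Wc (- s)); last by rewrite ltrN2 s1 oppr_lt0.
  rewrite /W opprK -mulrA normrM ger0_norm ?powR_ge0// [leRHS]mulrC ler_wpM2l ?powR_ge0//.
  by have := HB (- s); rewrite opprK normrN (gtr0_norm s0) => /(_ sd).
rewrite normr_le0 /W mulf_eq0 subr_eq0 => /orP[|/eqP//].
by rewrite mulf_eq0 !powR_eq0 => /orP[] /andP[/eqP h _]; lra.
Qed.

(** Close to 0, where the Gauss series does not vanish, the Wronskian relation
    says that some multiple of it has the Cauchy data of [pfaff]. By uniqueness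
    the two solutions are proportional on ]-1, 0[, and the factor is 1 since
    both are equal to 1 at 0. *)
Lemma gauss_pfaff x : -1 < x < 0 -> pfaff x = gauss x.
Proof.
have [d d0 Hd] := cts_eps gauss_cts (ltr01 : (0 : R) < 1).
pose x0 := - (Num.min 1 d / 2).
have m0 : 0 < Num.min 1 d by rewrite lt_min ltr01.
have [md m1] : Num.min 1 d <= d /\ Num.min 1 d <= 1 by rewrite !ge_min !lexx orbT.
have x0m : -1 < x0 < 0 by rewrite /x0; apply/andP; split; lra.
have g0 : gauss x0 != 0.
  have := Hd x0; rewrite gauss0 subr0 normrN gtr0_norm ?divr_gt0// => /(_ ltac:(lra)).
  by apply: contraTneq => ->; rewrite sub0r normrN normr1 ltxx.
pose k := pfaff x0 / gauss x0.
have H (t : R) : -1 < t < 0 -> pfaff t - k * gauss t = 0.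
  move=> /andP[tm t0]; have /andP[xm x00] := x0m.
  have side : (0 < Num.min t x0 /\ Num.max t x0 < 1) \/ Num.max t x0 < 0.
    by right; rewrite gt_max t0.
  have x0I : Num.min t x0 <= x0 <= Num.max t x0.
    by rewrite ge_min le_max lexx !orbT.
  have tI : Num.min t x0 <= t <= Num.max t x0.
    by rewrite ge_min le_max lexx.
  have sol u : Num.min t x0 <= u <= Num.max t x0 -> hyp_sol (fun t => pfaff t - k * gauss t)
     (fun t => pfaff1 t - k * gauss1 t) u.
    move=> /andP[u1 u2].
    have um : -1 < u by apply: lt_le_trans u1; rewrite lt_min tm.
    have u0 : u < 0 by apply: le_lt_trans u2 _; rewrite gt_max t0.
    apply: hyp_sol_lin; first by apply: pfaff_sol; [lra | rewrite lt_eqF].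
    by apply: gauss_sol; [rewrite ltr_norml um; lra | rewrite lt_eqF].
  apply: (hyp_unique side x0I sol _ _ tI).1; first by rewrite /k divfK// subrr.
  by apply: (mulfI g0); rewrite mulr0 mulrBr (wronskian_zero x0m) /k; field.
have k1 : k = 1.
  pose D t := pfaff t - k * gauss t.
  have cD : {for 0, continuous D}.
    have n0 : `|0 : R| < 1 by rewrite normr0.
    exact: dv_cts (dvB (@is_derive_pfaff 0 ltac:(lra)) (dvZ k (is_derive_ps gauss_radius n0))).
  have [k1|k1] := eqVneq (D 0) 0; first by move: k1; rewrite /D pfaff_0 gauss0; lra.
  have [|e e0 He] := cts_eps cD (e := `|D 0|); first by rewrite normr_gt0.
  have me : 0 < Num.min 1 e by rewrite lt_min ltr01.
  have [mde me1] : Num.min 1 e <= e /\ Num.min 1 e <= 1 by rewrite !ge_min !lexx orbT.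
  have := He (- (Num.min 1 e / 2)); rewrite subr0 normrN gtr0_norm ?divr_gt0//.
  rewrite /D (H (- (Num.min 1 e / 2))); last by apply/andP; split; lra.
  by rewrite sub0r normrN ltxx => /(_ ltac:(lra)).
by move=> /H; rewrite k1 mul1r => /eqP; rewrite subr_eq0 => /eqP.
Qed.

End Hypergeometric.

(** * Analytic continuation *)

Section JacobiFunction.
Variable R : realType.
Variables (c rho l2 : R).
Hypothesis c0 : 0 < c.
Implicit Types (x y z : R).
Local Notation gauss := (gauss c rho l2).
Local Notation gauss1 := (gauss1 c rho l2).
Local Notation pfaff := (pfaff c rho l2).
Local Notation pfaff1 := (pfaff1 c rho l2).
Local Notation hyp_sol := (hyp_sol c rho l2).

(** The two formulas agree on ]-1, 0[, so that the Gauss series gives this function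
    on both sides of 0. *)
Definition hypf x := if x < 0 then pfaff x else gauss x.
Definition hypf1 x := if x < 0 then pfaff1 x else gauss1 x.

Lemma hypf_gauss x : `|x| < 1 -> hypf x = gauss x.
Proof.
rewrite ltr_norml => /andP[xm _]; rewrite /hypf; case: ifPn => // x0.
by apply: gauss_pfaff => //; rewrite xm.
Qed.

Lemma hypf_sol x : x < 1 -> x != 0 -> hyp_sol hypf hypf1 x.
Proof.
move=> x1 x0; have [xneg|xpos] := ltP x 0.
  have [p1 p2] := @pfaff_sol R c rho l2 c0 x ltac:(lra) x0.
  have near0 (f g : R -> R) : exists2 e, 0 < e &
      forall y, `|y - x| < e -> f y = if y < 0 then f y else g y.
    exists (- x); first by rewrite oppr_gt0.
    move=> y; rewrite ltr_norml => /andP[_ h]; have -> : y < 0 by lra.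
    by [].
  have E (f g : R -> R) : (if x < 0 then f x else g x) = f x by rewrite xneg.
  by split; [rewrite /hypf1 E | rewrite /hypf1 /hypf !E]; apply: dv_near (near0 _ _) _.
have xp : 0 < x by rewrite lt_neqAle eq_sym x0.
have [p1 p2] := @gauss_sol R c rho l2 c0 x ltac:(rewrite gtr0_norm//) x0.
have near0 (f g : R -> R) : exists2 e, 0 < e &
    forall y, `|y - x| < e -> g y = if y < 0 then f y else g y.
  exists x => //.
  move=> y; rewrite ltr_norml => /andP[h _]; have -> : (y < 0) = false by apply/negbTE; lra.
  by [].
have E (f g : R -> R) : (if x < 0 then f x else g x) = g x by rewrite ltNge xpos.
by split; [rewrite /hypf1 E | rewrite /hypf1 /hypf !E]; apply: dv_near (near0 _ _) _.
Qed.

(** Elsewhere than at 0, the local power series solution with the Cauchy data of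
    [hypf] at [x0] coincides with it by uniqueness. *)
Lemma hypf_series x0 : x0 < 1 -> exists (u : nat -> R) (r : R), 0 < r /\
  forall x, `|x - x0| < r -> pseries u (x - x0) @ \oo --> hypf x.
Proof.
move=> x01; have [->|x00] := eqVneq x0 0.
  exists (gauss_coef c rho l2), 1; split => // x; rewrite subr0 => x1.
  by rewrite hypf_gauss//; exact: psl_ps (gauss_radius _ _ c0) x1.
have [u [r [r0 ur u0 u1 Hu]]] :=
  @local_solution R c rho l2 x0 (hypf x0) (hypf1 x0) x01 x00.
have [d [d0 [dr dx d1]]] : exists d, 0 < d /\ [/\ d < r, d < `|x0| & d < 1 - x0].
  have m0 : 0 < Num.min r (Num.min `|x0| (1 - x0)).
    by rewrite !lt_min r0 normr_gt0 x00 subr_gt0.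
  exists (Num.min r (Num.min `|x0| (1 - x0)) / 2); split; first by rewrite divr_gt0.
  have h : Num.min r (Num.min `|x0| (1 - x0)) / 2 < Num.min r (Num.min `|x0| (1 - x0)) by lra.
  by split; apply: lt_le_trans h _; rewrite !ge_min lexx ?orbT.
exists u, d; split => // x xd.
suff <- : ps u (x - x0) = hypf x by apply: psl_ps ur _; exact: lt_trans dr.
have side : (0 < x0 - d /\ x0 + d < 1) \/ x0 + d < 0.
  have [xneg|xpos] := ltP x0 0; first by right; move: dx; rewrite ltr0_norm//; lra.
  by left; move: dx; rewrite ger0_norm//; lra.
have x0I : x0 - d <= x0 <= x0 + d by apply/andP; split; lra.
have xI : x0 - d <= x <= x0 + d.
  by move: xd; rewrite ltr_norml => /andP[h1 h2]; apply/andP; split; lra.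
have sol t : x0 - d <= t <= x0 + d -> hyp_sol (fun x => ps u (x - x0) - 1 * hypf x)
    (fun x => ps (pseries_diffs u) (x - x0) - 1 * hypf1 x) t.
  move=> /andP[t1 t2]; apply: (@hyp_sol_lin _ _ _ _ 1 (fun x => ps u (x - x0)) (fun x => ps (pseries_diffs u) (x - x0))).
    by apply: Hu; rewrite ltr_norml; apply/andP; split; lra.
  apply: hypf_sol; first by case: side => [[]|]; lra.
  by case: side => [[]|] *; [rewrite gt_eqF//; lra | rewrite lt_eqF//; lra].
have := (hyp_unique c0 side x0I sol _ _ xI).1.
rewrite !mul1r subrr u0 u1 !subrr => /(_ erefl erefl) /eqP.
by rewrite subr_eq0 => /eqP.
Qed.

End JacobiFunction.

Section IdentityTheorem.
Variable R : realType.
Local Open Scope complex_scope.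
Implicit Types (f g : R -> R[i]).

Lemma pseries_cvg_radius (u : nat -> R) (r : R) : 0 < r ->
  (forall x, 0 < x < r -> cvgn (pseries u x)) -> radius_ge u r.
Proof.
move=> r0 H s /andP[s0 sr]; pose t := (s + r) / 2.
have t0 : 0 < t < r by rewrite /t; apply/andP; split; lra.
have [K [Kr Kf]] := cvg_series_bounded (H t t0).
exists (K + 1) => n; have /= := Kf (K + 1) ltac:(by rewrite ltrDl) n I.
rewrite normrM normrX; apply: le_trans; rewrite ler_wpM2l// lerXn2r ?nnegrE//.
by rewrite gtr0_norm; [rewrite /t; lra | case/andP: t0].
Qed.

Lemma pseries_zero (u : nat -> R) (r : R) : 0 < r ->
  (forall x, 0 < x < r -> pseries u x @ \oo --> (0 : R)) -> forall n, u n = 0.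
Proof.
move=> r0 H; apply: (@ps_coef0 _ u r) => //.
  by apply: pseries_cvg_radius r0 _ => x /H h; apply/cvg_ex; exists 0.
by move=> x /H h; apply: cvg_lim.
Qed.

(** Otherwise let s be the supremum of the points where the functions differ. As
    s <= -1, both functions are analytic at s; they agree to the right of s, so
    their expansions at s coincide, and they agree near s, which contradicts the
    choice of s. *)
Lemma analytic_identity f g :
  (forall x, x < 1 -> analytic_at f x) -> (forall x, x < 1 -> analytic_at g x) ->
  (forall x, `|x| < 1 -> f x = g x) -> forall x, x < 1 -> f x = g x.
Proof.
move=> fa ga fg y y1; apply: contrapT => /eqP fgy.
pose B := [set x : R | x < 1 /\ f x != g x].
have By : B y by split.
have ubB : ubound B (-1).
  move=> x [x1 fgx]; rewrite leNgt; apply/negP => xm; move: fgx.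
  by rewrite fg ?eqxx// ltr_norml xm.
have supB : has_sup B by split; [exists y | exists (-1)].
have s1 : sup B <= -1 by apply: sup_le_ub => //; exists y.
pose s := sup B.
have sB x : s < x -> x < 1 -> f x = g x.
  move=> sx x1; apply: contrapT => /eqP fgx.
  have : x <= s by apply: sup_upper_bound => //; split.
  by rewrite leNgt sx.
have [u [r [r0 Hu]]] := fa s ltac:(rewrite /s; lra).
have [v [r' [r'0 Hv]]] := ga s ltac:(rewrite /s; lra).
pose d := Num.min r (Num.min r' 1).
have d0 : 0 < d by rewrite !lt_min r0 r'0 ltr01.
have [dr dr' d1] : [/\ d <= r, d <= r' & d <= 1] by rewrite /d !ge_min !lexx !orbT.
have Z n : u n = v n.
  have H (x : R) : 0 < x < d -> f (s + x) = g (s + x).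
    by move=> /andP[x0 xd]; apply: sB; [rewrite ltrDl | rewrite /s; lra].
  have HR (x : R) : 0 < x < d ->
     csums_to (fun n => u n * (x ^+ n)%:C) (f (s + x)) /\
     csums_to (fun n => v n * (x ^+ n)%:C) (f (s + x)).
    move=> xd; rewrite {2}H//; case/andP: xd => x0 xd.
    have E : s + x - s = x by ring.
    have := Hu (s + x); have := Hv (s + x); rewrite E gtr0_norm//.
    by move=> /(_ ltac:(lra)) h1 /(_ ltac:(lra)) h2.
  have zero (p : R[i] -> R) (pu pv : nat -> R) :
     (forall n, pu n = p (u n)) -> (forall n, pv n = p (v n)) ->
     (forall x, 0 < x < d -> pseries pu x @ \oo --> p (f (s + x)) /\
       pseries pv x @ \oo --> p (f (s + x))) -> p (u n) = p (v n).
    move=> Eu Ev HH; have := @pseries_zero (fun n => 1 * pu n + (-1) * pv n) d d0.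
    move=> /(_ _ n) E; rewrite -Eu -Ev; apply/eqP; rewrite -subr_eq0 -E; first by apply/eqP; ring.
    move=> x /HH[h1 h2]; have := psl_lin 1 (-1) h1 h2.
    by rewrite mul1r mulN1r subrr.
  have E1 : complex.Re (u n) = complex.Re (v n).
    apply: (zero (@complex.Re R) (fun n => complex.Re (u n)) (fun n => complex.Re (v n))) => //.
    by move=> x /HR[/csums_to_ReIm[h1 _] /csums_to_ReIm[h2 _]].
  have E2 : complex.Im (u n) = complex.Im (v n).
    apply: (zero (@complex.Im R) (fun n => complex.Im (u n)) (fun n => complex.Im (v n))) => //.
    by move=> x /HR[/csums_to_ReIm[_ h1] /csums_to_ReIm[_ h2]].
  by case: (u n) (v n) E1 E2 => a b [a' b'] /= -> ->.
have loc x : `|x - s| < d -> f x = g x.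
  move=> xs; have := Hu x (lt_le_trans xs dr); have := Hv x (lt_le_trans xs dr').
  have -> : u = v by apply/funext.
  move=> /csums_to_ReIm[h1 h2] /csums_to_ReIm[h3 h4].
  have E1 : complex.Re (g x) = complex.Re (f x) by exact: (cvg_unique _ h1 h3).
  have E2 : complex.Im (g x) = complex.Im (f x) by exact: (cvg_unique _ h2 h4).
  by case: (f x) (g x) E1 E2 => a b [a' b'] /= -> ->.
have [z Bz zs] := sup_adherent d0 supB.
have zs' : z <= s by apply: sup_upper_bound.
case: Bz => _ /eqP; apply; apply: loc.
by rewrite distrC ger0_norm ?subr_ge0// /s; lra.
Qed.

End IdentityTheorem.

(** * The hypergeometric function with conjugate parameters *)

Section HypIdentification.
Variable R : realType.
Local Open Scope complex_scope.
Variables (alpha beta lambda : R).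
Hypothesis ha : -1 < alpha.
Local Notation rho := (rho alpha beta).
Local Notation c := (alpha + 1).
Local Notation l2 := (lambda ^+ 2).

Lemma c_gt0 : 0 < c. Proof. by move: ha; lra. Qed.

Lemma hyp2F1_coefE n :
  hyp2F1_coef ((rho +i* lambda) / 2) ((rho -i* lambda) / 2) c%:C n =
  (gauss_coef c rho l2 n)%:C.
Proof.
elim: n => [|n IH].
  by rewrite /hyp2F1_coef /pochhammer !big_ord0 !mul1r invr1.
have -> : forall a b d : R[i], hyp2F1_coef a b d n.+1 =
   hyp2F1_coef a b d n * ((a + n%:R) * (b + n%:R) / ((d + n%:R) * n.+1%:R)).
  move=> a b d; rewrite /hyp2F1_coef /pochhammer !big_ord_recr/= factS natrM.
  by rewrite !invfM; ring.
rewrite IH !complex_half !natC -!rmorphD -rmorphM -fmorphV.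
have -> : (rho / 2 +i* (lambda / 2) + (n%:R)%:C) * (rho / 2 +i* (- lambda / 2) + (n%:R)%:C)
   = ((rho / 2 + n%:R) ^+ 2 + l2 / 4)%:C.
  apply/eqP; rewrite eq_complex /=; apply/andP; split; apply/eqP.
    by field.
  by field.
rewrite -!rmorphM /=; congr (_%:C).
by rewrite mulrC; congr (_ / _ * _); rewrite mulrC [n%:R + _]addrC.
Qed.

Lemma is_hyp2F1_hypf : is_hyp2F1 ((rho +i* lambda) / 2) ((rho -i* lambda) / 2) c%:C
  (fun x => (hypf c rho l2 x)%:C).
Proof.
split=> [x x1|x x1].
  apply/csums_to_ReIm; split => /=; last first.
    rewrite [X in pseries X](_ : _ = fun=> 0); last first.
      by apply/funext => n; rewrite hyp2F1_coefE.
    exact: psl_0.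
  rewrite (hypf_gauss _ _ c_gt0 x1).
  rewrite [X in pseries X](_ : _ = gauss_coef c rho l2); first exact: psl_ps (gauss_radius rho l2 c_gt0) x1.
  by apply/funext => n; rewrite hyp2F1_coefE.
have [u [r [r0 Hu]]] := hypf_series rho l2 c_gt0 x1.
exists (fun n => (u n)%:C), r; split => // y yr; apply/csums_to_ReIm; split => /=.
  exact: Hu.
exact: psl_0.
Qed.

(** The specification of [hyp2F1] is met by [hypf], and by no other function on
    the half-line, by the identity theorem. *)
Lemma hyp2F1E x : x < 1 ->
  hyp2F1 ((rho +i* lambda) / 2) ((rho -i* lambda) / 2) c%:C x = (hypf c rho l2 x)%:C.
Proof.
have H := is_hyp2F1_hypf.
have H' := xgetPex (fun=> 0 : R[i]) (ex_intro _ _ H).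
move: x; apply: analytic_identity => [x x1|x x1|x x1].
- exact: H'.2.
- exact: H.2.
- have h1 := H'.1 x x1; have h2 := H.1 x x1.
  move/csums_to_ReIm: h1 => [a1 a2]; move/csums_to_ReIm: h2 => [b1 b2].
  rewrite /hyp2F1; move: (xget _ _ _) a1 a2 b1 b2 => z a1 a2 b1 b2.
  have E1 := (cvg_unique _ a1 b1 : _); have E2 := (cvg_unique _ a2 b2 : _).
  by apply/eqP; rewrite eq_complex; apply/andP; split; apply/eqP; [exact: E1 | exact: E2].
Qed.

End HypIdentification.

(** * Hyperbolic functions *)

Section HyperbolicFunctions.
Variable R : realType.
Implicit Types t : R.

Definition th t : R := sinh t / cosh t.

Lemma cosh_gt0 t : 0 < cosh t.
Proof. by rewrite /cosh divr_gt0// addr_gt0// expR_gt0. Qed.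

Lemma cosh2_sinh2 t : cosh t ^+ 2 = 1 + sinh t ^+ 2.
Proof.
rewrite /cosh /sinh; have : expR t * expR (- t) = 1 by rewrite -expRD subrr expR0.
by set a := expR t; set b := expR (- t) => E; field: E.
Qed.

Lemma dv_expN t : is_derive t 1 (fun u : R => expR (- u)) (- expR (- t)).
Proof.
apply: (dv_ext (dvc (is_derive_expR (- t)) (dvN (dvI t)))) => //.
by rewrite mulrN1.
Qed.

Lemma dv_sinh t : is_derive t 1 (@sinh R) (cosh t).
Proof.
apply: (dv_ext (dvM (dvB (is_derive_expR t) (dv_expN t)) (dvC 2^-1 t))) => //.
by rewrite mulr0 addr0 opprK.
Qed.

Lemma dv_cosh t : is_derive t 1 (@cosh R) (sinh t).
Proof.
apply: (dv_ext (dvM (dvD (is_derive_expR t) (dv_expN t)) (dvC 2^-1 t))) => //.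
by rewrite mulr0 addr0.
Qed.

Lemma one_sub_th2 t : 1 - th t ^+ 2 = (cosh t ^+ 2)^-1.
Proof.
have c0 : cosh t != 0 by rewrite gt_eqF// cosh_gt0.
transitivity ((cosh t ^+ 2 - sinh t ^+ 2) / cosh t ^+ 2); first by rewrite /th; field.
have -> : cosh t ^+ 2 - sinh t ^+ 2 = 1 by rewrite cosh2_sinh2; ring.
by rewrite mul1r.
Qed.

Lemma dv_th t : is_derive t 1 th (1 - th t ^+ 2).
Proof.
have c0 : cosh t != 0 by rewrite gt_eqF// cosh_gt0.
apply: (dv_ext (dvM (dv_sinh t) (dvV c0 (dv_cosh t)))) => //.
by rewrite /th; field.
Qed.

Lemma th2_lt1 t : th t ^+ 2 < 1.
Proof. by rewrite -subr_gt0 one_sub_th2 invr_gt0 exprn_gt0// cosh_gt0. Qed.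

Lemma th_norm_lt1 t : `|th t ^+ 2| < 1.
Proof. by rewrite ger0_norm ?sqr_ge0// th2_lt1. Qed.

Lemma sinh0 : sinh (0 : R) = 0.
Proof. by rewrite /sinh oppr0 subrr mul0r. Qed.

Lemma th0 : th 0 = 0.
Proof. by rewrite /th sinh0 mul0r. Qed.

Lemma th_le s t : s <= t -> th s <= th t.
Proof.
move=> st; apply: (deriv_ge0_le st (df := fun u => 1 - th u ^+ 2)) => [x _|x _].
  exact: dv_th.
by rewrite subr_ge0 ltW// th2_lt1.
Qed.

Lemma cosh_ge1 t : 1 <= cosh t.
Proof.
rewrite -(@ler_sqr R)// ?nnegrE ?(ltW (cosh_gt0 _))//.
by rewrite expr1n cosh2_sinh2 lerDl sqr_ge0.
Qed.

Lemma sinh_ge t : 0 <= t -> t <= sinh t.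
Proof.
move=> t0; rewrite -subr_ge0 -[X in X <= _](_ : sinh 0 - 0 = 0 :> R); last by rewrite sinh0 subr0.
apply: (deriv_ge0_le t0 (f := fun u => sinh u - u) (df := fun u => cosh u - 1)) => [x _|x _].
  exact: dvB (dv_sinh x) (dvI x).
by rewrite subr_ge0 cosh_ge1.
Qed.

Lemma th_gt0 t : 0 < t -> 0 < th t.
Proof.
move=> t0; rewrite divr_gt0 ?cosh_gt0//; apply: (lt_le_trans t0).
exact/sinh_ge/ltW.
Qed.

Lemma th_ge0 t : 0 <= t -> 0 <= th t.
Proof. by move=> t0; rewrite -th0; exact: th_le. Qed.

Lemma th_le_id t : 0 <= t -> th t <= t.
Proof.
move=> t0; rewrite -subr_ge0 -[X in X <= _](_ : 0 - th 0 = 0 :> R); last by rewrite th0 subr0.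
apply: (deriv_ge0_le t0 (f := fun u => u - th u) (df := fun u => 1 - (1 - th u ^+ 2))) => [x _|x _].
  exact: dvB (dvI x) (dv_th x).
by rewrite opprB addrC subrK sqr_ge0.
Qed.

Lemma th_lower t : 0 <= t <= 1 -> t / cosh 1 <= th t.
Proof.
move=> /andP[t0 t1].
have h : cosh t <= cosh 1.
  apply: (deriv_ge0_le t1 (df := fun u => sinh u)) => [x _|x /andP[h _]].
    exact: dv_cosh.
  by have := sinh_ge (ltW (le_lt_trans t0 h)); lra.
apply: ler_pM => //; first by rewrite invr_ge0 ltW// cosh_gt0.
  exact: sinh_ge.
by rewrite lef_pV2 ?posrE ?cosh_gt0.
Qed.

End HyperbolicFunctions.

(** * Jacobi functions without their exponential factor *)

Section Profile.
Variable R : realType.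
Variables (c rho : R).
Hypothesis c_gt : 1 / 2 < c.
Hypothesis rho_gt0 : 0 < rho.
Hypothesis rho_lt : rho < 2 * c.
Implicit Types (t z l : R).

Let c0 : 0 < c. Proof. by move: c_gt; lra. Qed.
Let A := rho * (2 * c - rho).
Let A0 : 0 < A. Proof. by rewrite mulr_gt0// subr_gt0. Qed.

(** The coefficient of z in the expansion of v for lambda = 0. *)
Definition slope : R := A / (4 * c).

Lemma slope_gt0 : 0 < slope.
Proof. by rewrite divr_gt0// mulr_gt0. Qed.

(** This is v_lambda(tanh^2 t) for [l = lambda ^+ 2]; the factor (cosh t)^(- rho)
    that is missing to get phi_lambda(t) cancels in phi_lambda / phi_0. *)
Definition profile l t := pf c rho l (th t ^+ 2).
Definition profile1 l t := 2 * th t * (1 - th t ^+ 2) * pf1 c rho l (th t ^+ 2).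

Lemma dv_th2 t : is_derive t 1 (fun u => th u ^+ 2) (2 * th t * (1 - th t ^+ 2)).
Proof. by apply: (dv_ext (dvX 1 (dv_th t))) => //; rewrite expr1. Qed.

Lemma dv_profile l t : is_derive t 1 (profile l) (profile1 l t).
Proof.
apply: (dv_ext (dvc (g := fun u => th u ^+ 2) (is_derive_pf rho l c0 (th_norm_lt1 t)) (dv_th2 t))) => //.
by rewrite /profile1 mulrC.
Qed.

Lemma profile_0 l : profile l 0 = 1.
Proof. by rewrite /profile th0 expr0n/= pf_0. Qed.

(** The weight in the Sturm-Liouville form of the equation of the profiles. *)
Definition weight t : R := th t `^ (2 * c - 1).

Lemma dv_weight t : 0 < t -> is_derive t 1 weight ((2 * c - 1) * weight t / th t * (1 - th t ^+ 2)).
Proof. by move=> t0; exact: dv_powR (th_gt0 t0) (dv_th t). Qed.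

Lemma weight_gt0 t : 0 < t -> 0 < weight t.
Proof. by move=> t0; rewrite powR_gt0// th_gt0. Qed.

Lemma weight_le t : 0 <= t -> weight t <= t `^ (2 * c - 1).
Proof.
move=> t0; apply: ge0_ler_powR; rewrite ?nnegrE ?th_ge0//; last exact: th_le_id.
by move: c_gt; lra.
Qed.

(** In this form the equation shows that the Wronskian of the profiles for
    lambda and 0, multiplied by the weight, has derivative
    - lambda^2 weight v_lambda v_0. *)
Lemma dv_flux l t : 0 < t -> is_derive t 1 (fun u => weight u * profile1 l u)
  ((A * (1 - th t ^+ 2) - l) * weight t * profile l t).
Proof.
move=> t0; have tp := th_gt0 t0.
have D := dv_weight t0.
have Dq := dvc (g := fun u => th u ^+ 2) (is_derive_pf1 rho l c0 (th_norm_lt1 t)) (dv_th2 t).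
have D1 := dvM (dvM (dvZ 2 (dv_th t)) (dvB (dvC 1 t) (dv_th2 t))) Dq.
apply: (dv_ext (dvM D D1)) => //.
have := pfaff_ode rho l c0 (th_norm_lt1 t); rewrite /profile1 /profile -/A.
set z := th t; set v := pf _ _ _ _; set v1 := pf1 _ _ _ _; set v2 := pf2 _ _ _ _ => E.
have -> : (A * (1 - z ^+ 2) - l) * weight t * v = 4 * weight t * ((A / 4 * (1 - z ^+ 2) - l / 4) * v).
  by field.
by rewrite -E; field; rewrite gt_eqF.
Qed.

Lemma pfaff0_rec n : n.+1%:R * (n%:R + c) * pfaff_coef c rho 0 n.+1 =
  (n%:R * (n%:R + c) + A / 4) * pfaff_coef c rho 0 n.
Proof. by rewrite pfaff_rec// mul0r mul0r subr0. Qed.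

Lemma pfaff0_gt0 n : 0 < pfaff_coef c rho 0 n.
Proof.
elim: n => [|n IH]; first by rewrite /pfaff_coef /= ltr01.
have h := nc_gt0 c0 n; have h' : 0 < n.+1%:R * (n%:R + c) by rewrite mulr_gt0.
rewrite -(pmulr_rgt0 _ h') pfaff0_rec mulr_gt0//.
by rewrite ltr_wpDl// ?divr_gt0// mulr_ge0// ltW.
Qed.

(** For lambda = 0 the recurrence makes n v_n nondecreasing. Hence v(z) grows at
    least like - ln (1 - z), and v(tanh^2 t) at least linearly in t. *)
Lemma pfaff0_lower n : slope <= n.+1%:R * pfaff_coef c rho 0 n.+1.
Proof.
elim: n => [|n IH].
  have := pfaff0_rec 0; rewrite mul0r !add0r mul1r [pfaff_coef _ _ _ 0]/= mulr1 => E.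
  rewrite mul1r le_eqVlt; apply/orP; left; apply/eqP.
  by apply: (mulfI (_ : c != 0)); rewrite ?gt_eqF// E /slope; field; rewrite gt_eqF.
apply: le_trans IH _; have h := nc_gt0 c0 n.+1.
rewrite -(ler_pM2l h) [leRHS]mulrCA mulrA pfaff0_rec mulrDl.
have : 0 <= A / 4 * pfaff_coef c rho 0 n.+1.
  by rewrite mulr_ge0 ?(ltW (pfaff0_gt0 _))// divr_ge0// ltW.
by lra.
Qed.

Lemma pf1_lower z : 0 <= z < 1 -> slope / (1 - z) <= pf1 c rho 0 z.
Proof.
move=> /andP[z0 z1]; have nz : `|z| < 1 by rewrite ger0_norm.
have H1 := psl_ps (radius_ge_diffs (pfaff_radius rho 0 c0)) nz.
have H2 := cvg_geometric_series (a := slope) nz.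
rewrite /pf1 -(cvg_lim _ H2)// -(cvg_lim _ H1)//; apply: ler_lim.
- by apply/cvg_ex; eexists; exact: H2.
- by apply/cvg_ex; eexists; exact: H1.
near=> n; rewrite /pseries /series /=; apply: ler_sum => i _.
by apply: ler_wpM2r; [rewrite exprn_ge0 | exact: pfaff0_lower].
Unshelve. all: by end_near. Qed.

Lemma profile1_0_lower t : 0 <= t -> 2 * th t * (slope) <= profile1 0 t.
Proof.
move=> t0; have h : 0 < 1 - th t ^+ 2 by rewrite subr_gt0 th2_lt1.
have := @pf1_lower (th t ^+ 2); rewrite sqr_ge0 th2_lt1 => /(_ isT) H.
rewrite /profile1; have z0 := th_ge0 t0.
move: (th t) z0 h H => z z0 h; rewrite ler_pdivrMr// => H.
have := ler_wpM2l (mulr_ge0 (ler0n R 2) z0) H; lra.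
Qed.

Lemma profile1_0_ge0 t : 0 <= t -> 0 <= profile1 0 t.
Proof.
move=> t0; apply: le_trans (profile1_0_lower t0).
by rewrite mulr_ge0 ?(ltW slope_gt0)// mulr_ge0// th_ge0.
Qed.

Lemma profile_0_mono s t : 0 <= s -> s <= t -> profile 0 s <= profile 0 t.
Proof.
move=> s0 st; apply: (deriv_ge0_le st (df := profile1 0)) => [x _|x /andP[h _]].
  exact: dv_profile.
by apply: profile1_0_ge0; rewrite (le_trans s0)// ltW.
Qed.

Lemma profile_0_ge1 t : 0 <= t -> 1 <= profile 0 t.
Proof. by move=> t0; rewrite -(profile_0 0); exact: profile_0_mono. Qed.

Lemma profile_0_lower : exists2 k, 0 < k & forall t, 1 <= t -> k * t <= profile 0 t.
Proof.
pose e := 2 * th 1 * (slope).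
have e0 : 0 < e by rewrite mulr_gt0 ?slope_gt0// mulr_gt0// th_gt0.
exists (Num.min 1 e); first by rewrite lt_min ltr01.
move=> t t1; have [m1 me] : Num.min 1 e <= 1 /\ Num.min 1 e <= e by rewrite !ge_min !lexx orbT.
have m0 : 0 < Num.min 1 e by rewrite lt_min ltr01.
have h : profile 0 1 - e * 1 <= profile 0 t - e * t.
  apply: (deriv_ge0_le t1 (f := fun u => profile 0 u - e * u) (df := fun u => profile1 0 u - e * 1)).
    by move=> x _; exact: dvB (dv_profile 0 x) (dvZ e (dvI x)).
  move=> x /andP[x1 _]; rewrite subr_ge0 mulr1.
  have x0 : 0 <= x by apply: ltW; exact: lt_trans x1.
  apply: le_trans (profile1_0_lower x0); rewrite /e ler_wpM2r ?(ltW slope_gt0)//.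
  by rewrite ler_wpM2l// th_le// ltW.
have := profile_0_ge1 (ler01 : (0:R) <= 1).
have : (Num.min 1 e) * (t - 1) <= e * (t - 1) by rewrite ler_wpM2r// subr_ge0.
by move: h; lra.
Qed.

Lemma dv_profile1 l t : is_derive t 1 (profile1 l)
  ((2 * (1 - th t ^+ 2) * (1 - th t ^+ 2) + 2 * th t * (0 - 2 * th t * (1 - th t ^+ 2)))
     * pf1 c rho l (th t ^+ 2) +
   2 * th t * (1 - th t ^+ 2) * (pf2 c rho l (th t ^+ 2) * (2 * th t * (1 - th t ^+ 2)))).
Proof.
have Dq := dvc (g := fun u => th u ^+ 2) (is_derive_pf1 rho l c0 (th_norm_lt1 t)) (dv_th2 t).
exact: dvM (dvM (dvZ 2 (dv_th t)) (dvB (dvC 1 t) (dv_th2 t))) Dq.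
Qed.

(** H is nondecreasing, and at least - M t^(2 c - 1) near the singular point 0; as
    2 c - 1 > 0, its values are at least 0. *)
Lemma flux_ge0 (H B : R -> R) (h : R -> R) (T : R) :
  (forall t, 0 < t < T -> is_derive t 1 H (h t)) ->
  (forall t, 0 < t < T -> 0 <= h t) ->
  (forall t, 0 < t -> H t = weight t * B t) -> {for 0, continuous B} ->
  forall t, 0 < t < T -> 0 <= H t.
Proof.
move=> DH h0 HB cB t /andP[t0 tT]; have [M [d [d0 Hd]]] := bounded_near0 cB.
rewrite -oppr_le0; apply: (@powR_small R _ M (2 * c - 1) (Num.min d t)).
- by move: c_gt; lra.
- by rewrite lt_min d0.
move=> s /andP[s0]; rewrite lt_min => /andP[sd st].
have : H s <= H t.
  apply: (deriv_ge0_le (ltW st) (df := h)) => x /andP[x1 x2].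
    by apply: DH; rewrite (lt_le_trans s0 x1) (le_lt_trans x2).
  by apply: h0; rewrite (lt_trans s0 x1) (lt_trans x2).
rewrite -lerN2 => /le_trans; apply; rewrite HB//.
apply: le_trans (ler_norm _) _; rewrite normrN normrM mulrC.
apply: ler_pM => //; first by apply: Hd; rewrite gtr0_norm.
by rewrite ger0_norm ?powR_ge0//; apply/weight_le/ltW.
Qed.

(** Let u = v_l / v_0, let M be the maximum of |u| on [0, T], and let W be the
    weight times v_l' v_0 - v_l v_0'. Then |W'| <= l M weight v_0^2, and weight v_0^2
    is nondecreasing, so |W| <= l M t weight v_0^2, which means |u'| <= l M t.
    Integrating, |u - 1| <= l M t^2 / 2 <= M / 8. At the point where |u| = M this
    gives M <= 8 / 7, and then |u - 1| <= 1 / 7 everywhere. *)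
Lemma profile_ratio_bound l T : 0 <= l -> 0 < T -> l * T ^+ 2 <= 1 / 4 ->
  1 / 2 <= profile l T / profile 0 T <= 2.
Proof.
move=> l0 T0 lT.
have w0 t : 0 <= t -> 0 < profile 0 t by move=> /profile_0_ge1; exact: lt_le_trans.
pose u t := profile l t / profile 0 t.
pose du t := (profile1 l t * profile 0 t - profile l t * profile1 0 t) / profile 0 t ^+ 2.
have Du t : 0 <= t -> is_derive t 1 u (du t).
  move=> t0; have h := w0 t t0; have hn : profile 0 t != 0 by rewrite gt_eqF.
  apply: (dv_ext (dvM (dv_profile l t) (dvV hn (dv_profile 0 t)))) => //.
  by rewrite /du; field.
have [s + Hs] : exists2 s, s \in `[0, T]%R & forall t, t \in `[0, T]%R -> `|u t| <= `|u s|.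
  apply: (@EVT_max R (fun t => `|u t|) 0 T (ltW T0)).
  have cu : {within `[0, T], continuous u}.
    apply: derivable_within_continuous => x; rewrite in_itv/= => /andP[x0 _].
    by have [] := Du x x0.
  by move=> x; apply: (continuous_comp (cu x)); exact: norm_continuous.
rewrite in_itv/= => /andP[s0 sT]; pose M : R := `|u s|.
have Hu t : 0 <= t <= T -> `|u t| <= M by move=> h; apply: Hs; rewrite in_itv.
have M0 : 0 <= M by rewrite /M normr_ge0.
(* For e = 1 and e = -1, [H e] is l M t weight v_0^2 + e W, whose sign is to be
   found; [B e] is its quotient by the weight, which is continuous at 0. *)
pose B (e : R) t := l * M * t * profile 0 t ^+ 2 +
   e * (profile1 l t * profile 0 t - profile l t * profile1 0 t).
pose H (e : R) t := l * M * t * (weight t * profile 0 t ^+ 2) +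
   e * (weight t * profile1 l t * profile 0 t - profile l t * (weight t * profile1 0 t)).
have cB e : {for 0, continuous (B e)}.
  apply: dv_cts (dvD (dvM (dvZ (l * M) (dvI 0)) (dvX 1 (dv_profile 0 0)))
    (dvZ e (dvB (dvM (dv_profile1 l 0) (dv_profile 0 0)) (dvM (dv_profile l 0) (dv_profile1 0 0))))).
pose dm t := (2 * c - 1) * weight t / th t * (1 - th t ^+ 2) * profile 0 t ^+ 2 +
     weight t * (2 * profile 0 t * profile1 0 t).
pose h (e : R) t := l * M * (weight t * profile 0 t ^+ 2) + l * M * t * dm t
   - e * (l * weight t * profile l t * profile 0 t).
have DH e t : 0 < t < T -> is_derive t 1 (H e) (h e t).
  move=> /andP[t0 tT].
  have := dvD (dvM (dvZ (l * M) (dvI t)) (dvM (dv_weight t0) (dvX 1 (dv_profile 0 t))))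
    (dvZ e (dvB (dvM (dv_flux l t0) (dv_profile 0 t)) (dvM (dv_profile l t) (dv_flux 0 t0)))).
  by move/dv_ext; apply => //; rewrite /h /dm expr1; ring.
have h0 e t : `|e| <= 1 -> 0 < t < T -> 0 <= h e t.
  move=> e1 /andP[t0 tT]; have wt := weight_gt0 t0; have tp := th_gt0 t0.
  have pt := w0 t (ltW t0).
  have dm0 : 0 <= dm t.
    have p1 := profile1_0_ge0 (ltW t0); have z1 : 0 < 1 - th t ^+ 2 by rewrite subr_gt0 th2_lt1.
    have c1 : 0 <= 2 * c - 1 by move: c_gt; lra.
    rewrite /dm addr_ge0//; last by rewrite mulr_ge0 ?(ltW wt)// mulr_ge0// mulr_ge0// ltW.
    by rewrite mulr_ge0 ?sqr_ge0// mulr_ge0 ?(ltW z1)// divr_ge0 ?(ltW tp)// mulr_ge0// ltW.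
  have pl : `|profile l t| <= M * profile 0 t.
    have := Hu t; rewrite (ltW t0) (ltW tT) => /(_ isT); rewrite /u normrM normfV (gtr0_norm pt).
    by rewrite ler_pdivrMr.
  have e2 : e * (l * weight t * profile l t * profile 0 t) <= l * weight t * (M * profile 0 t) * profile 0 t.
    apply: le_trans (ler_norm _) _; rewrite normrM; apply: le_trans (ler_wpM2r _ e1) _ => //.
    rewrite mul1r !normrM (ger0_norm l0) (gtr0_norm wt) (gtr0_norm pt) ler_wpM2r ?(ltW pt)//.
    by rewrite ler_wpM2l// mulr_ge0// ltW.
  have e3 : 0 <= l * M * t * dm t by rewrite mulr_ge0// mulr_ge0 ?(ltW t0)// mulr_ge0.
  by rewrite /h; lra.
have HB e t : 0 < t -> H e t = weight t * B e t by move=> _; rewrite /H /B; ring.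
have Hpos e t : `|e| <= 1 -> 0 < t < T -> 0 <= H e t.
  by move=> e1; apply: (flux_ge0 (DH e) (fun t => @h0 e t e1) (HB e) (cB e)).
have duB t : 0 < t < T -> `|du t| <= l * M * t.
  move=> tT; have := Hpos 1 t; have := Hpos (-1) t; rewrite normrN normr1 lexx => /(_ isT tT) h1 /(_ isT tT) h2.
  case/andP: tT => t0 tT; have wt := weight_gt0 t0; have pt := w0 t (ltW t0).
  have pp : 0 < profile 0 t ^+ 2 by rewrite exprn_gt0.
  move: h1 h2; rewrite !HB// !pmulr_rge0// /B => h1 h2.
  rewrite /du normrM normfV (gtr0_norm pp) ler_pdivrMr// ler_norml.
  by apply/andP; split; lra.
have u0 : u 0 = 1 by rewrite /u !profile_0 divr1.
have dq (x : R) : is_derive x 1 (fun x : R => l * M / 2 * x ^+ 2) (l * M * x).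
  by apply: (dv_ext (dvZ (l * M / 2) (dvX 1 (dvI x)))) => //; rewrite expr1; field.
have ub t : 0 <= t <= T -> `|u t - 1| <= l * M / 2 * t ^+ 2.
  move=> /andP[t0 tT].
  have g1 : l * M / 2 * 0 ^+ 2 - u 0 <= l * M / 2 * t ^+ 2 - u t.
    apply: (deriv_ge0_le t0 (f := fun x => l * M / 2 * x ^+ 2 - u x) (df := fun x => l * M * x - du x)).
      by move=> x /andP[x0 _]; exact: dvB (dq x) (Du x x0).
    move=> x /andP[x0 xt]; have := duB x; rewrite x0 (lt_le_trans xt tT) => /(_ isT).
    by rewrite ler_norml subr_ge0 => /andP[].
  have g2 : l * M / 2 * 0 ^+ 2 + u 0 <= l * M / 2 * t ^+ 2 + u t.
    apply: (deriv_ge0_le t0 (f := fun x => l * M / 2 * x ^+ 2 + u x) (df := fun x => l * M * x + du x)).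
      by move=> x /andP[x0 _]; exact: dvD (dq x) (Du x x0).
    move=> x /andP[x0 xt]; have := duB x; rewrite x0 (lt_le_trans xt tT) => /(_ isT).
    by rewrite ler_norml => /andP[]; lra.
  move: g1 g2; rewrite u0 expr0n/= mulr0 ler_norml => g1 g2; apply/andP; split; lra.
have key t : 0 <= t <= T -> `|u t - 1| <= M / 8.
  move=> tI; apply: le_trans (ub t tI) _; case/andP: tI => t0 tT.
  have : l * t ^+ 2 <= 1 / 4.
    by apply: le_trans lT; rewrite ler_wpM2l// lerXn2r// nnegrE ltW.
  by move/(ler_wpM2r M0); lra.
have kM : M <= 8 / 7.
  have := key s; rewrite s0 sT => /(_ isT) k; have := ler_normD (u s - 1) 1.
  by rewrite subrK normr1 -/M; lra.
have := key T; rewrite (ltW T0) lexx => /(_ isT); rewrite ler_norml => /andP[k1 k2].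
by rewrite -/(u T); apply/andP; split; lra.
Qed.

End Profile.

(** * The modified Jacobi function and the modified weight *)

Section JacobiEstimates.
Variables (R : realType) (alpha beta : R).
Hypothesis hab : beta <= alpha.
Hypothesis hb : - (1 / 2) <= beta.
Hypothesis ha : - (1 / 2) < alpha.
Implicit Types (t lambda : R).
Local Notation rho := (rho alpha beta).
Local Notation c := (alpha + 1).

Let c_gt : 1 / 2 < c. Proof. by move: ha; lra. Qed.
Let rho_gt0 : 0 < rho. Proof. by rewrite /Defs.rho; move: ha hb; lra. Qed.
Let rho_lt : rho < 2 * c. Proof. by rewrite /Defs.rho; move: hab; lra. Qed.

(** Pfaff's transformation at x = - sinh^2 t, where 1 - x = cosh^2 t and
    x / (x - 1) = tanh^2 t. *)
Lemma jacobiE lambda t : 0 < t ->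
  jacobi alpha beta lambda t = cosh t `^ (- rho) * profile c rho (lambda ^+ 2) t.
Proof.
move=> t0; have s0 : 0 < sinh t by apply: lt_le_trans (sinh_ge (ltW t0)).
have x0 : - (sinh t ^+ 2) < 0 by rewrite oppr_lt0 exprn_gt0.
rewrite /jacobi hyp2F1E /=; [|by move: ha; lra|by move: x0; lra].
rewrite /hypf x0 /pfaff opprK -cosh2_sinh2 -one_sub_th2 opprB addrCA subrr addr0.
congr (_ * _); rewrite -powR_mulrn ?ltW ?cosh_gt0// -powRrM; congr (_ `^ _).
by field.
Qed.

Lemma jacobi_modE lambda t : 0 < t ->
  jacobi_mod alpha beta lambda t = profile c rho (lambda ^+ 2) t / profile c rho 0 t.
Proof.
move=> t0; rewrite /jacobi_mod !jacobiE// expr0n /=.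
have h : cosh t `^ (- rho) != 0 by rewrite gt_eqF// powR_gt0 ?cosh_gt0.
by rewrite invfM mulrACA mulfV// mul1r.
Qed.

Lemma jacobi_mod_bound lambda t : 0 < t -> `|lambda * t| <= 1 / 2 ->
  1 / 2 <= jacobi_mod alpha beta lambda t <= 2.
Proof.
move=> t0 lt; rewrite jacobi_modE//; apply: profile_ratio_bound => //.
  exact: sqr_ge0.
rewrite -exprMn -[X in X <= _]real_normK ?num_real//.
have := ler_pM (normr_ge0 _) (normr_ge0 _) lt lt; rewrite -expr2; lra.
Qed.

Definition m_const : R := (2 * pi) `^ (- (1 / 2)) * 2 `^ (2 * rho).

Lemma m_const_gt0 : 0 < m_const.
Proof. by rewrite mulr_gt0// powR_gt0// mulr_gt0// pi_gt0. Qed.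

(** The exponents - 2 rho of phi_0^2 and 2 beta + 1 of the weight add up to
    - (2 alpha + 1), so that only tanh remains. *)
Lemma m_weight_modE t : 0 < t ->
  m_weight_mod alpha beta t = m_const * (weight c t * profile c rho 0 t ^+ 2).
Proof.
move=> t0; rewrite /m_weight_mod jacobiE// expr0n /= /m_weight /weight /th.
have s0 : 0 < sinh t by apply: lt_le_trans (sinh_ge (ltW t0)).
have ch := cosh_gt0 t; have chn : cosh t != 0 by rewrite gt_eqF.
have -> : (sinh t / cosh t) `^ (2 * c - 1) = sinh t `^ (2 * c - 1) * cosh t `^ (-1 * (2 * c - 1)).
  by rewrite powRM ?invr_ge0 ?ltW// powRrM powR_inv1// ltW.
have -> : 2 * c - 1 = 2 * alpha + 1 by ring.
have -> : cosh t `^ (-1 * (2 * alpha + 1)) =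
    cosh t `^ (- rho) ^+ 2 * cosh t `^ (2 * beta + 1).
  rewrite expr2 -!powRD; [|by rewrite chn implybT..].
  by congr (_ `^ _); rewrite /Defs.rho; ring.
by rewrite /m_const; ring.
Qed.

Lemma m_weight_mod_ge0 t : 0 < t -> 0 <= m_weight_mod alpha beta t.
Proof.
move=> t0; rewrite m_weight_modE// mulr_ge0 ?(ltW m_const_gt0)//.
by rewrite mulr_ge0 ?sqr_ge0// powR_ge0.
Qed.

Lemma m_weight_mod_small : exists2 k, 0 < k &
  forall t, 0 < t <= 1 -> k * t `^ (2 * alpha + 1) <= m_weight_mod alpha beta t.
Proof.
have ch := cosh_gt0 (1 : R).
exists (m_const * (cosh 1)^-1 `^ (2 * alpha + 1)).
  by rewrite mulr_gt0 ?m_const_gt0// powR_gt0// invr_gt0.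
move=> t /andP[t0 t1]; rewrite m_weight_modE// -mulrA ler_wpM2l ?(ltW m_const_gt0)//.
apply: (@le_trans _ _ (weight c t)); last first.
  rewrite ler_peMr ?powR_ge0// exprn_ege1//.
  by have := profile_0_ge1 c_gt rho_gt0 rho_lt (ltW t0).
rewrite /weight -powRM ?invr_ge0 ?(ltW ch) ?(ltW t0)//.
have -> : 2 * c - 1 = 2 * alpha + 1 by ring.
apply: ge0_ler_powR; rewrite ?nnegrE ?th_ge0 ?(ltW t0)//.
- by move: ha; lra.
- by rewrite mulr_ge0 ?invr_ge0 ?(ltW ch) ?(ltW t0).
- by rewrite mulrC; apply: th_lower; rewrite (ltW t0).
Qed.

(** The linear growth of [profile 0] produces the square, hence the dimension 3
    of the low frequency conditions. *)
Lemma m_weight_mod_large : exists2 k, 0 < k &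
  forall t, 1 <= t -> k * t ^+ 2 <= m_weight_mod alpha beta t.
Proof.
have [e e0 He] := profile_0_lower c_gt rho_gt0 rho_lt.
have w1 : 0 < weight c (1 : R) by exact: weight_gt0.
exists (m_const * (weight c 1 * e ^+ 2)).
  by rewrite mulr_gt0 ?m_const_gt0// mulr_gt0// exprn_gt0.
move=> t t1; have t0 : 0 < t by exact: lt_le_trans t1.
rewrite m_weight_modE// -mulrA ler_wpM2l ?(ltW m_const_gt0)// -mulrA -exprMn.
have et : 0 <= e * t by rewrite mulr_ge0// ltW.
have h1 : weight c 1 <= weight c t.
  rewrite /weight; apply: ge0_ler_powR; rewrite ?nnegrE ?th_ge0 ?(ltW t0)//; last exact: th_le.
  by move: c_gt; lra.
have h2 : (e * t) ^+ 2 <= profile c rho 0 t ^+ 2.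
  by rewrite lerXn2r ?nnegrE ?(le_trans et) ?He.
exact: ler_pM (ltW w1) (sqr_ge0 _) h1 h2.
Qed.

End JacobiEstimates.

(** * Bounds for trigonometric functions *)

Section Trig.
Variable R : realType.
Implicit Types s t : R.

Lemma expR_taylor1 s : 0 <= s -> 0 <= expR s - 1 - s <= s ^+ 2 * expR s.
Proof.
move=> s0; apply/andP; split; first by have := expR_ge1Dx s; lra.
have h : expR s - 1 <= s * expR s.
  have := expR_ge1Dx (- s); rewrite expRN => e1.
  have := ler_wpM2r (expR_ge0 s) e1; rewrite mulVf ?gt_eqF ?expR_gt0//; lra.
have := ler_wpM2l s0 h; lra.
Qed.

Lemma sin_le_id t : 0 <= t -> sin t <= t.
Proof.
move=> t0; rewrite -subr_ge0 -[X in X <= _](_ : 0 - sin 0 = 0 :> R); last by rewrite sin0 subr0.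
have D (x : R) : is_derive x 1 (fun u : R => u - sin u) (1 - cos x) by exact: dvB (dvI x) (is_derive_sin x).
apply: (deriv_ge0_le t0 (fun x _ => D x)) => x _.
by rewrite subr_ge0 cos_le1.
Qed.

Lemma cos_lower t : 0 <= t -> 0 <= t ^+ 2 - (1 - cos t).
Proof.
move=> t0; rewrite -[X in X <= _](_ : 0 ^+ 2 - (1 - cos 0) = 0 :> R); last by rewrite cos0 expr0n subrr subr0.
apply: (deriv_ge0_le t0 (f := fun u => u ^+ 2 - (1 - cos u)) (df := fun u => 2 * u ^+ 1 * 1 - (0 - - sin u))) => [x _|x /andP[x0 _]].
  exact: dvB (dvX 1 (dvI x)) (dvB (dvC 1 x) (is_derive_cos x)).
by have := sin_le_id (ltW x0); rewrite expr1; lra.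
Qed.

Lemma one_sub_cos_le t : 0 <= t -> 0 <= t - (1 - cos t).
Proof.
move=> t0; rewrite -[X in X <= _](_ : 0 - (1 - cos 0) = 0 :> R); last by rewrite cos0 subrr subr0.
have D (x : R) : is_derive x 1 (fun u : R => u - (1 - cos u)) (1 - (0 - - sin x)).
  exact: dvB (dvI x) (dvB (dvC 1 x) (is_derive_cos x)).
apply: (deriv_ge0_le t0 (fun x _ => D x)) => x _.
by have := sin_le1 x; lra.
Qed.

Lemma sin_lower t : 0 <= t -> 0 <= t ^+ 2 - (t - sin t).
Proof.
move=> t0; rewrite -[X in X <= _](_ : 0 ^+ 2 - (0 - sin 0) = 0 :> R); last by rewrite sin0 expr0n subrr subr0.
apply: (deriv_ge0_le t0 (f := fun u => u ^+ 2 - (u - sin u)) (df := fun u => 2 * u ^+ 1 * 1 - (1 - cos u))) => [x _|x /andP[x0 _]].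
  exact: dvB (dvX 1 (dvI x)) (dvB (dvI x) (is_derive_sin x)).
by have := one_sub_cos_le (ltW x0); rewrite expr1; lra.
Qed.

Lemma norm_cos_sub1 t : `|cos t - 1| <= t ^+ 2.
Proof.
wlog t0 : t / 0 <= t.
  move=> H; have [/H//|/ltW t0] := leP 0 t.
  by rewrite -cosN -sqrrN; apply: H; rewrite oppr_ge0.
rewrite ler_norml; have := cos_le1 t; have := cos_lower t0; have := sqr_ge0 t.
by move=> h1 h2 h3; apply/andP; split; lra.
Qed.

Lemma norm_sin_sub t : `|sin t - t| <= t ^+ 2.
Proof.
wlog t0 : t / 0 <= t.
  move=> H; have [/H//|/ltW t0] := leP 0 t.
  have := H (- t); rewrite oppr_ge0 sinN sqrrN => /(_ t0).
  by rewrite opprK addrC distrC.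
rewrite ler_norml; have := sin_le_id t0; have := sin_lower t0; have := sqr_ge0 t.
by move=> h1 h2 h3; apply/andP; split; lra.
Qed.

End Trig.

(** * Modulus and exponential of complex numbers *)

Section ComplexModulus.
Variable R : realType.
Local Open Scope complex_scope.
Implicit Types (z w : R[i]) (x y l : R).

Lemma cabsM z w : cabs (z * w) = cabs z * cabs w.
Proof. exact: Normc.normcM. Qed.

Lemma cabsV z : cabs z^-1 = (cabs z)^-1.
Proof. exact: Normc.normcV. Qed.

Lemma cabsD z w : cabs (z + w) <= cabs z + cabs w.
Proof. exact: le_normcD. Qed.

Lemma cabs_ge0 z : 0 <= cabs z.
Proof. by case: z => a b; rewrite /cabs /= sqrtr_ge0. Qed.

Lemma cabsE x y : cabs (x +i* y) = Num.sqrt (x ^+ 2 + y ^+ 2).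
Proof. by []. Qed.

Lemma cabsR x : cabs x%:C = `|x|.
Proof. by rewrite /cabs /= expr0n/= addr0 sqrtr_sqr. Qed.

Lemma cabs0 : cabs (0 : R[i]) = 0.
Proof. by rewrite -[0]/(0%:C) cabsR normr0. Qed.

Lemma cabs_sqr x y : cabs (x +i* y) ^+ 2 = x ^+ 2 + y ^+ 2.
Proof. by rewrite cabsE sqr_sqrtr// addr_ge0// sqr_ge0. Qed.

Lemma cexpD z w : cexp (z + w) = cexp z * cexp w.
Proof.
case: z w => a b [a' b']; rewrite /cexp /=; rewrite expRD cosD sinD.
by apply/eqP; rewrite eq_complex /=; apply/andP; split; apply/eqP; ring.
Qed.

Lemma cabs_cexp z : cabs (cexp z) = expR (complex.Re z).
Proof.
case: z => a b; rewrite /cexp cabsM cabsR ger0_norm ?expR_ge0// cabsE.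
by rewrite cos2Dsin2 sqrtr1 mulr1.
Qed.

Lemma cexp_taylor1 x y l : 0 <= x -> 0 <= l <= 1 ->
  cabs (cexp ((x +i* y) * l%:C) - 1 - (x +i* y) * l%:C)
    <= expR x * (2 * y ^+ 2 + x ^+ 2 + x * `|y|) * l ^+ 2.
Proof.
move=> x0 /andP[l0 l1].
have -> : (x +i* y) * l%:C = (x * l) +i* (y * l).
  by apply/eqP; rewrite eq_complex /=; apply/andP; split; apply/eqP; ring.
set s := x * l; set t := y * l.
have s0 : 0 <= s by rewrite mulr_ge0.
have sx : s <= x by rewrite /s ler_piMr.
have -> : cexp (s +i* t) - 1 - (s +i* t) =
   (expR s * (cos t - 1) + (expR s - 1 - s)) +i* (expR s * (sin t - t) + (expR s - 1) * t).
  by apply/eqP; rewrite eq_complex /=; apply/andP; split; apply/eqP; ring.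
apply: le_trans (cabs_le _) _ => /=.
have E : expR s <= expR x by rewrite ler_expR.
have E0 := expR_ge0 s; have E0' := expR_ge0 x.
have /andP[e1 e2] := expR_taylor1 s0.
have h1 : `|expR s * (cos t - 1) + (expR s - 1 - s)| <= expR x * t ^+ 2 + s ^+ 2 * expR x.
  apply: le_trans (ler_normD _ _) _; apply: lerD.
    by rewrite normrM (ger0_norm E0); apply: ler_pM => //; exact: norm_cos_sub1.
  by rewrite ger0_norm//; apply: le_trans e2 _; rewrite ler_wpM2l// sqr_ge0.
have h2 : `|expR s * (sin t - t) + (expR s - 1) * t| <= expR x * t ^+ 2 + s * expR x * `|t|.
  apply: le_trans (ler_normD _ _) _; apply: lerD.
    by rewrite normrM (ger0_norm E0); apply: ler_pM => //; exact: norm_sin_sub.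
  rewrite normrM ler_wpM2r// ger0_norm; last by lra.
  have : s * expR s <= s * expR x by rewrite ler_wpM2l.
  have := expR_ge1Dx (- s); rewrite expRN => e3.
  have := ler_wpM2r E0 e3; rewrite mulVf ?gt_eqF ?expR_gt0//; lra.
apply: le_trans (lerD h1 h2) _.
have -> : `|t| = `|y| * l by rewrite /t normrM (ger0_norm l0).
by rewrite /s /t le_eqVlt; apply/orP; left; apply/eqP; ring.
Qed.

End ComplexModulus.

(** * Infinite products *)

Section Products.
Variable R : realType.
Local Open Scope complex_scope.

Lemma inv_sqr_sum n : \sum_(k < n) (k.+1%:R ^+ 2)^-1 <= 2 :> R.
Proof.
case: n => [|n]; first by rewrite big_ord0.
suff H : \sum_(k < n.+1) (k.+1%:R ^+ 2)^-1 <= 2 - n.+1%:R^-1 :> R.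
  by apply: le_trans H _; rewrite lerBlDr lerDl invr_ge0.
elim: n => [|n IH]; first by rewrite big_ord1 expr1n invr1; lra.
rewrite big_ord_recr/=; apply: le_trans (lerD IH (lexx _)) _.
have E : n.+2%:R = n.+1%:R + 1 :> R by rewrite natr1.
have h1 : (n.+1%:R : R) != 0 by rewrite pnatr_eq0.
have h2 : (n.+2%:R : R) != 0 by rewrite pnatr_eq0.
rewrite -subr_ge0.
have -> : 2 - n.+2%:R^-1 - (2 - n.+1%:R^-1 + (n.+2%:R ^+ 2)^-1) =
   (n.+1%:R * n.+2%:R ^+ 2)^-1 :> R.
  move: h1 h2 E; move: (n.+1%:R) (n.+2%:R) => a b h1 h2 E.
  by rewrite E in h2 *; field; rewrite h1 h2.
by rewrite invr_ge0 mulr_ge0// exprn_ge0.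
Qed.

(** Discrete Gronwall inequality: the product of the factors 1 + C / k^2 is at
    most exp (2 C). *)
Lemma slow_growth (v : nat -> R) (C : R) (N : nat) : 0 <= C -> (forall n, 0 <= v n) ->
  (forall n, (N <= n)%N -> v n.+1 <= v n * (1 + C * (n.+1%:R ^+ 2)^-1)) ->
  exists2 B, 0 < B & forall n, (N <= n)%N -> v n <= B.
Proof.
move=> C0 v0 H; exists ((v N + 1) * expR (C * 2)).
  by rewrite mulr_gt0 ?expR_gt0// ltr_wpDl.
move=> n Nn; suff K : v n <= (v N + 1) * expR (C * \sum_(k < n) (k.+1%:R ^+ 2)^-1).
  apply: le_trans K _; rewrite ler_wpM2l ?addr_ge0// ler_expR ler_wpM2l//.
  exact: inv_sqr_sum.
elim: n Nn => [|n IH]; first by rewrite leqn0 => /eqP ->; rewrite big_ord0 mulr0 expR0 mulr1 lerDl.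
rewrite leq_eqVlt => /orP[/eqP <-|].
  rewrite -[X in X <= _]mulr1; apply: ler_pM => //; first by rewrite lerDl.
  by rewrite -[X in X <= _]expR0 ler_expR mulr_ge0// sumr_ge0// => i _; rewrite invr_ge0 exprn_ge0.
rewrite ltnS => Nn; apply: le_trans (H n Nn) _.
rewrite big_ord_recr/= (mulrDr C) expRD mulrA; apply: ler_pM => //; last exact: expR_ge1Dx.
  by rewrite addr_ge0// mulr_ge0// invr_ge0 exprn_ge0.
exact: IH.
Qed.

Lemma inv_sqr_series_cvg : cvgn (series (fun n => (n.+1%:R ^+ 2)^-1 : R)).
Proof.
apply: nondecreasing_is_cvgn.
  by apply: nondecreasing_series => n _ _; rewrite invr_ge0 exprn_ge0.
exists 2 => _ [n _ <-]; rewrite /series /= big_mkord; exact: inv_sqr_sum.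
Qed.

Lemma cvg_of_increments (u : nat -> R) (C : R) (N : nat) :
  (forall n, (N <= n)%N -> `|u n.+1 - u n| <= C * (n.+1%:R ^+ 2)^-1) -> cvgn u.
Proof.
move=> H; have C0 : 0 <= C.
  by have := le_trans (normr_ge0 _) (H N (leqnn N)); rewrite pmulr_lge0// invr_gt0 exprn_gt0.
pose d n := u (n + N).+1 - u (n + N)%N.
have cd : cvgn (series d).
  apply: normed_cvg; apply: (@series_le_cvg _ _ (fun n => C * (n.+1%:R ^+ 2)^-1)).
  - by move=> n /=.
  - by move=> n; rewrite mulr_ge0// invr_ge0 exprn_ge0.
  - move=> n /=; apply: le_trans (H _ (leq_addl _ _)) _; rewrite ler_wpM2l//.
    rewrite lef_pV2 ?posrE ?exprn_gt0// lerXn2r ?nnegrE// ler_nat ltnS leq_addr//.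
  have := inv_sqr_series_cvg => /cvg_ex[l Hl]; apply/cvg_ex; exists (C * l).
  rewrite [X in X @ \oo --> _](_ : _ = fun n => C * series (fun n => (n.+1%:R ^+ 2)^-1 : R) n).
    exact: cvgMr.
  by apply/funext => n; rewrite /series /= mulr_sumr.
have /cvg_ex[l Hl] := cd; apply/cvg_ex; exists (l + u N).
rewrite -(cvg_shiftn N) [X in X @ \oo --> _](_ : _ = fun n => series d n + u N).
  by apply: cvgD => //; exact: cvg_cst.
apply/funext => n; rewrite /series /= /d.
elim: n => [|n IH]; first by rewrite big_geq// add0r.
by rewrite big_nat_recr//= addrAC -IH addrC subrK.
Qed.

Lemma cabs_cvg (w : nat -> R[i]) (l : R[i]) :
  ((w : nat -> R[i]^o) @ \oo --> (l : R[i]^o)) -> cabs (w n) @[n --> \oo] --> cabs l.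
Proof.
move=> /cvgC_ReIm[h1 h2].
have -> : (fun n => cabs (w n)) = (fun n => Num.sqrt (complex.Re (w n) ^+ 2 + complex.Im (w n) ^+ 2)).
  by apply/funext => n; case: (w n).
have -> : cabs l = Num.sqrt (complex.Re l ^+ 2 + complex.Im l ^+ 2) by case: (l).
apply: continuous_cvg; first exact: sqrt_continuous.
rewrite [X in X @ \oo --> _](_ : _ = fun n => complex.Re (w n) * complex.Re (w n) +
   complex.Im (w n) * complex.Im (w n)); last by apply/funext => n; rewrite !expr2.
by rewrite !expr2; apply: cvgD; apply: cvgM.
Qed.

(** [slow_growth], applied to |w| and to 1 / |w|, bounds |w| from above and away
    from 0; then the increments of w are summable. *)
Lemma infinite_product_cvg (w : nat -> R[i]) (C : R) :
  (forall n, w n != 0) ->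
  (forall n, cabs (w n.+1 / w n - 1) <= C * (n.+1%:R ^+ 2)^-1) ->
  exists2 l, ((w : nat -> R[i]^o) @ \oo --> (l : R[i]^o)) & l != 0.
Proof.
move=> w0 H; have C0 : 0 <= C.
  by have := le_trans (cabs_ge0 _) (H 0%N); rewrite pmulr_lge0// invr_gt0 exprn_gt0.
have cw0 n : 0 < cabs (w n).
  rewrite lt_neqAle cabs_ge0 andbT eq_sym; apply: contra (w0 n) => /eqP h.
  by apply/eqP; exact: Normc.eq0_normc.
have D n : cabs (w n.+1 - w n) <= cabs (w n) * (C * (n.+1%:R ^+ 2)^-1).
  have -> : w n.+1 - w n = w n * (w n.+1 / w n - 1) by rewrite mulrBr mulr1 mulrCA mulfV// mulr1.
  by rewrite cabsM ler_wpM2l// cabs_ge0.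
have [B B0 HB] : exists2 B, 0 < B & forall n, (0 <= n)%N -> cabs (w n) <= B.
  apply: (@slow_growth (fun n => cabs (w n)) C 0 C0) => [n|n _]; first exact: cabs_ge0.
  have := cabsD (w n.+1 - w n) (w n); rewrite subrK; have := D n.
  move: (C * _) => e; lra.
have [M hM] : exists M : nat, forall n, (M <= n)%N -> 2 * C <= n%:R.
  exists (Num.bound (2 * C)) => n Mn; apply: (le_trans (ltW (archi_boundP _))).
    by rewrite mulr_ge0.
  by rewrite ler_nat.
have [B' B'0 HB'] : exists2 B, 0 < B & forall n, (M <= n)%N -> (cabs (w n))^-1 <= B.
  apply: (@slow_growth (fun n => (cabs (w n))^-1) (2 * C) M) => [|n|n Mn].
  - by rewrite mulr_ge0.
  - by rewrite invr_ge0 cabs_ge0.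
  rewrite -mulrA; have := D n; set e := C * _^-1 => De.
  have e0 : 0 <= e by rewrite mulr_ge0// invr_ge0 exprn_ge0.
  have e2 : e <= 1 / 2.
    rewrite /e ler_pdivrMr ?exprn_gt0//; have := hM n Mn.
    have : (1 : R) <= n.+1%:R by rewrite ler1n.
    have : (n%:R : R) <= n.+1%:R by rewrite ler_nat.
    move: (n.+1%:R) (n%:R) => a b ba a1 Cb; have := ler_wpM2l (le_trans ler01 a1) a1; lra.
  have h : cabs (w n) <= cabs (w n.+1) * (1 + 2 * e).
    have := cabsD (w n - w n.+1) (w n.+1); rewrite subrK.
    have -> : cabs (w n - w n.+1) = cabs (w n.+1 - w n) by rewrite -opprB /cabs normcN.
    move: De (cw0 n) (cw0 n.+1); move: (cabs (w n)) (cabs (w n.+1)) (cabs _) => a b d d1 a0 b0 d2.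
    have k1 : a * (1 - e) <= b by lra.
    have k2 := ler_wpM2r (_ : 0 <= 1 + 2 * e) k1; have {}k2 := k2 ltac:(lra).
    have k3 : 0 <= a * (e * (1 - 2 * e)) by rewrite mulr_ge0 ?(ltW a0)// mulr_ge0//; lra.
    lra.
  by rewrite ler_pdivlMl// ler_pdivrMr// [leRHS]mulrC.
have inc (p : R[i] -> R) : (forall z z', p z - p z' = p (z - z')) -> (forall z, `|p z| <= cabs z) ->
    cvgn (fun n => p (w n)).
  move=> padd ple; apply: (@cvg_of_increments _ (B * C) 0) => n _.
  rewrite padd; apply: le_trans (ple _) _; apply: le_trans (D n) _.
  by rewrite -mulrA ler_wpM2r ?HB// mulr_ge0// invr_ge0 exprn_ge0.
have /cvg_ex[a Ha] : cvgn (fun n => complex.Re (w n)).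
  by apply: inc => [z z'|z]; [rewrite raddfB | exact: Re_le_cabs].
have /cvg_ex[b Hb] : cvgn (fun n => complex.Im (w n)).
  by apply: inc => [z z'|z]; [rewrite raddfB | exact: Im_le_cabs].
have wl : ((w : nat -> R[i]^o) @ \oo --> ((a +i* b) : R[i]^o)).
  by apply/cvgC_ReIm; split.
exists (a +i* b) => //.
have cl := cabs_cvg wl.
apply/eqP => l0; rewrite l0 cabs0 in cl.
have : B'^-1 <= 0.
  rewrite -(cvg_lim _ cl)//; apply: limr_ge; first by apply/cvg_ex; exists 0.
  near=> n; have Mn : (M <= n)%N by near: n; exact: nbhs_infty_ge.
  have := HB' n Mn; rewrite invf_ple ?posrE//.
by rewrite leNgt invr_gt0 B'0.
Unshelve. all: by end_near. Qed.

End Products.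

(** * Convergence of Gauss's limit formula for Gamma *)

Section GammaConvergence.
Variable R : realType.
Local Open Scope complex_scope.
Implicit Types (z : R[i]) (x y : R).

Definition gamma_seq z (n : nat) : R[i] :=
  (n`!)%:R * cpow n%:R z / \prod_(k < n.+1) (z + k%:R).

Lemma addC_nat x y n : (x +i* y) + n%:R = (x + n%:R) +i* y.
Proof. by rewrite natC; apply/eqP; rewrite eq_complex /= addr0 !eqxx. Qed.

Lemma shift_neq0 x y n : 0 <= x -> x +i* y != 0 -> (x +i* y) + n%:R != 0.
Proof.
move=> x0 z0; rewrite addC_nat; apply: contra z0; rewrite !eq_complex /=.
move=> /andP[/eqP h ->]; rewrite andbT; apply/eqP; have := ler0n R n; lra.
Qed.

Lemma cexp_neq0 z : cexp z != 0.
Proof.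
apply: contraTneq (expR_gt0 (complex.Re z)) => h.
by rewrite -cabs_cexp h cabs0 ltxx.
Qed.

Lemma gamma_seq_neq0 x y n : 0 <= x -> x +i* y != 0 -> gamma_seq (x +i* y) n != 0.
Proof.
move=> x0 z0; rewrite /gamma_seq; apply: mulf_neq0.
  apply: mulf_neq0; last exact: cexp_neq0.
  by rewrite pnatr_eq0 -lt0n fact_gt0.
by rewrite invr_eq0; apply/prodf_neq0 => k _; exact: shift_neq0.
Qed.

Lemma gamma_seqS x y n : 0 <= x -> x +i* y != 0 ->
  gamma_seq (x +i* y) n.+1 / gamma_seq (x +i* y) n =
  n.+1%:R * cexp ((x +i* y) * (ln n.+1%:R - ln n%:R)%:C) / ((x +i* y) + n.+1%:R).
Proof.
move=> x0 z0; have g0 := gamma_seq_neq0 n x0 z0; have s0 := shift_neq0 n.+1 x0 z0.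
apply: (mulIf g0); rewrite divfK// /gamma_seq big_ord_recr/= factS natrM.
have -> : cpow n.+1%:R (x +i* y) =
    cexp ((x +i* y) * (ln n.+1%:R - ln n%:R)%:C) * cpow n%:R (x +i* y).
  by rewrite /cpow -cexpD -mulrDr -rmorphD subrK.
by rewrite invfM; ring.
Qed.

Lemma ln_ratio_bounds n : (0 < n)%N ->
  n.+1%:R^-1 <= ln (n.+1%:R : R) - ln n%:R <= n%:R^-1.
Proof.
move=> n0; have h : (0 : R) < n%:R by rewrite ltr0n.
have h1 : (0:R) < n.+1%:R by [].
have E : n.+1%:R = n%:R + 1 :> R by rewrite natr1.
apply/andP; split.
  rewrite -lerN2 opprB -ln_div ?posrE//.
  have -> : n%:R / n.+1%:R = 1 + (- n.+1%:R^-1) :> R.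
    by move: h h1 E; move: (n.+1%:R) (n%:R) => a b b0 a0 ->; field; rewrite gt_eqF//; lra.
  apply: le_ln1Dx; rewrite ltrN2 invf_lt1// ltr1n//.
rewrite -ln_div ?posrE//.
have -> : n.+1%:R / n%:R = 1 + n%:R^-1 :> R.
  by move: h h1 E; move: (n.+1%:R) (n%:R) => a b b0 a0 ->; field; rewrite gt_eqF.
by apply: le_ln1Dx; rewrite (lt_trans _ (_ : 0 < _)) ?invr_gt0// ltrN10.
Qed.

(** With l = ln (n + 1) - ln n = 1 / n + O(1 / n^2), the quotient is
    (n + 1) e^(z l) / (z + n + 1), where e^(z l) = 1 + z l + O(l^2); the terms of
    order 1 / n cancel. *)
Lemma gamma_ratio_bound x y : 0 <= x -> x +i* y != 0 -> exists C, forall n, (0 < n)%N ->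
  cabs (gamma_seq (x +i* y) n.+1 / gamma_seq (x +i* y) n - 1) <= C * (n%:R ^+ 2)^-1.
Proof.
move=> x0 z0; pose C1 := expR x * (2 * y ^+ 2 + x ^+ 2 + x * `|y|).
have C10 : 0 <= C1.
  rewrite /C1 mulr_ge0 ?expR_ge0// addr_ge0 ?mulr_ge0//.
  by rewrite addr_ge0 ?sqr_ge0// mulr_ge0// sqr_ge0.
exists (2 * C1 + cabs (x +i* y)) => n n0.
rewrite gamma_seqS//; set l := ln _ - ln _; set z := x +i* y.
have h : (1 : R) <= n%:R by rewrite ler1n.
have n00 : (0 : R) < n%:R by exact: lt_le_trans h.
have /andP[l1 l2] := ln_ratio_bounds n0; rewrite -/l in l1 l2.
have E : n.+1%:R = n%:R + 1 :> R by rewrite natr1.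
have l0 : 0 <= l by apply: le_trans l1; rewrite invr_ge0.
have l01 : 0 <= l <= 1.
  by rewrite l0 (le_trans l2)// invf_le1.
have s0 := shift_neq0 n.+1 x0 z0; rewrite -/z in s0.
have -> : n.+1%:R * cexp (z * l%:C) / (z + n.+1%:R) - 1 =
  (n.+1%:R * (cexp (z * l%:C) - 1 - z * l%:C) + z * (n.+1%:R * l%:C - 1)) / (z + n.+1%:R).
  by apply: (mulIf s0); rewrite mulrBl !divfK//; ring.
rewrite cabsM cabsV.
have d1 : n%:R <= cabs (z + n.+1%:R).
  rewrite /z addC_nat; apply: le_trans (Re_le_cabs _) => /=.
  by apply: le_trans (ler_norm _); rewrite E; lra.
have T := cexp_taylor1 y x0 l01; rewrite -/z -/C1 in T.
have T2 : cabs (n.+1%:R * (cexp (z * l%:C) - 1 - z * l%:C) + z * (n.+1%:R * l%:C - 1))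
    <= (2 * C1 + cabs z) / n%:R.
  apply: le_trans (cabsD _ _) _; rewrite !cabsM.
  have -> : n.+1%:R * l%:C - 1 = (n.+1%:R * l - 1)%:C 
    by rewrite natC; apply/eqP; rewrite eq_complex /=; apply/andP; split; apply/eqP; ring.
  rewrite (natC R n.+1) !cabsR normr_nat mulrDl; apply: lerD.
    apply: (le_trans (ler_wpM2l (ler0n _ _) T)).
    have : l ^+ 2 <= n%:R^-1 ^+ 2 by rewrite lerXn2r// nnegrE// invr_ge0.
    move=> /(ler_wpM2l C10) /(ler_wpM2l (ler0n R n.+1)) /le_trans; apply.
    have -> : n.+1%:R * (C1 * n%:R^-1 ^+ 2) = C1 / n%:R * (n.+1%:R / n%:R).
      by field; rewrite gt_eqF.
    have -> : 2 * C1 / n%:R = C1 / n%:R * 2 by ring.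
    rewrite ler_wpM2l ?divr_ge0//.
    by rewrite ler_pdivrMr// E; lra.
  rewrite ler_wpM2l ?cabs_ge0// ger0_norm.
    have := ler_wpM2l (ler0n R n.+1) l2; have -> : n.+1%:R / n%:R = 1 + n%:R^-1 :> R.
      by rewrite E; field; rewrite gt_eqF.
    lra.
  have := ler_wpM2l (ler0n R n.+1) l1; rewrite mulfV ?pnatr_eq0//; lra.
have -> : (2 * C1 + cabs z) / n%:R ^+ 2 = (2 * C1 + cabs z) / n%:R * n%:R^-1.
  by rewrite -mulrA -invfM -expr2.
apply: ler_pM => //; first exact: cabs_ge0.
  by rewrite invr_ge0 cabs_ge0.
by rewrite lef_pV2 ?posrE// (lt_le_trans n00).
Qed.

Lemma gamma_cvg x y : 0 <= x -> x +i* y != 0 ->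
  (cabs (gamma_seq (x +i* y) n) @[n --> \oo] --> cabs (cGamma (x +i* y))) /\
  0 < cabs (cGamma (x +i* y)).
Proof.
move=> x0 z0; have [C HC] := gamma_ratio_bound x0 z0.
have [||l wl l0] := @infinite_product_cvg R (fun n => gamma_seq (x +i* y) n.+1) C.
- by move=> n; exact: gamma_seq_neq0.
- by move=> n; exact: HC.
have gl : ((gamma_seq (x +i* y) : nat -> R[i]^o) @ \oo --> (l : R[i]^o)) by rewrite -cvg_shiftS.
have -> : cGamma (x +i* y) = l by exact: (cvg_lim (@norm_hausdorff _ _) gl).
split; first exact: cabs_cvg gl.
rewrite lt_neqAle cabs_ge0 andbT eq_sym; apply: contra l0 => /eqP h.
by apply/eqP; exact: Normc.eq0_normc.
Qed.

End GammaConvergence.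

(** * The size of the Plancherel density *)

Section GammaModulus.
Variable R : realType.
Local Open Scope complex_scope.
Implicit Types (x y : R).

Definition gamma_sqr x y (n : nat) : R :=
  (n`!)%:R ^+ 2 * (n%:R `^ x) ^+ 2 / \prod_(k < n.+1) ((x + k%:R) ^+ 2 + y ^+ 2).

Lemma cabs_gamma_seq x y n : (0 < n)%N -> cabs (gamma_seq (x +i* y) n) ^+ 2 = gamma_sqr x y n.
Proof.
move=> n0; rewrite /gamma_seq cabsM cabsV (cabsM (n`!)%:R) /gamma_sqr !exprMn exprVn; congr (_ * _ * _^-1).
- by rewrite natC cabsR normr_nat.
- rewrite /cpow cabs_cexp /powR pnatr_eq0 gtn_eqF//; congr (expR _ ^+ 2).
  by rewrite /= mulr0 subr0.
- elim: n.+1 => [|m IH]; first by rewrite !big_ord0 -[1]/(1%:C) cabsR normr1 expr1n.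
  by rewrite !big_ord_recr/= cabsM exprMn IH addC_nat cabs_sqr.
Qed.

Lemma ln1D_approx (s : R) : 0 <= s -> `|ln (1 + s) - s| <= s ^+ 2.
Proof.
move=> s0; have s1 : 0 < 1 + s by lra.
have h1 : ln (1 + s) <= s by apply: le_ln1Dx; lra.
have h2 : s - s ^+ 2 <= ln (1 + s).
  have : ln (1 + (- (s / (1 + s)))) <= - (s / (1 + s)).
    by apply: le_ln1Dx; rewrite ltrN2 ltr_pdivrMr//; lra.
  have -> : 1 - s / (1 + s) = (1 + s)^-1 by field; rewrite gt_eqF.
  rewrite lnV ?posrE// lerN2; apply: le_trans.
  rewrite ler_pdivlMr//; have := mulr_ge0 s0 (sqr_ge0 s); lra.
by rewrite ler_norml; apply/andP; split; have := sqr_ge0 s; lra.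
Qed.

Definition shift_err x := (2 * x + x ^+ 2) ^+ 2 + x ^+ 2.

Lemma shift_err_ge0 x : 0 <= shift_err x.
Proof. by rewrite addr_ge0// sqr_ge0. Qed.

(** Expansion of the logarithm in the relative increment
    (2 j x + x^2) / (j^2 + y^2), which is O(1 / j) uniformly in [y]. *)
Lemma ln_shift x y (j : R) : 0 <= x -> 1 <= j ->
  `|ln ((j + x) ^+ 2 + y ^+ 2) - ln (j ^+ 2 + y ^+ 2) - 2 * j * x / (j ^+ 2 + y ^+ 2)|
    <= shift_err x / j ^+ 2.
Proof.
move=> x0 j1; have j0 : 0 < j by exact: lt_le_trans j1.
have jj : 0 < j ^+ 2 by rewrite exprn_gt0.
pose F := j ^+ 2 + y ^+ 2; have jF : j ^+ 2 <= F by rewrite lerDl sqr_ge0.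
have F0 : 0 < F by exact: lt_le_trans jF.
pose s := (2 * j * x + x ^+ 2) / F.
have s0 : 0 <= s.
  by rewrite divr_ge0 ?(ltW F0)// addr_ge0 ?sqr_ge0// mulr_ge0// mulr_ge0// ltW.
have E : (j + x) ^+ 2 + y ^+ 2 = F * (1 + s).
  by rewrite /s mulrDr mulr1 mulrC divfK ?gt_eqF// /F; ring.
have s1 : 0 < 1 + s by lra.
rewrite E -/F lnM ?posrE// [ln F + _]addrC addrK.
have -> : 2 * j * x / F = s - x ^+ 2 / F by rewrite /s; ring.
have -> : ln (1 + s) - (s - x ^+ 2 / F) = (ln (1 + s) - s) + x ^+ 2 / F by ring.
have iF : F^-1 <= (j ^+ 2)^-1 by rewrite lef_pV2 ?posrE.
apply: le_trans (ler_normD _ _) _; rewrite /shift_err mulrDl; apply: lerD; last first.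
  by rewrite ger0_norm ?divr_ge0 ?sqr_ge0 ?(ltW F0)// ler_wpM2l// sqr_ge0.
apply: le_trans (ln1D_approx s0) _.
have sj : s <= (2 * x + x ^+ 2) / j.
  have : s <= (2 * j * x + x ^+ 2) / j ^+ 2.
    by rewrite ler_wpM2l// addr_ge0 ?sqr_ge0// mulr_ge0// mulr_ge0// ltW.
  move=> /le_trans; apply.
  have -> : (2 * x + x ^+ 2) / j = (2 * j * x + x ^+ 2 * j) / j ^+ 2.
    by field; rewrite gt_eqF.
  by rewrite ler_wpM2r ?invr_ge0 ?(ltW jj)// lerD2l ler_peMr// sqr_ge0.
have : s ^+ 2 <= ((2 * x + x ^+ 2) / j) ^+ 2.
  by apply: lerXn2r; rewrite ?nnegrE ?(le_trans s0 sj).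
by have -> : (2 * x + x ^+ 2) ^+ 2 / j ^+ 2 = ((2 * x + x ^+ 2) / j) ^+ 2 by rewrite exprMn exprVn.
Qed.

Variables (x1 x2 : R).
Hypotheses (x1_gt0 : 0 < x1) (x2_gt0 : 0 < x2).
Local Notation c := (x1 + x2).

(** The contribution of index j to
    |Gamma_n(x1 + i y) Gamma_n(x2 + i y) / Gamma_(2 n + 1)(2 i y)|^2, where Gamma_n
    is the n-th term of Gauss's formula. In the denominator the factors of index
    2 j and 2 j + 1 are grouped, as in the duplication formula. *)
Definition dens_factor y (j : R) : R :=
  j ^+ 2 * (j ^+ 2 + y ^+ 2) * ((j + 1 / 2) ^+ 2 + y ^+ 2) /
  ((j + 1 / 2) ^+ 2 * ((x1 + j) ^+ 2 + y ^+ 2) * ((x2 + j) ^+ 2 + y ^+ 2)).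

Definition dens_err := shift_err (1 / 2) + shift_err (1 / 2) + shift_err x1 + shift_err x2
  + (`|c - 1 / 2| + 1 / 2) * shift_err 1.

Lemma dens_factor_gt0 y j : 0 < j -> 0 < dens_factor y j.
Proof.
move=> j0; have h (u : R) : 0 < u -> 0 < u ^+ 2 + y ^+ 2.
  by move=> u0; rewrite ltr_wpDr ?sqr_ge0// exprn_gt0.
have j2 : 0 < j + 1 / 2 by lra.
have [jx1 jx2] : 0 < x1 + j /\ 0 < x2 + j by rewrite !addr_gt0.
by rewrite /dens_factor divr_gt0 ?mulr_gt0 ?exprn_gt0 ?h.
Qed.

(** The main terms 2 j u / (j^2 + y^2) given by [ln_shift] are linear in the
    shift u, and those of the factors add up to those of the telescoping
    logarithms. The errors are summable in j, uniformly in [y]. *)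
Lemma ln_dens_factor y (n : nat) :
  `|ln (dens_factor y n.+1%:R) -
    (- (c - 1 / 2) * (ln (n.+2%:R ^+ 2 + y ^+ 2) - ln (n.+1%:R ^+ 2 + y ^+ 2))
     - (ln n.+2%:R - ln n.+1%:R))| <= dens_err * (n.+1%:R ^+ 2)^-1.
Proof.
have E : n.+2%:R = n.+1%:R + 1 :> R by rewrite natr1.
have j1 : (1 : R) <= n.+1%:R by rewrite ler1n.
rewrite E; move: (n.+1%:R) j1 => j j1 {E}.
have j0 : 0 < j by exact: lt_le_trans j1.
have h (u z : R) : 0 < u -> 0 < u ^+ 2 + z ^+ 2.
  by move=> u0; rewrite ltr_wpDr ?sqr_ge0// exprn_gt0.
have j2 : 0 < j + 1 / 2 by lra. have jx1 : 0 < j + x1 by rewrite addr_gt0.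
have jx2 : 0 < j + x2 by rewrite addr_gt0. have jp : 0 < j + 1 by lra.
pose L u z := ln ((j + u) ^+ 2 + z ^+ 2) - ln (j ^+ 2 + z ^+ 2).
have HL u z : 0 <= u -> `|L u z - 2 * j * u / (j ^+ 2 + z ^+ 2)| <= shift_err u / j ^+ 2.
  by move=> u0; exact: ln_shift.
have ED : ln (dens_factor y j) = L (1 / 2) y - L (1 / 2) 0 - L x1 y - L x2 y.
  rewrite /dens_factor /L !expr0n /= !addr0 (addrC x1) (addrC x2).
  rewrite ln_div ?posrE ?mulr_gt0 ?exprn_gt0 ?h// !lnM ?posrE ?mulr_gt0 ?exprn_gt0 ?h//.
  by ring.
have EJ : ln (j + 1) - ln j = 1 / 2 * L 1 0.
  by rewrite /L !expr0n /= !addr0 !lnXn// !mulr2n; field.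
rewrite ED EJ -/(L 1 y).
have := HL (1 / 2) y ltac:(lra); have := HL (1 / 2) 0 ltac:(lra).
have := HL x1 y (ltW x1_gt0); have := HL x2 y (ltW x2_gt0).
have := HL 1 y ler01; have := HL 1 0 ler01.
have cn : c - 1 / 2 <= `|c - 1 / 2| /\ - (c - 1 / 2) <= `|c - 1 / 2|.
  by split; [exact: ler_norm | rewrite -normrN; exact: ler_norm].
rewrite /dens_err; set i := (j ^+ 2)^-1.
set a1 := `|L 1 0 - _|; set a2 := `|L 1 y - _|; set a3 := `|L x2 y - _|.
set a4 := `|L x1 y - _|; set a5 := `|L (1 / 2) 0 - _|; set a6 := `|L (1 / 2) y - _|.
move=> h1 h2 h3 h4 h5 h6.
have -> : L (1 / 2) y - L (1 / 2) 0 - L x1 y - L x2 y - (- (c - 1 / 2) * L 1 y - 1 / 2 * L 1 0) =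
  ((L (1 / 2) y - 2 * j * (1 / 2) / (j ^+ 2 + y ^+ 2)) - (L (1 / 2) 0 - 2 * j * (1 / 2) / (j ^+ 2 + 0 ^+ 2)))
  - (L x1 y - 2 * j * x1 / (j ^+ 2 + y ^+ 2)) - (L x2 y - 2 * j * x2 / (j ^+ 2 + y ^+ 2))
  + (c - 1 / 2) * (L 1 y - 2 * j * 1 / (j ^+ 2 + y ^+ 2)) + 1 / 2 * (L 1 0 - 2 * j * 1 / (j ^+ 2 + 0 ^+ 2)).
  by ring.
apply: le_trans (ler_normD _ _) _.
apply: (@le_trans _ _ (a6 + a5 + a4 + a3 + `|c - 1 / 2| * a2 + 1 / 2 * a1)).
  apply: lerD; last by rewrite normrM ger0_norm//; lra.
  apply: le_trans (ler_normD _ _) _; rewrite normrM lerD2r.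
  apply: le_trans (ler_normB _ _) _; rewrite lerD2r.
  apply: le_trans (ler_normB _ _) _; rewrite lerD2r.
  exact: ler_normB.
have := ler_wpM2l (normr_ge0 (c - 1 / 2)) h2.
by lra.
Qed.

Definition dens_prod y n : R := \prod_(k < n) dens_factor y k.+1%:R.

Lemma dens_prod_gt0 y n : 0 < dens_prod y n.
Proof. by apply: prodr_gt0 => k _; exact: dens_factor_gt0. Qed.

Lemma dens_err_ge0 : 0 <= dens_err.
Proof.
have : 0 <= (`|c - 1 / 2| + 1 / 2) * shift_err 1.
  by rewrite mulr_ge0 ?shift_err_ge0// addr_ge0.
have := shift_err_ge0 (1 / 2); have := shift_err_ge0 x1; have := shift_err_ge0 x2.
by rewrite /dens_err; lra.
Qed.

Lemma ln_dens_prod y n :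
  `|ln (dens_prod y n) -
    (- (c - 1 / 2) * (ln (n.+1%:R ^+ 2 + y ^+ 2) - ln (1 + y ^+ 2)) - ln n.+1%:R)| <= dens_err * 2.
Proof.
apply: (@le_trans _ _ (dens_err * \sum_(k < n) (k.+1%:R ^+ 2)^-1)); last first.
  by rewrite ler_wpM2l ?dens_err_ge0// inv_sqr_sum.
elim: n => [|n IH].
  rewrite /dens_prod !big_ord0 ln1 expr1n subrr mulr0 sub0r mulr0.
  by rewrite subrr oppr0 normr0.
rewrite /dens_prod !big_ord_recr/= -/(dens_prod y n) lnM ?posrE ?dens_prod_gt0 ?dens_factor_gt0//.
rewrite (mulrDr dens_err); apply: (le_trans _ (lerD IH (ln_dens_factor y n))).
by apply: le_trans (ler_normD _ _); rewrite le_eqVlt; apply/orP; left; apply/eqP; congr (`|_|); ring.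
Qed.

(** The contribution of index 0, the only one that vanishes with [y]. *)
Definition dens0 y : R := 16 * (y ^+ 2 * (1 / 4 + y ^+ 2) / ((x1 ^+ 2 + y ^+ 2) * (x2 ^+ 2 + y ^+ 2))).

Lemma natS2 n : n.*2.+1%:R = 2 * n%:R + 1 :> R.
Proof. by rewrite -natr1 -muln2 natrM mulrC. Qed.

Lemma gamma_sqr_ratio y n : 0 < y -> (0 < n)%N ->
  gamma_sqr x1 y n * gamma_sqr x2 y n / gamma_sqr 0 (2 * y) n.*2.+1 =
  dens0 y * (n%:R `^ c) ^+ 2 * dens_prod y n.
Proof.
move=> y0 n0; have np : (0 : R) < n%:R by rewrite ltr0n.
rewrite powRD; last by rewrite (gt_eqF np) implybT.
pose D x z m : R := \prod_(k < m) ((x + k%:R) ^+ 2 + z ^+ 2).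
have D0 x z m : 0 <= x -> 0 < z -> D x z m != 0.
  move=> x0 z0; apply/prodf_neq0 => k _.
  by rewrite gt_eqF// ltr_wpDl ?sqr_ge0// exprn_gt0.
suff K m : (m`!)%:R ^+ 2 * (m`!)%:R ^+ 2 / (D x1 y m.+1 * D x2 y m.+1) * D 0 (2 * y) m.*2.+2
    = dens0 y * dens_prod y m * (m.*2.+1`!)%:R ^+ 2.
  rewrite /gamma_sqr powRr0 expr1n mulr1 -!/(D _ _ _) exprMn.
  have f0 : (n.*2.+1`!)%:R != 0 :> R by rewrite pnatr_eq0 -lt0n fact_gt0.
  have h1 := D0 x1 y n.+1 (ltW x1_gt0) y0; have h2 := D0 x2 y n.+1 (ltW x2_gt0) y0.
  have h3 : D 0 (2 * y) n.*2.+2 != 0 by apply: D0 => //; rewrite mulr_gt0.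
  apply: (mulIf (_ : (n.*2.+1`!)%:R ^+ 2 != 0)); first by rewrite expf_neq0.
  transitivity (((n`!)%:R ^+ 2 * (n`!)%:R ^+ 2 / (D x1 y n.+1 * D x2 y n.+1) * D 0 (2 * y) n.*2.+2)
     * ((n%:R `^ x1) ^+ 2 * (n%:R `^ x2) ^+ 2)).
    by move: (D 0 _ _) (D x1 _ _) (D x2 _ _) h1 h2 h3 => d0 d1 d2 h1 h2 h3; field; rewrite f0 h1 h2 h3.
  by rewrite K; ring.
elim: m => [|m IH].
  rewrite /D /dens_prod /dens0 !big_ord_recr !big_ord0 /=.
  have h1 : x1 ^+ 2 + y ^+ 2 != 0 by rewrite gt_eqF// ltr_wpDl ?sqr_ge0// exprn_gt0.
  have h2 : x2 ^+ 2 + y ^+ 2 != 0 by rewrite gt_eqF// ltr_wpDl ?sqr_ge0// exprn_gt0.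
  rewrite !addr0 fact0 (_ : 1`! = 1%N)// !expr1n double0.
  by field; rewrite h1 h2.
have h1 := D0 x1 y m.+1 (ltW x1_gt0) y0; have h2 := D0 x2 y m.+1 (ltW x2_gt0) y0.
have g1 : (x1 + m.+1%:R) ^+ 2 + y ^+ 2 != 0 by rewrite gt_eqF// ltr_wpDl ?sqr_ge0// exprn_gt0.
have g2 : (x2 + m.+1%:R) ^+ 2 + y ^+ 2 != 0 by rewrite gt_eqF// ltr_wpDl ?sqr_ge0// exprn_gt0.
have -> : D 0 (2 * y) m.+1.*2.+2 = D 0 (2 * y) m.*2.+2 *
   ((2 * m.+1%:R) ^+ 2 + (2 * y) ^+ 2) * ((2 * m.+1%:R + 1) ^+ 2 + (2 * y) ^+ 2).
  rewrite doubleS /D !big_ord_recr/= !add0r; congr (_ * _ * _).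
    by rewrite -doubleS -muln2 natrM mulrC.
  by rewrite -doubleS natS2.
have -> : D x1 y m.+2 = D x1 y m.+1 * ((x1 + m.+1%:R) ^+ 2 + y ^+ 2) by rewrite /D big_ord_recr.
have -> : D x2 y m.+2 = D x2 y m.+1 * ((x2 + m.+1%:R) ^+ 2 + y ^+ 2) by rewrite /D big_ord_recr.
have -> : dens_prod y m.+1 = dens_prod y m * dens_factor y m.+1%:R by rewrite /dens_prod big_ord_recr.
have -> : (m.+1.*2.+1)`! = (m.+1.*2.+1 * (m.+1.*2 * m.*2.+1`!))%N by rewrite doubleS !factS.
have -> : (m.+1.*2.+1 * (m.+1.*2 * m.*2.+1`!))%N%:R = (2 * m.+1%:R + 1) * (2 * m.+1%:R) * (m.*2.+1`!)%:R :> R.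
  by rewrite !natrM natS2 -(muln2 m.+1) natrM [m.+1%:R * 2]mulrC mulrA.
rewrite factS natrM.
have j0 : (0 : R) < m.+1%:R by [].
have jn : (m.+1%:R + 1 / 2 : R) != 0 by rewrite gt_eqF//; lra.
move: IH; move: (D 0 _ _) (D x1 _ _) (D x2 _ _) h1 h2 => d0 d1 d2 h1 h2 IH.
rewrite /dens_factor; move: (m.+1%:R) j0 jn g1 g2 => j j0 jn g1 g2.
transitivity (((m`!)%:R ^+ 2 * (m`!)%:R ^+ 2 / (d1 * d2) * d0) *
  (j ^+ 4 * ((2 * j) ^+ 2 + (2 * y) ^+ 2) * ((2 * j + 1) ^+ 2 + (2 * y) ^+ 2) /
    (((x1 + j) ^+ 2 + y ^+ 2) * ((x2 + j) ^+ 2 + y ^+ 2)))).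
  by field; rewrite h1 h2 g1 g2.
rewrite IH; field.
have j2 : j * 2 + 1 != 0 by rewrite gt_eqF//; lra.
by rewrite g1 g2 j2.
Qed.

Hypothesis c_gt : 1 / 2 < c.

Definition dens_shape y : R := y ^+ 2 / (1 + y ^+ 2) * (1 + y ^+ 2) `^ (c - 1 / 2).

Definition dens_const : R := dens_err * 2 + (c - 1 / 2) * ln 5 + ln 2.

(** For n >= y the telescoped logarithm ln ((n + 1)^2 + y^2) is 2 ln n up to a
    bounded term, so that the powers of n cancel. *)
Lemma dens_prod_bound y n : (0 < n)%N -> 0 < y -> y <= n%:R ->
  expR (- dens_const) * (1 + y ^+ 2) `^ (c - 1 / 2) <= (n%:R `^ c) ^+ 2 * dens_prod y n
  <= expR dens_const * (1 + y ^+ 2) `^ (c - 1 / 2).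
Proof.
move=> n0 y0 yn; have n1 : (1 : R) <= n%:R by rewrite ler1n.
have np : (0 : R) < n%:R by exact: lt_le_trans n1.
have E : n.+1%:R = n%:R + 1 :> R by rewrite natr1.
have Y0 : 0 < 1 + y ^+ 2 by rewrite ltr_pwDl// sqr_ge0.
have F0 : 0 < n.+1%:R ^+ 2 + y ^+ 2 by rewrite ltr_pwDl ?sqr_ge0// exprn_gt0.
have pos : 0 < (n%:R `^ c) ^+ 2 * dens_prod y n by rewrite mulr_gt0 ?dens_prod_gt0// exprn_gt0// powR_gt0.
have lnE : ln ((n%:R `^ c) ^+ 2 * dens_prod y n) = 2 * c * ln n%:R + ln (dens_prod y n).
  by rewrite lnM ?posrE ?dens_prod_gt0 ?exprn_gt0 ?powR_gt0// lnXn ?powR_gt0// ln_powR mulr2n; ring.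
have h1 : ln (n%:R : R) <= ln n.+1%:R by rewrite ler_ln ?posrE// ler_nat.
have h2 : ln (n.+1%:R : R) <= ln 2 + ln n%:R by rewrite -lnM ?posrE// ler_ln ?posrE// ?mulr_gt0// E; lra.
have h3 : 2 * ln (n%:R : R) <= ln (n.+1%:R ^+ 2 + y ^+ 2).
  rewrite mulr_natl -lnXn// ler_ln ?posrE ?exprn_gt0//.
  by rewrite E; have := sqr_ge0 y; have := np; lra.
have h4 : ln (n.+1%:R ^+ 2 + y ^+ 2) <= ln 5 + 2 * ln (n%:R : R).
  rewrite mulr_natl -lnXn// -lnM ?posrE ?exprn_gt0// ler_ln ?posrE ?mulr_gt0 ?exprn_gt0//.
  have : y ^+ 2 <= n%:R ^+ 2 by rewrite lerXn2r ?nnegrE ?(ltW y0) ?(ltW np).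
  by move=> hy; rewrite E; have := ler_wpM2l (ltW np) n1; rewrite mulr1; lra.
have h5 : 0 <= ln (2 : R) by apply: ln_ge0; lra.
have c2 : 0 <= c - 1 / 2 by move: c_gt; lra.
have := ln_dens_prod y n; rewrite ler_norml => /andP[k1 k2].
have m3 := ler_wpM2l c2 h3; have m4 := ler_wpM2l c2 h4.
have PE : forall s, expR s * (1 + y ^+ 2) `^ (c - 1 / 2) = expR (s + (c - 1 / 2) * ln (1 + y ^+ 2)).
  by move=> s; rewrite /powR gt_eqF// expRD.
rewrite !PE -[(n%:R `^ c) ^+ 2 * _]lnK ?posrE// !ler_expR lnE /dens_const.
move: (ln (dens_prod y n)) (ln n%:R) (ln n.+1%:R) (ln (n.+1%:R ^+ 2 + y ^+ 2)) (ln (1 + y ^+ 2)) h1 h2 h3 h4 k1 k2 m3 m4 h5.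
move: (ln 5) (ln 2) (dens_err) => l5 l2 e P ln0 ln1 F Y h1 h2 h3 h4 k1 k2 m3 m4 h5.
by apply/andP; split; lra.
Qed.

Definition dens0_const : R := 64 * (1 + (x1 ^+ 2)^-1) * (1 + (x2 ^+ 2)^-1) * (1 + x1 ^+ 2) * (1 + x2 ^+ 2).

Lemma dens0_bound y : 0 < y ->
  dens0_const^-1 * (y ^+ 2 / (1 + y ^+ 2)) <= dens0 y <= dens0_const * (y ^+ 2 / (1 + y ^+ 2)).
Proof.
move=> y0; set Y := y ^+ 2; have Y0 : 0 < Y by rewrite exprn_gt0.
have Y1 : 0 < 1 + Y by lra.
have key x : 0 < x -> (1 + Y) <= (1 + (x ^+ 2)^-1) * (x ^+ 2 + Y) /\ x ^+ 2 + Y <= (1 + x ^+ 2) * (1 + Y).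
  move=> x0; have X0 : 0 < x ^+ 2 by rewrite exprn_gt0.
  move: (x ^+ 2) X0 => X X0; have iX : 0 < X^-1 by rewrite invr_gt0.
  have XX : X^-1 * X = 1 by rewrite mulVf// gt_eqF.
  split; first by have := mulr_gt0 iX Y0; lra.
  by have := mulr_gt0 X0 Y0; lra.
have [a1 a2] := key x1 x1_gt0; have [b1 b2] := key x2 x2_gt0.
have X1 : 0 < x1 ^+ 2 + Y by rewrite addr_gt0// exprn_gt0.
have X2 : 0 < x2 ^+ 2 + Y by rewrite addr_gt0// exprn_gt0.
have i1 : 0 < (x1 ^+ 2)^-1 by rewrite invr_gt0 exprn_gt0.
have i2 : 0 < (x2 ^+ 2)^-1 by rewrite invr_gt0 exprn_gt0.
have s1 := sqr_ge0 x1; have s2 := sqr_ge0 x2.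
rewrite /dens0 /dens0_const -/Y.
move: (x1 ^+ 2) (x2 ^+ 2) ((x1 ^+ 2)^-1) ((x2 ^+ 2)^-1) i1 i2 s1 s2 a1 a2 b1 b2 X1 X2.
move=> u v iu iv i1 i2 s1 s2 a1 a2 b1 b2 X1 X2.
have D0 : 0 < (u + Y) * (v + Y) by rewrite mulr_gt0.
have up : (1 + Y) * (1 + Y) <= (1 + iu) * (1 + iv) * ((u + Y) * (v + Y)).
  by rewrite mulrACA; apply: ler_pM => //; exact: ltW.
have lo : (u + Y) * (v + Y) <= (1 + u) * (1 + v) * ((1 + Y) * (1 + Y)).
  by rewrite [leRHS]mulrACA; apply: ler_pM => //; exact: ltW.
have P1 : 1 <= (1 + iu) * (1 + iv) by have := mulr_gt0 i1 i2; lra.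
have P2 : 1 <= (1 + u) * (1 + v) by have := mulr_ge0 s1 s2; lra.
have -> : 64 * (1 + iu) * (1 + iv) * (1 + u) * (1 + v) = 64 * ((1 + iu) * (1 + iv)) * ((1 + u) * (1 + v)) by ring.
move: ((1 + iu) * (1 + iv)) ((1 + u) * (1 + v)) ((u + Y) * (v + Y)) P1 P2 D0 up lo.
move=> P Q D P1 P2 D0 up lo.
have S0 : 0 < (1 + Y) * (1 + Y) by rewrite mulr_gt0.
have U : D^-1 <= P / ((1 + Y) * (1 + Y)).
  by rewrite ler_pdivlMr// ler_pdivrMl// [leRHS]mulrC.
have L : (Q * ((1 + Y) * (1 + Y)))^-1 <= D^-1.
  by rewrite lef_pV2// posrE mulr_gt0//; exact: lt_le_trans P2.
have Qp : 0 < Q by exact: lt_le_trans P2.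
have Pp : 0 < P by exact: lt_le_trans P1.
have iY : 0 < (1 + Y)^-1 by rewrite invr_gt0.
have Y1n : 1 + Y != 0 by rewrite gt_eqF.
have PQ : 1 <= P * Q by rewrite -[leLHS]mulr1; apply: ler_pM.
apply/andP; split.
  have e1 := ler_wpM2l (_ : 0 <= 16 * (Y * (1 / 4 + Y))) L.
  have {}e1 := e1 ltac:(have := mulr_gt0 Y0 Y0; lra).
  have -> : 16 * (Y * (1 / 4 + Y) / D) = 16 * (Y * (1 / 4 + Y)) / D by ring.
  apply: (le_trans _ e1).
  have -> : 16 * (Y * (1 / 4 + Y)) * (Q * ((1 + Y) * (1 + Y)))^-1 =
     Q^-1 * (16 * (Y * (1 / 4 + Y)) * (1 + Y)^-1 * (1 + Y)^-1).
    by field; rewrite Y1n gt_eqF.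
  apply: ler_pM.
  - by rewrite invr_ge0 mulr_ge0 ?(ltW Qp)// mulr_ge0// ltW.
  - by rewrite divr_ge0// ltW.
  - rewrite lef_pV2 ?posrE ?mulr_gt0// ler_peMl ?(ltW Qp)//; lra.
  rewrite ler_wpM2r ?(ltW iY)// ler_pdivlMr//; have := mulr_gt0 Y0 Y0; lra.
have e1 := ler_wpM2l (_ : 0 <= 16 * (Y * (1 / 4 + Y))) U.
have {}e1 := e1 ltac:(have := mulr_gt0 Y0 Y0; lra).
have -> : 16 * (Y * (1 / 4 + Y) / D) = 16 * (Y * (1 / 4 + Y)) / D by ring.
apply: (le_trans e1).
have -> : 16 * (Y * (1 / 4 + Y)) * (P / ((1 + Y) * (1 + Y))) =
   P * (16 * (Y * (1 / 4 + Y)) * (1 + Y)^-1 * (1 + Y)^-1) by field.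
have -> : 64 * P * Q * (Y / (1 + Y)) = P * (64 * Q * (Y / (1 + Y))) by ring.
rewrite ler_wpM2l ?(ltW Pp)//.
rewrite [leRHS]mulrA ler_wpM2r ?(ltW iY)// ler_pdivrMr//.
have h : 1 * (Y * (1 + Y)) <= Q * (Y * (1 + Y)) by rewrite ler_wpM2r// mulr_ge0// ltW.
have := mulr_gt0 Y0 Y0; lra.
Qed.

Lemma dens0_const_gt0 : 0 < dens0_const.
Proof.
rewrite /dens0_const; have i1 : 0 < (x1 ^+ 2)^-1 by rewrite invr_gt0 exprn_gt0.
have i2 : 0 < (x2 ^+ 2)^-1 by rewrite invr_gt0 exprn_gt0.
have s1 := sqr_ge0 x1; have s2 := sqr_ge0 x2.
by rewrite !mulr_gt0//; lra.
Qed.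

(** The bounds of the finite products are uniform in n >= y, and pass to the
    limit. *)
Lemma gamma_ratio_limit_bound y : 0 < y ->
  (dens0_const * expR dens_const)^-1 * dens_shape y <=
  cabs (cGamma (x1 +i* y)) ^+ 2 * cabs (cGamma (x2 +i* y)) ^+ 2 / cabs (cGamma (0 +i* (2 * y))) ^+ 2
  <= dens0_const * expR dens_const * dens_shape y.
Proof.
move=> y0.
have nz x : 0 <= x -> x +i* y != 0 by move=> _; rewrite eq_complex /= negb_and (gt_eqF y0) orbT.
have nz0 : 0 +i* (2 * y) != 0 by rewrite eq_complex /= negb_and; apply/orP; right; rewrite gt_eqF// mulr_gt0.
have [c1 p1] := gamma_cvg (ltW x1_gt0) (nz _ (ltW x1_gt0)).
have [c2 p2] := gamma_cvg (ltW x2_gt0) (nz _ (ltW x2_gt0)).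
have [c3 p3] := gamma_cvg (lexx 0) nz0.
have sq (u : nat -> R) (l : R) : u n @[n --> \oo] --> l -> u n ^+ 2 @[n --> \oo] --> l ^+ 2.
  by move=> ul; rewrite expr2; under eq_fun do rewrite expr2; exact: cvgM.
have c3' : cabs (gamma_seq (0 +i* (2 * y)) n.*2.+1) @[n --> \oo] --> cabs (cGamma (0 +i* (2 * y))).
  apply: (cvg_comp (fun n : nat => n.*2.+1) (fun n => cabs (gamma_seq (0 +i* (2 * y)) n)) _ c3).
  apply/cvgnyPge => A; near=> n; have An : (A <= n)%N by near: n; exact: nbhs_infty_ge.
  by apply: leq_trans An _; rewrite -addnn; apply: leqW; exact: leq_addr.
have g3 : cabs (cGamma (0 +i* (2 * y))) ^+ 2 != 0 by rewrite expf_neq0// gt_eqF.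
have Q : (fun n => cabs (gamma_seq (x1 +i* y) n) ^+ 2 * cabs (gamma_seq (x2 +i* y) n) ^+ 2 *
    (cabs (gamma_seq (0 +i* (2 * y)) n.*2.+1) ^+ 2)^-1) @ \oo -->
    cabs (cGamma (x1 +i* y)) ^+ 2 * cabs (cGamma (x2 +i* y)) ^+ 2 / cabs (cGamma (0 +i* (2 * y))) ^+ 2.
  exact: cvgM (cvgM (sq _ _ c1) (sq _ _ c2)) (cvgV g3 (sq _ _ c3')).
have QE : \forall n \near \oo,
   (dens0_const * expR dens_const)^-1 * dens_shape y <=
   cabs (gamma_seq (x1 +i* y) n) ^+ 2 * cabs (gamma_seq (x2 +i* y) n) ^+ 2 *
   (cabs (gamma_seq (0 +i* (2 * y)) n.*2.+1) ^+ 2)^-1 <= dens0_const * expR dens_const * dens_shape y.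
  near=> n; have n0 : (0 < n)%N by near: n; exact: nbhs_infty_gt.
  have yn : y <= n%:R by near: n; exact: nbhs_infty_ger.
  rewrite !cabs_gamma_seq// gamma_sqr_ratio//.
  have /andP[a1 a2] := dens_prod_bound n0 y0 yn; have /andP[b1 b2] := dens0_bound y0.
  have K0 := dens0_const_gt0; have E0 := expR_gt0 dens_const.
  have S0 : 0 <= y ^+ 2 / (1 + y ^+ 2) by rewrite divr_ge0 ?sqr_ge0// addr_ge0 ?sqr_ge0.
  rewrite -mulrA invfM -expRN /dens_shape; apply/andP; split.
    rewrite mulrACA; apply: ler_pM => //; first by rewrite mulr_ge0// invr_ge0 ltW.
    by rewrite mulr_ge0 ?expR_ge0 ?powR_ge0.
  rewrite [leRHS]mulrACA; apply: ler_pM => //.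
    by apply: le_trans b1; rewrite mulr_ge0// invr_ge0 ltW.
  by apply: le_trans a1; rewrite mulr_ge0 ?expR_ge0 ?powR_ge0.
rewrite -(cvg_lim _ Q)//; apply/andP; split.
  apply: limr_ge; first by apply/cvg_ex; eexists; exact: Q.
  by apply: filterS QE => n /andP[].
apply: limr_le; first by apply/cvg_ex; eexists; exact: Q.
by apply: filterS QE => n /andP[].
Unshelve. all: by end_near. Qed.

End GammaModulus.

Section PlancherelDensity.
Variables (R : realType) (alpha beta : R).
Hypothesis hab : beta <= alpha.
Hypothesis hb : - (1 / 2) <= beta.
Hypothesis ha : - (1 / 2) < alpha.
Local Open Scope complex_scope.

Definition density_model (lambda : R) : R :=
  (lambda / 2) ^+ 2 / (1 + (lambda / 2) ^+ 2) * (1 + (lambda / 2) ^+ 2) `^ (alpha + 1 / 2).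

(** |c(lambda)|^(-2) is a constant times the quotient of Gamma functions at
    x1 = rho / 2, x2 = rho / 2 - beta and y = lambda / 2. *)
Lemma n_weight_bounds : exists k K : R, [/\ 0 < k, 0 < K &
  forall lambda, 0 < lambda ->
    k * density_model lambda <= n_weight alpha beta lambda <= K * density_model lambda].
Proof.
pose x1 := rho alpha beta / 2; pose x2 := x1 - beta.
have x10 : 0 < x1 by rewrite /x1 /rho; move: ha hb; lra.
have x20 : 0 < x2 by rewrite /x2 /x1 /rho; move: hab; lra.
have cE : x1 + x2 = alpha + 1 by rewrite /x2 /x1 /rho; field.
have c_gt : 1 / 2 < x1 + x2 by rewrite cE; move: ha; lra.
have a10 : 0 <= alpha + 1 by move: ha; lra.
have nzc : (alpha + 1) +i* 0 != 0 by rewrite eq_complex /= eqxx andbT gt_eqF//; move: ha; lra.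
have [_ gc] := gamma_cvg a10 nzc.
pose G : R := (2 * pi) `^ (- (1 / 2)) / ((2 `^ rho alpha beta) ^+ 2 * cabs (cGamma ((alpha + 1) +i* 0)) ^+ 2).
have G0 : 0 < G.
  by rewrite divr_gt0 ?mulr_gt0 ?exprn_gt0 ?powR_gt0// mulr_gt0// pi_gt0.
pose K := dens0_const x1 x2 * expR (dens_const x1 x2).
have K0 : 0 < K by rewrite mulr_gt0 ?expR_gt0// dens0_const_gt0.
exists (G * K^-1), (G * K); split.
- by apply: mulr_gt0 => //; rewrite invr_gt0.
- exact: mulr_gt0.
move=> lambda l0.
have y0 : 0 < lambda / 2 by rewrite divr_gt0.
have nE : n_weight alpha beta lambda = G *
  (cabs (cGamma (x1 +i* (lambda / 2))) ^+ 2 * cabs (cGamma (x2 +i* (lambda / 2))) ^+ 2 /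
   cabs (cGamma (0 +i* (2 * (lambda / 2)))) ^+ 2).
  rewrite /n_weight /c_function complex_half -/x1.
  have -> : x1 +i* (lambda / 2) - beta%:C = x2 +i* (lambda / 2).
    by apply/eqP; rewrite eq_complex /= subr0 !eqxx.
  have -> : 2 * (lambda / 2) = lambda by field.
  rewrite cabsM cabsV cabsM (cabsM (cpow _ _)) (cabsM (cGamma (x1 +i* _))).
  have -> : cabs (cpow 2 (rho alpha beta -i* lambda)) = 2 `^ rho alpha beta.
    rewrite /cpow cabs_cexp /powR (_ : (2 == 0 :> R) = false) ?pnatr_eq0//; congr expR.
    by rewrite /= mulr0 subr0.
  rewrite /G -[(alpha + 1)%:C]/((alpha + 1) +i* 0) !exprMn exprVn exprMn.
  move: (_ `^ rho _ _ ^+ 2) (_ `^ (- (1 / 2))) (cabs _ ^+ 2) (cabs _ ^+ 2) (cabs _ ^+ 2) (cabs _ ^+ 2).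
  by move=> p pp u1 u2 u3 u4; rewrite !invfM !invrK; ring.
rewrite nE -(mulrA G K^-1) -(mulrA G K) !(ler_pM2l G0).
have := gamma_ratio_limit_bound x10 x20 c_gt y0.
rewrite /dens_shape cE -/K.
by have -> : alpha + 1 - 1 / 2 = alpha + 1 / 2 by field.
Qed.

End PlancherelDensity.

(** * Smooth bump functions *)

Section Bump.
Variable R : realType.
Implicit Types (q P : {poly R}) (x y s : R).

(** This family, P q^(- k) exp(- 1 / q) extended by 0, contains the bumps and is
    closed under differentiation, which makes its members smooth. *)
Definition flat q P (k : nat) x : R :=
  if 0 < q.[x] then P.[x] * (q.[x])^-1 ^+ k * expR (- (q.[x])^-1) else 0.

Lemma poly_bounded P x : exists M, forall y, `|y - x| < 1 -> `|P.[y]| <= M.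
Proof.
elim/poly_ind: P => [|P c [M HM]].
  by exists 0 => y _; rewrite horner0 normr0.
exists (M * (1 + `|x|) + `|c|) => y yx; rewrite hornerMXaddC.
apply: le_trans (ler_normD _ _) _; rewrite lerD2r normrM; apply: ler_pM => //.
  exact: HM.
by rewrite -[y](subrK x); apply: le_trans (ler_normD _ _) _; rewrite lerD2r ltW.
Qed.

Lemma exp_neg_inv_le (u : R) m : 0 < u -> expR (- u^-1) <= m.+1`!%:R * u ^+ m.+1.
Proof.
move=> u0; have := @expR_ge1Dxn R u^-1 m; rewrite invr_ge0 (ltW u0) => /(_ isT) h.
rewrite expRN invf_ple ?posrE ?expR_gt0//; last first.
  by rewrite mulr_gt0 ?exprn_gt0// ltr0n fact_gt0.
apply: le_trans h; rewrite invfM -exprVn mulrC; lra.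
Qed.

Lemma dv_quadratic (f : R -> R) x M : f x = 0 ->
  (forall y, `|y - x| < 1 -> `|f y| <= M * (y - x) ^+ 2) -> is_derive x 1 f 0.
Proof.
move=> fx H; apply/is_derive1_caratheodory.
exists (fun z => if z == x then 0 else f z / (z - x)); split; last by rewrite eqxx.
  move=> z; case: eqP => [->|/eqP zx]; first by rewrite fx !subrr mulr0.
  by rewrite fx subr0 divfK// subr_eq0.
apply/cvgrPdist_lt => e e0; rewrite eqxx.
have M1 : 0 < `|M| + 1 by rewrite ltr_wpDl.
have eM : 0 < e / (`|M| + 1) by rewrite divr_gt0.
exists (Num.min 1 (e / (`|M| + 1))) => /=; first by rewrite lt_min ltr01.
move=> z /=; rewrite distrC lt_min => /andP[z1 ze].
rewrite sub0r normrN; case: eqP => [_|/eqP zx]; first by rewrite normr0.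
have zx0 : 0 < `|z - x| by rewrite normr_gt0 subr_eq0.
rewrite normrM normfV ltr_pdivrMr//; apply: le_lt_trans (H z z1) _.
rewrite -real_normK ?num_real// expr2 mulrA ltr_pM2r//.
move: ze; rewrite ltr_pdivlMr//; apply: le_lt_trans.
rewrite mulrC ler_wpM2l//; have := ler_norm M; lra.
Qed.

(** The delicate points are the zeros x of q: there exp(- 1 / q) = O(q^(k + 2)) and
    q(y) = O(y - x), so that the function is O((y - x)^2). *)
Lemma dv_flat q P k x : is_derive x 1 (flat q P k)
  (flat q (P^`() * q ^+ 2 - k%:R *: (P * q^`() * q) + P * q^`()) k.+2 x).
Proof.
have qc := @continuous_horner R q x.
have [q0|q0|q0] := ltrgt0P q.[x].
- have [d d0 Hd] := cts_eps qc q0.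
  apply: (dv_near (f := fun y => P.[y] * (q.[y])^-1 ^+ k * expR (- (q.[y])^-1))).
    exists d => // y /Hd; rewrite /flat ltr_norml => /andP[h _].
    by have -> : 0 < q.[y] by lra.
  have qn : q.[x] != 0 by rewrite gt_eqF.
  have Dq := is_derive_poly q x; have DP := is_derive_poly P x.
  have Di := dvV (f := fun y => q.[y]) qn Dq.
  have DE := dvc (g := fun y => - (q.[y])^-1) (is_derive_expR (- (q.[x])^-1)) (dvN Di).
  have Dk : is_derive x 1 (fun y => (q.[y])^-1 ^+ k)
     (- k%:R * (q.[x])^-1 ^+ k.+1 * (q^`()).[x]).
    case: k => [|k].
      by apply: (dv_ext (dvC 1 x)); rewrite ?oppr0 ?mul0r//; apply/funext => y; rewrite expr0.
    apply: (dv_ext (dvX k Di)) => //.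
    have -> : (q.[x])^-1 ^+ k.+2 = (q.[x])^-1 ^+ k * (q.[x])^-1 ^+ 2 by rewrite -exprD addn2.
    by rewrite -[in LHS](exprVn q.[x] 2); ring.
  apply: (dv_ext (dvM (dvM DP Dk) DE)) => //.
  rewrite /flat q0 !(hornerD, hornerN, hornerZ, hornerM, horner_exp) -!exprVn.
  rewrite (_ : (q.[x])^-1 ^+ k.+2 = (q.[x])^-1 ^+ k * (q.[x])^-1 ^+ 2); last first.
    by rewrite -exprD addn2.
  rewrite (_ : (q.[x])^-1 ^+ k.+1 = (q.[x])^-1 ^+ k * (q.[x])^-1); last first.
    by rewrite exprSr.
  by field.
- have nq0 : 0 < - q.[x] by lra.
  have [d d0 Hd] := cts_eps qc nq0.
  rewrite {2}/flat ltNge (ltW q0) /=; apply: dv_near (dvC 0 x).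
  exists d => // y /Hd; rewrite /flat ltr_norml => /andP[_ h].
  by have -> : (0 < q.[y]) = false by apply/negbTE; lra.
rewrite {2}/flat q0 ltxx; have [MP HP] : exists M : R, forall y, `|y - x| < 1 -> `|P.[y]| <= M by exact: poly_bounded.
have /factor_theorem[r qE] : root q x by rewrite /root q0.
have [Mr Hr] : exists M : R, forall y, `|y - x| < 1 -> `|r.[y]| <= M by exact: poly_bounded.
apply: (@dv_quadratic _ _ (MP * (k.+2`!)%:R * Mr ^+ 2)); first by rewrite /flat q0 ltxx.
move=> y yx; have hP := HP y yx; have hr := Hr y yx.
have MP0 : 0 <= MP by exact: le_trans hP.
have Mr0 : 0 <= Mr by exact: le_trans hr.
rewrite /flat; case: ifPn => [qy|_]; last first.
  by rewrite normr0 mulr_ge0 ?sqr_ge0// !mulr_ge0// exprn_ge0.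
have h1 := exp_neg_inv_le k.+1 qy.
rewrite !normrM (ger0_norm (expR_ge0 _)) -!mulrA; apply: ler_pM => //.
rewrite ger0_norm ?exprn_ge0 ?invr_ge0 ?(ltW qy)//.
apply: (le_trans (ler_wpM2l _ h1)); first by rewrite exprn_ge0// invr_ge0 ltW.
have qk : q.[y] ^+ k != 0 by rewrite expf_neq0// gt_eqF.
have -> : (q.[y])^-1 ^+ k * ((k.+2)`!%:R * q.[y] ^+ k.+2) = (k.+2)`!%:R * q.[y] ^+ 2.
  by rewrite -addn2 exprD exprVn addn2; field.
have -> : Mr * (Mr * (y - x) ^+ 2) = Mr ^+ 2 * (y - x) ^+ 2 by ring.
rewrite ler_wpM2l// qE hornerM hornerXsubC exprMn ler_wpM2r ?sqr_ge0//.
by rewrite -real_normK ?num_real// lerXn2r ?nnegrE.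
Qed.

Lemma smooth_flat q P k : smooth (flat q P k).
Proof.
have H n : exists P' k', derive1n n (flat q P k) = flat q P' k'.
  elim: n => [|n [P' [k' IH]]]; first by exists P, k.
  exists (P'^`() * q ^+ 2 - k'%:R *: (P' * q^`() * q) + P' * q^`()), k'.+2.
  rewrite derive1nS IH; apply/funext => x; rewrite derive1E.
  by have [_ ->] := dv_flat q P' k' x.
by move=> n x; have [P' [k' ->]] := H n; have [] := dv_flat q P' k' x.
Qed.

Lemma smooth0 : smooth (fun _ : R => 0 : R).
Proof.
have -> : (fun _ : R => 0 : R) = flat 0 0 0.
  by apply/funext => x; rewrite /flat horner0 ltxx.
exact: smooth_flat.
Qed.

Lemma smoothD (f g : R -> R) : smooth f -> smooth g -> smooth (fun x => f x + g x).
Proof.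
move=> sf sg; have H n : derive1n n (fun x => f x + g x) = fun x => derive1n n f x + derive1n n g x.
  elim: n => [|n IH]; first by [].
  rewrite derive1nS IH; apply/funext => x; rewrite derive1E (deriveD (sf n x) (sg n x)).
  by rewrite !derive1nS !derive1E.
by move=> n x; rewrite H; exact: derivableD.
Qed.

Lemma smooth_sum (K : nat) (f : nat -> R -> R) : (forall k, smooth (f k)) ->
  smooth (fun x => \sum_(k < K) f k x).
Proof.
move=> sf; elim: K => [|K IH].
  have -> : (fun x => \sum_(k < 0) f k x) = fun=> 0 by apply/funext => x; rewrite big_ord0.
  exact: smooth0.
have -> : (fun x => \sum_(k < K.+1) f k x) = fun x => \sum_(k < K) f k x + f K x.
  by apply/funext => x; rewrite big_ord_recr.
exact: (smoothD IH (sf K)).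
Qed.

(** Positive exactly on ]s, 2 s[, with maximum 1 whatever the scale. *)
Definition bump_poly s : {poly R} := (4 / s ^+ 2) *: (('X - s%:P) * ((2 * s)%:P - 'X)).

Definition bump s a x : R := flat (bump_poly s) a%:P 0 x.

Lemma bump_polyE s x : (bump_poly s).[x] = 4 / s ^+ 2 * ((x - s) * (2 * s - x)).
Proof. by rewrite /bump_poly !hornerE. Qed.

Lemma bumpE s a x : bump s a x =
  if 0 < (bump_poly s).[x] then a * expR (- ((bump_poly s).[x])^-1) else 0.
Proof. by rewrite /bump /flat hornerC expr0 mulr1. Qed.

Lemma bump_ge0 s a x : 0 <= a -> 0 <= bump s a x.
Proof. by move=> a0; rewrite bumpE; case: ifP => // _; rewrite mulr_ge0// expR_ge0. Qed.

Lemma bump_le s a x : 0 <= a -> bump s a x <= a.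
Proof.
move=> a0; rewrite bumpE; case: ifP => // q0; rewrite ler_piMr// -[leRHS]expR0 ler_expR.
by rewrite oppr_le0 invr_ge0 ltW.
Qed.

Lemma bump_supp s a x : 0 < s -> bump s a x != 0 -> s < x < 2 * s.
Proof.
move=> s0; rewrite bumpE bump_polyE; case: ifP => [|]; last by rewrite eqxx.
rewrite pmulr_rgt0; last by rewrite divr_gt0// exprn_gt0.
move=> h _; rewrite ltNge (ltNge x) -negb_or; apply/negP => /orP[] h1; move: h; apply/negP;
  rewrite -leNgt.
- by apply: mulr_le0_ge0; lra.
- by apply: mulr_ge0_le0; lra.
Qed.

Lemma bump_lower s a x : 0 < s -> 0 <= a -> 5 / 4 * s < x <= 7 / 4 * s ->
  a * expR (- 4) <= bump s a x.
Proof.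
move=> s0 a0 /andP[x1 x2]; have q4 : 4^-1 <= (bump_poly s).[x].
  rewrite bump_polyE mulrAC ler_pdivlMr ?exprn_gt0//.
  have := mulr_ge0 (_ : 0 <= x - 5 / 4 * s) (_ : 0 <= 7 / 4 * s - x).
  by move=> /(_ ltac:(lra) ltac:(lra)); have := mulr_gt0 s0 s0; rewrite expr2; lra.
have q0 : 0 < (bump_poly s).[x] by apply: lt_le_trans q4; rewrite invr_gt0.
rewrite bumpE q0 ler_wpM2l// ler_expR lerN2.
by rewrite invf_ple ?posrE.
Qed.

Definition packet (K : nat) (s a : nat -> R) x : R := \sum_(k < K) bump (s k) (a k) x.

Local Open Scope complex_scope.

Lemma test_function_packet K (s a : nat -> R) : (forall k, 0 < s k) ->
  test_function (fun x => (packet K s a x)%:C).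
Proof.
move=> s0.
have [m [M [m0 mM Hm]]] : exists m M, [/\ 0 < m, m <= M & forall k, (k < K)%N -> m <= s k /\ 2 * s k <= M].
  elim: K => [|K [m [M [m0 mM Hm]]]]; first by exists 1, 1; split.
  exists (Num.min m (s K)), (Num.max M (2 * s K)); split.
  - by rewrite lt_min m0 s0.
  - by rewrite (@le_trans _ _ m) ?ge_min ?lexx// (le_trans mM)// le_max lexx.
  move=> k; rewrite ltnS leq_eqVlt => /orP[/eqP ->|/Hm[h1 h2]].
    by rewrite ge_min le_max !lexx !orbT.
  by rewrite ge_min le_max h1 h2.
have sub : closure [set x | (packet K s a x)%:C != 0] `<=` `[m, M]%classic.
  have cl : closed `[m, M]%classic by exact: interval_closed.
  rewrite (proj1 (closure_id _) cl); apply: closureS => x /= px; rewrite in_itv /=.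
  have : packet K s a x != 0 by apply: contra px => /eqP ->.
  apply: contraNT => nI; rewrite /packet big1// => k _; apply: contraNeq nI => /(bump_supp (s0 k)).
  move=> /andP[h1 h2]; have [h3 h4] := Hm k (ltn_ord k); apply/andP; split; lra.
have bsm k : smooth (bump (s k) (a k)) by exact: smooth_flat.
split => /=.
- have h := @smooth_sum K (fun k => bump (s k) (a k)) bsm; exact: h.
- exact: smooth0.
- apply: (subclosed_compact _ (@segment_compact _ m M) sub); exact: closed_closure.
- by move=> x /sub /=; rewrite !in_itv /= andbT => /andP[h _]; exact: lt_le_trans h.
Qed.

End Bump.

(** * Integrals of step functions *)

Section StepIntegrals.
Variable R : realType.
Local Notation mu := (@lebesgue_measure R).
Implicit Types (f g : R -> R).

(** The integral of a nonnegative function is the supremum of the integrals of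
    the simple functions below it, and these are also below any larger
    function. *)
Lemma ge0_integral_mono (D : set R) (f g : R -> \bar R) :
  (forall x, D x -> (0 <= f x)%E) -> (forall x, D x -> (f x <= g x)%E) ->
  (\int[mu]_(x in D) f x <= \int[mu]_(x in D) g x)%E.
Proof.
move=> f0 fg; have g0 x : D x -> (0 <= g x)%E by move=> Dx; exact: le_trans (f0 x Dx) (fg x Dx).
rewrite !ge0_integralE//; apply: le_ereal_sup => /= _ [h hf <-]; exists h => //= x.
apply: le_trans (hf x) _; rewrite /patch; case: ifPn => // /[!inE]; exact: fg.
Qed.

Definition step (K : nat) (a l r : nat -> R) (x : R) : R :=
  \sum_(k < K) a k * \1_(`]l k, r k]%classic) x.

Lemma step_ge0 K (a l r : nat -> R) x : (forall k, 0 <= a k) -> 0 <= step K a l r x.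
Proof. by move=> a0; apply: sumr_ge0 => k _; rewrite mulr_ge0// indicE. Qed.

Lemma integral_step (K : nat) (a l r : nat -> R) : (forall k, 0 <= a k) ->
  (forall k, 0 <= l k) -> (forall k, l k <= r k) ->
  (\int[mu]_(x in `]0%R, +oo[) (step K a l r x)%:E)%E = (\sum_(k < K) a k * (r k - l k))%:E.
Proof.
move=> a0 l0 lr; rewrite /step; under eq_integral do rewrite -sumEFin.
rewrite ge0_integral_sum//=; last 2 first.
- move=> k; apply/measurable_EFinP; apply: measurable_funM => //.
- by move=> k x _; rewrite lee_fin mulr_ge0// indicE.
rewrite -sumEFin; apply: eq_bigr => k _.
under eq_integral do rewrite EFinM.
rewrite ge0_integralZl_EFin//; last by apply/measurable_EFinP; apply: measurable_indic.
rewrite integral_indic// (_ : _ `&` _ = `]l k, r k]%classic); last first.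
  apply/seteqP; split => x /=; first by case.
  move=> xI; split => //; move: xI; rewrite !in_itv /= andbT => /andP[h _].
  exact: le_lt_trans h.
rewrite [X in (_ * X)%E](@lebesgue_measure_itv R `]l k, r k]) /= lte_fin; have := lr k.
rewrite le_eqVlt => /orP[/eqP ->|->]; last by rewrite -EFinB -EFinM.
rewrite ltxx.
by rewrite subrr mulr0 mule0.
Qed.

Lemma integral_step_lower K (a l r : nat -> R) (f : R -> R) : (forall k, 0 <= a k) ->
  (forall k, 0 <= l k) -> (forall k, l k <= r k) ->
  (forall x, 0 < x -> step K a l r x <= f x) ->
  ((\sum_(k < K) a k * (r k - l k))%:E <= \int[mu]_(x in `]0%R, +oo[) (f x)%:E)%E.
Proof.
move=> a0 l0 lr H; rewrite -integral_step//; apply: ge0_integral_mono => x /=.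
  by rewrite lee_fin step_ge0.
by rewrite in_itv /= andbT lee_fin; exact: H.
Qed.

Lemma integral_step_upper K (a l r : nat -> R) (f : R -> R) : (forall k, 0 <= a k) ->
  (forall k, 0 <= l k) -> (forall k, l k <= r k) ->
  (forall x, 0 < x -> 0 <= f x <= step K a l r x) ->
  (0 <= \int[mu]_(x in `]0%R, +oo[) (f x)%:E <= (\sum_(k < K) a k * (r k - l k))%:E)%E.
Proof.
move=> a0 l0 lr H; apply/andP; split.
  by apply: integral_ge0 => x /=; rewrite in_itv /= andbT lee_fin => /H /andP[].
rewrite -integral_step//; apply: ge0_integral_mono => x /=; rewrite in_itv /= andbT lee_fin.
  by move=> /H /andP[].
by move=> /H /andP[].
Qed.

Lemma step_le_disjoint K (a l r : nat -> R) x (y : R) : 0 <= y ->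
  (forall j k, l j < x <= r j -> l k < x <= r k -> j = k) ->
  (forall k, (k < K)%N -> l k < x <= r k -> a k <= y) ->
  step K a l r x <= y.
Proof.
move=> y0 disj H; rewrite /step.
have [[k xk]|no] := pselect (exists k : 'I_K, l k < x <= r k).
  rewrite (bigD1 k)//= big1 => [|j jk].
    rewrite addr0 indicE mem_set; last by rewrite /= in_itv.
    by rewrite mulr1; exact: H.
  rewrite indicE memNset ?mulr0//= in_itv /= => xj.
  by move/eqP: jk; apply; apply: val_inj; exact: disj.
rewrite big1// => j _; rewrite indicE memNset ?mulr0//= in_itv /= => xj.
by apply: no; exists j.
Qed.

Lemma packet_disjoint K (s a : nat -> R) x : (forall k, 0 < s k) ->
  (forall j k, (j < K)%N -> (k < K)%N -> s j < x < 2 * s j -> s k < x < 2 * s k -> j = k) ->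
  packet K s a x = 0 \/ exists k : 'I_K, s k < x < 2 * s k /\ packet K s a x = bump (s k) (a k) x.
Proof.
move=> s0 disj; rewrite /packet.
have [[k xk]|no] := pselect (exists k : 'I_K, s k < x < 2 * s k).
  right; exists k; split => //; rewrite (bigD1 k)//= big1 ?addr0// => j jk.
  apply: contraNeq jk => /(bump_supp (s0 j)) xj.
  by apply/eqP/val_inj; apply: disj (ltn_ord _) (ltn_ord _) _ _.
left; apply: big1 => j _; apply/eqP/contraT => /(bump_supp (s0 j)) xj.
by exfalso; apply: no; exists j.
Qed.

Lemma indic_le (A : set R) x (c y : R) : 0 <= y -> (A x -> c <= y) -> c * \1_A x <= y.
Proof.
move=> y0 H; rewrite indicE; case: (boolP (x \in A)) => [/[!inE] /H|_]; first by rewrite mulr1.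
by rewrite mulr0.
Qed.

End StepIntegrals.

(** * The inequality for sums of bumps *)

Section TestInequality.
Variables (R : realType) (alpha beta zeta p q kappa sigma : R).
Hypothesis hab : beta <= alpha.
Hypothesis hb : - (1 / 2) <= beta.
Hypothesis ha : - (1 / 2) < alpha.
Hypothesis hp : 1 < p.
Hypothesis hq : 1 < q.
Local Open Scope complex_scope.
Local Notation mu := (@lebesgue_measure R).

Variables (K : nat) (s a omega Omega nu N : nat -> R).
Hypothesis s0 : forall k, 0 < s k.
Hypothesis a0 : forall k, 0 < a k.
Hypothesis omega0 : forall k, 0 < omega k.
Hypothesis nu0 : forall k, 0 < nu k.
Hypothesis omega_le : forall k x, s k < x < 2 * s k ->
  omega k <= (x ^+ 2 + zeta ^+ 2) `^ (- (kappa / 2)) <= Omega k.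
Hypothesis nu_le : forall k x, s k < x < 2 * s k ->
  nu k <= n_weight alpha beta x <= N k.

Local Notation F := (fun x => (packet K s a x)%:C).

Let mid k : s k < 3 / 2 * s k < 2 * s k.
Proof. by have := s0 k; move=> h; apply/andP; split; lra. Qed.

Let Omega0 k : 0 < Omega k.
Proof. by have /andP[h1 h2] := omega_le (mid k); exact: lt_le_trans (omega0 k) (le_trans h1 h2). Qed.

Let N0 k : 0 < N k.
Proof. by have /andP[h1 h2] := nu_le (mid k); exact: lt_le_trans (nu0 k) (le_trans h1 h2). Qed.

(** On the supports of the bumps the quotient phi_lambda(t) / phi_0(t) is at least
    1 / 2. The integrand is then nonnegative, and on the middle half of each
    ]s_k, 2 s_k[ it is bounded below by a constant. *)
Lemma jacobi_op_lower t : 0 < t -> (forall k, t * (2 * s k) <= 1 / 2) ->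
  t `^ (- sigma) * \sum_(k < K) a k * omega k * nu k * s k * (expR (- 4) / 4) <=
  cabs (jacobi_op alpha beta zeta kappa sigma F t).
Proof.
move=> t0 ts; pose w x := (x ^+ 2 + zeta ^+ 2) `^ (- (kappa / 2)).
pose g x := w x * packet K s a x * jacobi_mod alpha beta x t * n_weight alpha beta x.
have phi k x : s k < x < 2 * s k -> 1 / 2 <= jacobi_mod alpha beta x t <= 2.
  move=> /andP[x1 x2]; have x0 : 0 < x by exact: lt_trans (s0 k) x1.
  apply: jacobi_mod_bound => //; rewrite ger0_norm ?mulr_ge0 ?(ltW x0) ?(ltW t0)//.
  by apply: le_trans (ts k); rewrite mulrC ler_pM2l// ltW.
have gE x : g x = \sum_(k < K) w x * bump (s k) (a k) x * jacobi_mod alpha beta x t * n_weight alpha beta x.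
  by rewrite /g /packet mulr_sumr !mulr_suml.
have lo k x : 0 <= w x * bump (s k) (a k) x * jacobi_mod alpha beta x t * n_weight alpha beta x <=
    (a k * Omega k * 2 * N k) * \1_(`]s k, 2 * s k]%classic) x.
  have [b0|/(bump_supp (s0 k)) xk] := eqVneq (bump (s k) (a k) x) 0.
    rewrite b0 mulr0 !mul0r lexx /= indicE mulr_ge0// !mulr_ge0// ltW//.
  have /andP[w1 w2] := omega_le xk; have /andP[n1 n2] := nu_le xk; have /andP[p1 p2] := phi k x xk.
  have w0 : 0 <= w x by exact: le_trans (ltW (omega0 k)) w1.
  have n0 : 0 <= n_weight alpha beta x by exact: le_trans (ltW (nu0 k)) n1.
  have b0 := bump_ge0 (s k) x (ltW (a0 k)); have b1 := bump_le (s k) x (ltW (a0 k)).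
  have p0 : 0 <= jacobi_mod alpha beta x t by lra.
  apply/andP; split; first exact: mulr_ge0 (mulr_ge0 (mulr_ge0 w0 b0) p0) n0.
  rewrite indicE mem_set; last first.
    by rewrite /= in_itv /=; case/andP: xk => -> /ltW ->.
  rewrite mulr1 (mulrC (a k)); apply: ler_pM => //.
    exact: mulr_ge0 (mulr_ge0 w0 b0) p0.
  by apply: ler_pM => //; [exact: mulr_ge0 | exact: ler_pM].
have g0 x : 0 <= g x by rewrite gE; apply: sumr_ge0 => k _; case/andP: (lo k x).
(* The upper bound makes the integral finite: its real part is then not the
   default value 0. *)
have up x : 0 < x -> 0 <= g x <= step K (fun k => a k * Omega k * 2 * N k) s (fun k => 2 * s k) x.
  move=> _; rewrite g0 gE; apply: ler_sum => k _; by case/andP: (lo k x).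
have low x : 0 < x -> step K (fun k => a k * omega k * nu k * (expR (- 4) / 2))
    (fun k => 5 / 4 * s k) (fun k => 7 / 4 * s k) x <= g x.
  move=> _; rewrite gE; apply: ler_sum => k _; apply: indic_le.
    by case/andP: (lo k x).
  rewrite /= in_itv /= => xI; have xk : s k < x < 2 * s k.
    by case/andP: xI => h1 h2; have := s0 k; move=> h; apply/andP; split; lra.
  have /andP[w1 w2] := omega_le xk; have /andP[n1 n2] := nu_le xk; have /andP[p1 p2] := phi k x xk.
  have b1 := bump_lower (s0 k) (ltW (a0 k)) xI.
  have -> : a k * omega k * nu k * (expR (- 4) / 2) = omega k * (a k * expR (- 4)) * (1 / 2) * nu k by ring.
  have ae : 0 <= a k * expR (- 4) by rewrite mulr_ge0 ?expR_ge0// ltW.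
  apply: ler_pM => //; rewrite ?(ltW (nu0 k))//; first by rewrite !mulr_ge0// ltW.
  apply: ler_pM => //; first by rewrite mulr_ge0// ltW.
  by apply: ler_pM => //; rewrite ltW.
have aON k : 0 <= a k * Omega k * 2 * N k by rewrite !mulr_ge0// ltW.
have s0' k : 0 <= s k by exact: ltW.
have ss k : s k <= 2 * s k by have := s0 k; lra.
have /andP[i0 i1] := integral_step_upper aON s0' ss up.
have ann k : 0 <= a k * omega k * nu k * (expR (- 4) / 2).
  by rewrite !mulr_ge0// ?expR_ge0// ltW.
have i2 := @integral_step_lower R K _ (fun k => 5 / 4 * s k) (fun k => 7 / 4 * s k) g ann
   (fun k => ltac:(have := s0 k; lra)) (fun k => ltac:(have := s0 k; lra)) low.
have Re : complex.Re (jacobi_op alpha beta zeta kappa sigma F t) =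
   t `^ (- sigma) * fine (\int[mu]_(x in `]0%R, +oo[) (g x)%:E)%E.
  have ReZ (u : R) (z : R[i]) : complex.Re (u%:C * z) = u * complex.Re z.
    by case: z => z1 z2 /=; rewrite mul0r subr0.
  rewrite /jacobi_op ReZ; congr (_ * fine _); apply: eq_integral => x _ /=.
  by rewrite /g /w !(mulr0, mul0r, addr0, subr0).
apply: le_trans (Re_le_cabs _); apply: le_trans (ler_norm _); rewrite Re.
rewrite ler_wpM2l ?powR_ge0// -lee_fin fineK; last first.
  by apply: fin_real; rewrite (lt_le_trans _ i0) ?ltNyr// (le_lt_trans i1) ?ltry.
apply: le_trans i2; rewrite lee_fin; apply: ler_sum => k _.
by rewrite le_eqVlt; apply/orP; left; apply/eqP; field.
Qed.

Hypothesis disj : forall j k x, (j < K)%N -> (k < K)%N -> s j < x < 2 * s j -> s k < x < 2 * s k -> j = k.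

Lemma packet_norm_upper :
  (\int[mu]_(x in `]0%R, +oo[) (cabs (F x) `^ p * n_weight alpha beta x)%:E <=
   (\sum_(k < K) a k `^ p * N k * s k)%:E)%E.
Proof.
have p0 : 0 <= p by rewrite ltW// (lt_trans _ hp).
have aN k : 0 <= a k `^ p * N k by rewrite mulr_ge0 ?powR_ge0// ltW.
have s0' k : 0 <= s k by exact: ltW.
have ss k : s k <= 2 * s k by have := s0 k; lra.
have := @integral_step_upper R K _ s (fun k => 2 * s k)
   (fun x => cabs (F x) `^ p * n_weight alpha beta x) aN s0' ss.
have -> : \sum_(k < K) a k `^ p * N k * (2 * s k - s k) = \sum_(k < K) a k `^ p * N k * s k.
  by apply: eq_bigr => k _; congr (_ * _); ring.
suff H x : 0 < x -> 0 <= cabs (F x) `^ p * n_weight alpha beta x <= step K (fun k => a k `^ p * N k) s (fun k => 2 * s k) x.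
  by move=> /(_ H) /andP[].
move=> x0; rewrite cabsR; have [->|[k [xk ->]]] := @packet_disjoint _ K s a x s0 (fun j k => @disj j k x).
  have pp : 0 < p := lt_trans ltr01 hp.
  by rewrite normr0 powR0 ?gt_eqF// mul0r lexx step_ge0.
have /andP[n1 n2] := nu_le xk; have n0 : 0 <= n_weight alpha beta x by exact: le_trans (ltW (nu0 k)) n1.
rewrite mulr_ge0 ?powR_ge0//=.
apply: (@le_trans _ _ ((a k `^ p * N k) * \1_(`]s k, 2 * s k]%classic) x)).
  rewrite indicE mem_set; last by rewrite /= in_itv /=; case/andP: xk => -> /ltW ->.
  rewrite mulr1; apply: ler_pM => //.
  have a0' := ltW (a0 k); apply: ge0_ler_powR => //; rewrite ?nnegrE//.
  by rewrite ger0_norm ?bump_ge0 ?bump_le.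
rewrite /step (bigD1 k)//= lerDl; apply: sumr_ge0 => j _.
by rewrite mulr_ge0// indicE.
Qed.

Variable C : R.
Hypothesis hbound : forall G : R -> R[i], test_function G ->
     ((\int[lebesgue_measure]_(t in `]0%R, +oo[)
          (cabs (jacobi_op alpha beta zeta kappa sigma G t) `^ q
           * m_weight_mod alpha beta t)%:E) `^ (1 / q)
      <= C%:E *
         (\int[lebesgue_measure]_(lambda in `]0%R, +oo[)
             (cabs (G lambda) `^ p * n_weight alpha beta lambda)%:E)
           `^ (1 / p))%E.

Lemma test_inequality (I : nat) (c l r : nat -> R) : (forall i, 0 <= c i) ->
  (forall i, 0 <= l i) -> (forall i, l i <= r i) ->
  (forall t, 0 < t -> step I c l r t <=
     cabs (jacobi_op alpha beta zeta kappa sigma F t) `^ q * m_weight_mod alpha beta t) ->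
  (\sum_(i < I) c i * (r i - l i)) `^ (1 / q) <=
  `|C| * (\sum_(k < K) a k `^ p * N k * s k) `^ (1 / p).
Proof.
move=> c0 l0 lr H; have L := integral_step_lower c0 l0 lr H.
have U := packet_norm_upper; have := hbound (test_function_packet K a s0).
have sum0 : 0 <= \sum_(i < I) c i * (r i - l i).
  by apply: sumr_ge0 => i _; rewrite mulr_ge0// subr_ge0.
have q0 : 0 <= 1 / q by rewrite divr_ge0// ltW// (lt_trans _ hq).
have p0 : 0 <= 1 / p by rewrite divr_ge0// ltW// (lt_trans _ hp).
have J0 : (0 <= \int[mu]_(x in `]0%R, +oo[) (cabs (F x) `^ p * n_weight alpha beta x)%:E)%E.
  apply: integral_ge0 => x /=; rewrite in_itv /= andbT => x0.
  by rewrite lee_fin mulr_ge0 ?powR_ge0// /n_weight mulr_ge0 ?powR_ge0// invr_ge0 sqr_ge0.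
move=> B; rewrite -lee_fin EFinM -!poweR_EFin.
apply: le_trans (_ : _ <= (\int[mu]_(t in `]0%R, +oo[)
    (cabs (jacobi_op alpha beta zeta kappa sigma F t) `^ q * m_weight_mod alpha beta t)%:E) `^ (1 / q))%E _.
  apply: gt0_ler_poweR => //; rewrite ?in_itv /= ?lee_fin ?leey ?andbT//.
  exact: le_trans L.
apply: le_trans B _; apply: (@le_trans _ _ (`|C|%:E * (\int[mu]_(x in `]0%R, +oo[)
   (cabs (F x) `^ p * n_weight alpha beta x)%:E) `^ (1 / p))%E).
  by apply: lee_wpmul2r; [exact: poweR_ge0 | rewrite lee_fin ler_norm].
apply: lee_wpmul2l; first by rewrite lee_fin.
by apply: gt0_ler_poweR => //; rewrite ?in_itv /= ?leey ?andbT// lee_fin sumr_ge0// => k _;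
  rewrite !mulr_ge0 ?powR_ge0// ltW.
Qed.

End TestInequality.

(** * Powers and dyadic scales *)

Section Powers.
Variable R : realType.
Implicit Types (s x y r e C : R).

Lemma powR_comparable Y s x r : 0 < s -> s <= x <= Y * s ->
  Y `^ (- `|r|) * s `^ r <= x `^ r <= Y `^ `|r| * s `^ r.
Proof.
move=> s0 /andP[sx xY]; have sn : s != 0 by rewrite gt_eqF.
pose y := x / s; have xE : x = y * s by rewrite /y divfK.
have y1 : 1 <= y by rewrite /y ler_pdivlMr// mul1r.
have yY : y <= Y by rewrite /y ler_pdivrMr.
have y0 : 0 < y by lra. 
have Y0 : 0 < Y by lra.
have yr : y `^ `|r| <= Y `^ `|r| by apply: ge0_ler_powR => //; rewrite nnegrE ltW.
rewrite xE powRM ?(ltW y0) ?(ltW s0)// !ler_pM2r ?powR_gt0//; apply/andP; split; last first.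
  by apply: le_trans yr; apply: ler_powR => //; exact: ler_norm.
apply: (@le_trans _ _ (y `^ (- `|r|))).
  by rewrite !powRN lef_pV2 ?posrE ?powR_gt0.
by apply: ler_powR => //; rewrite lerNl -normrN ler_norm.
Qed.

Lemma powRV x r : 0 <= x -> x^-1 `^ r = x `^ (- r).
Proof. by move=> x0; rewrite -powR_inv1// -powRrM mulN1r. Qed.

Lemma natural_power_bounded e C : (forall n : nat, n.+1%:R `^ e <= C) -> e <= 0.
Proof.
move=> H; rewrite leNgt; apply/negP => e0.
have C0 : 0 <= C by apply: le_trans (H 0%N); exact: powR_ge0.
pose u := (C + 1) `^ e^-1; have u0 : 0 <= u by exact: powR_ge0.
have uE : u `^ e = C + 1.
  by rewrite /u -powRrM mulVf ?gt_eqF// powRr1// addr_ge0.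
have un : u <= (Num.bound u).+1%:R.
  apply: le_trans (ltW (archi_boundP u0)) _; rewrite ler_nat; exact: leqnSn.
have := H (Num.bound u).
have : u `^ e <= (Num.bound u).+1%:R `^ e by apply: ge0_ler_powR => //; rewrite ?nnegrE ?(ltW e0).
rewrite uE; lra.
Qed.

Lemma large_power_bounded e C : (forall s, 1 <= s -> s `^ e <= C) -> e <= 0.
Proof.
by move=> H; apply: (@natural_power_bounded _ C) => n; apply: H; rewrite ler1n.
Qed.

Lemma small_power_bounded e C : (forall s, 0 < s <= 1 / 8 -> s `^ e <= C) -> 0 <= e.
Proof.
move=> H; rewrite -oppr_le0; apply: (@natural_power_bounded _ (C * 8 `^ e)) => n.
have n0 : 0 < n.+1%:R :> R by rewrite ltr0n.
have n1 : 1 <= n.+1%:R :> R by rewrite ler1n.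
have := H (8 * n.+1%:R)^-1; rewrite invr_gt0 pmulr_rgt0// n0 /=.
have -> : (8 * n.+1%:R)^-1 <= 1 / 8 :> R.
  by rewrite div1r lef_pV2 ?posrE ?pmulr_rgt0//; lra.
move=> /(_ isT); rewrite invfM powRM ?invr_ge0 ?(ltW n0)//.
rewrite !powRV ?(ltW n0)// (powRN 8) -ler_pdivlMl ?invr_gt0 ?powR_gt0// invrK.
by rewrite mulrC.
Qed.

Lemma half_power_disjoint (j k : nat) x :
  2^-1 ^+ j < x <= 2 * 2^-1 ^+ j -> 2^-1 ^+ k < x <= 2 * 2^-1 ^+ k -> j = k.
Proof.
have H (m n : nat) : (m < n)%N -> 2^-1 ^+ m < x -> x <= 2 * 2^-1 ^+ n -> False.
  move=> mn h1 h2; have : 2 * 2^-1 ^+ n <= 2^-1 ^+ m :> R.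
    rewrite -(subnKC mn) exprD exprS !mulrA divff ?mul1r; last by lra.
    rewrite ler_piMr ?exprn_ge0//.
    by apply: exprn_ile1; lra.
  by move=> h3; have := lt_le_trans h1 (le_trans h2 h3); rewrite ltxx.
move=> /andP[j1 j2] /andP[k1 k2].
by case: (ltngtP j k) => // h; exfalso; [exact: H h j1 k2 | exact: H h k1 j2].
Qed.

End Powers.

(** * The frequency weights on dyadic intervals *)

Section DyadicWeights.
Variables (R : realType) (alpha beta zeta kappa : R).
Hypothesis hab : beta <= alpha.
Hypothesis hb : - (1 / 2) <= beta.
Hypothesis ha : - (1 / 2) < alpha.

Lemma n_weight_dyadic_small : exists n N : R, [/\ 0 < n, 0 < N & forall s, 0 < s <= 1 ->
  forall x, s < x < 2 * s -> n * s ^+ 2 <= n_weight alpha beta x <= N * s ^+ 2].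
Proof.
have [k [K [k0 K0 H]]] := n_weight_bounds hab hb ha.
pose P : R := 2 `^ (alpha + 1 / 2).
have P0 : 0 < P by exact: powR_gt0.
exists (k / 8), (K * P); split; [by lra|exact: mulr_gt0|].
move=> s /andP[s0 s1] x /andP[x1 x2]; have x0 : 0 < x by lra.
have := H x x0; rewrite /density_model.
set y := (x / 2) ^+ 2.
have y1 : s ^+ 2 / 4 <= y.
  have -> : s ^+ 2 / 4 = (s / 2) ^+ 2 by field.
  by rewrite ler_sqr ?nnegrE; lra.
have y2 : y <= s ^+ 2 by rewrite ler_sqr ?nnegrE; lra.
have ss : 0 < s ^+ 2 <= 1 by rewrite exprn_gt0//= exprn_ile1// ltW.
move/andP: ss => [ss0 ss1]; have y0 : 0 < y by lra.
have e0 : 0 <= alpha + 1 / 2 by move: ha; lra.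
have p1 : 1 <= (1 + y) `^ (alpha + 1 / 2).
  apply: (@le_trans _ _ (1 `^ (alpha + 1 / 2))); first by rewrite powR1.
  by apply: ge0_ler_powR => //; rewrite ?nnegrE; lra.
have p2 : (1 + y) `^ (alpha + 1 / 2) <= P.
  by apply: ge0_ler_powR => //; rewrite ?nnegrE; lra.
have q1 : y / 2 <= y / (1 + y) by rewrite ler_pM2l// lef_pV2 ?posrE; lra.
have q2 : y / (1 + y) <= y by rewrite ler_pdivrMr ?ler_peMr; lra.
move=> /andP[h1 h2]; apply/andP; split.
  apply: le_trans h1; rewrite -mulrA ler_pM2l//.
  apply: (@le_trans _ _ (y / 2 * 1)); first lra.
  by apply: ler_pM => //; lra.
apply: le_trans h2 _; rewrite -(mulrA K) ler_pM2l// (mulrC P); apply: ler_pM => //; lra.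
Qed.

Lemma n_weight_dyadic_large : exists n N : R, [/\ 0 < n, 0 < N & forall s, 1 <= s ->
  forall x, s < x < 2 * s ->
    n * s `^ (2 * alpha + 1) <= n_weight alpha beta x <= N * s `^ (2 * alpha + 1)].
Proof.
have [k [K [k0 K0 H]]] := n_weight_bounds hab hb ha.
pose e := alpha + 1 / 2; have e0 : 0 <= e by rewrite /e; move: ha; lra.
have P0 (u : R) : 0 < u -> 0 < u `^ e by exact: powR_gt0.
exists (k * (5^-1 * 4^-1 `^ e)), (K * 2 `^ e); split.
- by rewrite mulr_gt0// mulr_gt0// P0.
- by rewrite mulr_gt0// P0.
move=> s s1 x /andP[x1 x2]; have x0 : 0 < x by lra.
have s0 : 0 < s by lra.
have := H x x0; rewrite /density_model -/e.
set y := (x / 2) ^+ 2.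
have y1 : s ^+ 2 / 4 <= y.
  have -> : s ^+ 2 / 4 = (s / 2) ^+ 2 by field.
  by rewrite ler_sqr ?nnegrE; lra.
have y2 : y <= s ^+ 2 by rewrite ler_sqr ?nnegrE; lra.
have ss : 1 <= s ^+ 2 by rewrite exprn_ege1.
have y0 : 0 < y by lra.
have sE : s `^ (2 * alpha + 1) = (s ^+ 2) `^ e.
  by rewrite -powR_mulrn ?(ltW s0)// -powRrM /e; congr (_ `^ _); field.
have p1 : 4^-1 `^ e * (s ^+ 2) `^ e <= (1 + y) `^ e.
  by rewrite -powRM; [|lra|lra]; apply: ge0_ler_powR => //; rewrite ?nnegrE; lra.
have p2 : (1 + y) `^ e <= 2 `^ e * (s ^+ 2) `^ e.
  by rewrite -powRM; [|lra|lra]; apply: ge0_ler_powR => //; rewrite ?nnegrE; lra.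
have q1 : 5^-1 <= y / (1 + y) by rewrite ler_pdivlMr; lra.
have q2 : y / (1 + y) <= 1 by rewrite ler_pdivrMr; lra.
rewrite sE => /andP[h1 h2]; apply/andP; split.
  apply: le_trans h1; rewrite -(mulrA k) ler_pM2l// -(mulrA 5^-1); apply: ler_pM => //.
  by rewrite mulr_ge0 ?powR_ge0.
apply: le_trans h2 _; rewrite -(mulrA K) ler_pM2l// -[leRHS]mul1r; apply: ler_pM => //; first lra.
exact: powR_ge0.
Qed.

(** The condition on [zeta] holds for zeta = 0, and for every zeta when s >= 1: in
    both cases x^2 + zeta^2 is of order s^2. *)
Lemma riesz_weight_homogeneous s x : 0 < s -> zeta ^+ 2 <= zeta ^+ 2 * s ^+ 2 ->
  s < x < 2 * s ->
  (4 + zeta ^+ 2) `^ (- `|- (kappa / 2)|) * s `^ (- kappa) <=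
  (x ^+ 2 + zeta ^+ 2) `^ (- (kappa / 2)) <=
  (4 + zeta ^+ 2) `^ `|- (kappa / 2)| * s `^ (- kappa).
Proof.
move=> s0 zs /andP[x1 x2].
have -> : s `^ (- kappa) = (s ^+ 2) `^ (- (kappa / 2)).
  by rewrite -powR_mulrn ?(ltW s0)// -powRrM; congr (_ `^ _); field.
have z0 := sqr_ge0 zeta.
have x2s : s ^+ 2 <= x ^+ 2 by rewrite ler_sqr ?nnegrE; lra.
have x2S : x ^+ 2 <= (2 * s) ^+ 2 by rewrite ler_sqr ?nnegrE; lra.
apply: powR_comparable; first exact: exprn_gt0.
rewrite exprMn in x2S; lra.
Qed.

Lemma riesz_weight_constant s x : zeta != 0 -> 0 < s <= 1 -> s < x < 2 * s ->
  (1 + 4 / zeta ^+ 2) `^ (- `|- (kappa / 2)|) * (zeta ^+ 2) `^ (- (kappa / 2)) <=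
  (x ^+ 2 + zeta ^+ 2) `^ (- (kappa / 2)) <=
  (1 + 4 / zeta ^+ 2) `^ `|- (kappa / 2)| * (zeta ^+ 2) `^ (- (kappa / 2)).
Proof.
move=> z0 /andP[s0 s1] /andP[x1 x2].
have zz : 0 < zeta ^+ 2 by rewrite exprn_even_gt0.
apply: powR_comparable => //; rewrite mulrDl mul1r divfK ?gt_eqF//.
have : x ^+ 2 <= 2 ^+ 2 by rewrite ler_sqr ?nnegrE; lra.
have := sqr_ge0 x; lra.
Qed.

End DyadicWeights.

(** * The necessary conditions *)

Section NecessaryConditions.
Variables (R : realType) (alpha beta zeta p q kappa sigma C : R).
Hypothesis hab : beta <= alpha.
Hypothesis hb : - (1 / 2) <= beta.
Hypothesis ha : - (1 / 2) < alpha.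
Hypothesis hp : 1 < p.
Hypothesis hq : 1 < q.
Hypothesis hbound : forall F : R -> R[i], test_function F ->
     ((\int[lebesgue_measure]_(t in `]0%R, +oo[)
          (cabs (jacobi_op alpha beta zeta kappa sigma F t) `^ q
           * m_weight_mod alpha beta t)%:E) `^ (1 / q)
      <= C%:E *
         (\int[lebesgue_measure]_(lambda in `]0%R, +oo[)
             (cabs (F lambda) `^ p * n_weight alpha beta lambda)%:E)
           `^ (1 / p))%E.

Let p0 : 0 < p := lt_trans ltr01 hp.
Let q0 : 0 < q := lt_trans ltr01 hq.
Let pn0 : p != 0 := lt0r_neq0 p0.
Let qn0 : q != 0 := lt0r_neq0 q0.

Let sum_ord_const (I : nat) (x : R) (f : 'I_I -> R) : (forall i, f i = x) ->
  \sum_(i < I) f i = I%:R * x.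
Proof. by move=> fx; rewrite (eq_bigr (fun=> x)) // sumr_const card_ord mulr_natl. Qed.

Section Packet.
Variables (K : nat) (s a omega Omega nu N : nat -> R) (T : R).
Hypothesis s0 : forall k, 0 < s k.
Hypothesis a0 : forall k, 0 < a k.
Hypothesis omega0 : forall k, 0 < omega k.
Hypothesis nu0 : forall k, 0 < nu k.
Hypothesis omega_le : forall k x, s k < x < 2 * s k ->
  omega k <= (x ^+ 2 + zeta ^+ 2) `^ (- (kappa / 2)) <= Omega k.
Hypothesis nu_le : forall k x, s k < x < 2 * s k ->
  nu k <= n_weight alpha beta x <= N k.
Hypothesis disj : forall j k x, (j < K)%N -> (k < K)%N ->
  s j < x < 2 * s j -> s k < x < 2 * s k -> j = k.
Hypothesis T0 : 0 < T.
Hypothesis Ts : forall k, T * (2 * s k) <= 1 / 2.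

Let b : R := \sum_(k < K) a k * omega k * nu k * s k * (expR (- 4) / 4).

Let b0 : 0 <= b.
Proof.
apply: sumr_ge0 => k _; have := expR_gt0 (- 4 : R) => e0.
by rewrite mulr_ge0 ?mulr_ge0 ?(ltW (s0 k)) ?(ltW (a0 k)) ?(ltW (nu0 k)) ?(ltW (omega0 k))//; lra.
Qed.

Lemma packet_test (I : nat) (c l r : nat -> R) : (forall i, 0 <= c i) ->
  (forall i, 0 <= l i) -> (forall i, l i <= r i) -> (forall i, r i <= T) ->
  (forall t, 0 < t <= T ->
     step I c l r t <= (t `^ (- sigma) * b) `^ q * m_weight_mod alpha beta t) ->
  (\sum_(i < I) c i * (r i - l i)) `^ (1 / q) <=
  `|C| * (\sum_(k < K) a k `^ p * N k * s k) `^ (1 / p).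
Proof.
move=> c0 l0 lr rT H.
apply: (test_inequality hp hq s0 a0 nu0 nu_le disj hbound c0 l0 lr) => t t0.
have m0 : 0 <= m_weight_mod alpha beta t by exact: m_weight_mod_ge0.
have [tT|Tt] := leP t T; last first.
  rewrite /step big1 => [|i _]; first exact: mulr_ge0 (powR_ge0 _ _) m0.
  rewrite indicE memNset ?mulr0//= in_itv /= => /andP[_ /(lt_le_trans Tt)].
  by rewrite ltNge rT.
apply: le_trans (H t _) _; first by rewrite t0.
apply: ler_wpM2r => //; apply: ge0_ler_powR; rewrite ?nnegrE ?(ltW q0)//.
- by rewrite mulr_ge0// powR_ge0.
- exact: cabs_ge0.
apply: (jacobi_op_lower _ hab hb ha K s0 a0 omega0 nu0 omega_le nu_le t0) => k.
by apply: le_trans (Ts k); rewrite ler_pM2r// mulr_gt0.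
Qed.

(** Test on the single shell T / 2 < t <= T, where t^(- sigma) is comparable with
    T^(- sigma). *)
Lemma packet_test_shell (M : R) : 0 <= M ->
  (forall t, T / 2 < t <= T -> M <= m_weight_mod alpha beta t) ->
  2 `^ (- `|sigma|) * T^-1 `^ sigma * b * (M * (T / 2)) `^ (1 / q) <=
  `|C| * (\sum_(k < K) a k `^ p * N k * s k) `^ (1 / p).
Proof.
move=> M0 HM; pose d := 2 `^ (- `|sigma|) * T^-1 `^ sigma * b.
have d0 : 0 <= d by rewrite mulr_ge0// mulr_ge0// powR_ge0.
have T20 : 0 <= T / 2 by have := T0; lra.
have := @packet_test 1 (fun=> d `^ q * M) (fun=> T / 2) (fun=> T).
have E : (d `^ q * M * (T - T / 2)) `^ (1 / q) = d * (M * (T / 2)) `^ (1 / q).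
  rewrite (_ : T - T / 2 = T / 2); last by field.
  rewrite -[_ * M * _]mulrA (powRM _ (powR_ge0 _ _) (mulr_ge0 M0 T20)) -powRrM.
  by rewrite div1r divff// powRr1.
rewrite big_ord1 E; apply => //.
- by move=> _; rewrite mulr_ge0 ?powR_ge0.
- by move=> _; have := T0; lra.
move=> t /andP[t0 tT]; rewrite /step big_ord1; apply: indic_le.
  by rewrite mulr_ge0 ?powR_ge0 ?m_weight_mod_ge0.
rewrite /= in_itv /= => tI; apply: ler_pM => //; first exact: powR_ge0; last exact: HM.
apply: ge0_ler_powR; rewrite ?nnegrE ?(ltW q0)//; first by rewrite mulr_ge0// powR_ge0.
apply: ler_wpM2r => //; rewrite -powRV ?(ltW t0)//.
have TV : 0 < T^-1 by rewrite invr_gt0.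
suff /(powR_comparable sigma TV)/andP[] : T^-1 <= t^-1 <= 2 * T^-1 by [].
case/andP: tI => t1 t2; rewrite lef_pV2 ?posrE// t2 /=.
by rewrite -[2]invrK -invfM lef_pV2 ?posrE ?mulr_gt0 ?invr_gt0//; lra.
Qed.

End Packet.

(** One bump at scale s, tested on the shell of t ~ 1 / s. The weights scale there
    as those of the Fourier transform of radial functions in dimension d. *)
Lemma scaling_inequality (d A w W n N M : R) : 0 < w -> 0 < n -> 0 < N -> 0 < M ->
  exists C' : R, forall s, 0 < s ->
  (forall x, s < x < 2 * s ->
     w * s `^ A <= (x ^+ 2 + zeta ^+ 2) `^ (- (kappa / 2)) <= W * s `^ A) ->
  (forall x, s < x < 2 * s ->
     n * s `^ (d - 1) <= n_weight alpha beta x <= N * s `^ (d - 1)) ->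
  (forall t, (8 * s)^-1 < t <= (4 * s)^-1 -> M * s `^ (1 - d) <= m_weight_mod alpha beta t) ->
  s `^ (sigma + A + d * (1 - 1 / p - 1 / q)) <= C'.
Proof.
move=> w0 n0 N0 M0.
pose D := 2 `^ (- `|sigma|) * 4 `^ sigma * (w * n * (expR (- 4) / 4)) * (M / 8) `^ (1 / q).
have D0 : 0 < D.
  have e4 : 0 < expR (- 4) / 4 :> R by rewrite divr_gt0// expR_gt0.
  have M8 : 0 < M / 8 by rewrite divr_gt0.
  rewrite /D; apply: mulr_gt0; last exact: powR_gt0.
  by apply: mulr_gt0; [rewrite mulr_gt0// powR_gt0 | rewrite mulr_gt0// mulr_gt0].
exists (`|C| * N `^ (1 / p) / D) => s s0 Hw Hn Hm.
have sn : s != 0 by rewrite gt_eqF.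
have sD x y : s `^ (x + y) = s `^ x * s `^ y by rewrite powRD// sn implybT.
have s1 : s = s `^ 1 by rewrite powRr1// ltW.
have sX x : 0 < s `^ x by exact: powR_gt0.
have T0 : 0 < (4 * s)^-1 by rewrite invr_gt0 mulr_gt0.
have T2 : (4 * s)^-1 / 2 = (8 * s)^-1 by field.
have := @packet_test_shell 1 (fun=> s) (fun=> 1) (fun=> w * s `^ A) (fun=> W * s `^ A)
  (fun=> n * s `^ (d - 1)) (fun=> N * s `^ (d - 1)) (4 * s)^-1 (fun=> s0) (fun=> ltr01)
  (fun=> mulr_gt0 w0 (sX _)) (fun=> mulr_gt0 n0 (sX _)) (fun _ => Hw) (fun _ => Hn)
  _ T0 _ (M * s `^ (1 - d)).
rewrite T2 !big_ord1 powR1 (mul1r (w * _)) (mul1r (N * _)).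
have H1 (j k : nat) (x : R) : (j < 1)%N -> (k < 1)%N -> s < x < 2 * s -> s < x < 2 * s -> j = k.
  by case: j k => [|?] [|?].
have H2 (k : nat) : (4 * s)^-1 * (2 * s) <= 1 / 2.
  by rewrite (_ : _ * _ = 1 / 2) ?lexx//; field.
have H3 : 0 <= M * s `^ (1 - d) by rewrite mulr_ge0 ?ltW.
move=> /(_ H1 H2 H3 Hm); rewrite invrK (powRM sigma (ler0n _ 4) (ltW s0)).
have -> : M * s `^ (1 - d) * (8 * s)^-1 = M / 8 * s `^ (- d).
  rewrite invfM mulrACA; congr (_ * _).
  by rewrite -powR_inv1 ?(ltW s0)// -sD; congr (_ `^ _); ring.
have -> : N * s `^ (d - 1) * s = N * s `^ d.
  by rewrite -mulrA [X in _ * (_ * X)]s1 -sD; congr (_ * _ `^ _); ring.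
rewrite (powRM _ (ltW N0) (ltW (sX _))) (powRM _ (divr_ge0 (ltW M0) (ler0n _ 8)) (ltW (sX _))).
rewrite -!powRrM.
have -> : 2 `^ (- `|sigma|) * (4 `^ sigma * s `^ sigma) *
    (w * s `^ A * (n * s `^ (d - 1)) * s * (expR (- 4) / 4)) *
    ((M / 8) `^ (1 / q) * s `^ (- d * (1 / q))) =
    D * (s `^ (sigma + A + d * (1 - 1 / p - 1 / q)) * s `^ (d * (1 / p))).
  rewrite -sD (_ : _ + d * (1 / p) = sigma + A + (d - 1) + 1 + - d * (1 / q)); last by ring.
  rewrite !sD -s1 /D; ring.
by rewrite mulrA (mulrA `|C|) ler_pM2r// mulrC -ler_pdivlMr.
Qed.

(** The dimension is 2 (alpha + 1), and s tends to infinity. *)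
Lemma high_frequency_necessary :
  sigma - kappa <= 2 * (alpha + 1) * (1 / p + 1 / q - 1).
Proof.
pose d := 2 * (alpha + 1); pose Y := 4 + zeta ^+ 2.
have Y0 : 0 < Y by rewrite /Y; have := sqr_ge0 zeta; lra.
have [n [N [n0 N0 Hn]]] := n_weight_dyadic_large hab hb ha.
have [k k0 Hk] := m_weight_mod_small hab hb ha.
have M0 : 0 < k * 8^-1 `^ (2 * alpha + 1) by rewrite mulr_gt0// powR_gt0.
have [C' HC] := @scaling_inequality d (- kappa) (Y `^ (- `|- (kappa / 2)|))
  (Y `^ `|- (kappa / 2)|) n N _ (powR_gt0 _ Y0) n0 N0 M0.
suff : sigma + - kappa + d * (1 - 1 / p - 1 / q) <= 0 by rewrite /d; lra.
apply: (large_power_bounded (C := C')) => s s1; have s0 : 0 < s := lt_le_trans ltr01 s1.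
have dE : d - 1 = 2 * alpha + 1 by rewrite /d; ring.
apply: HC => //.
- move=> x; apply: riesz_weight_homogeneous => //.
  by rewrite ler_peMr ?sqr_ge0// exprn_ege1.
- by rewrite dE; exact: Hn.
move=> t /andP[t1 t2].
have r0 : 0 < (8 * s)^-1 by rewrite invr_gt0 mulr_gt0.
have t0 := lt_trans r0 t1.
have t_le1 : t <= 1.
  by apply: le_trans t2 _; rewrite invf_ple ?posrE ?mulr_gt0// invr1; lra.
apply: le_trans (Hk t _); last by rewrite t0.
rewrite -mulrA ler_pM2l// -opprB dE -powRV ?(ltW s0)// -powRM ?invr_ge0 ?(ltW s0)//.
rewrite -invfM; apply: ge0_ler_powR; rewrite ?nnegrE ?(ltW t0) ?(ltW r0) ?(ltW t1)//.
by have := ha; lra.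
Qed.

(** The dimension is 3, and s tends to 0; [A] is - kappa for zeta = 0, and 0
    otherwise. *)
Lemma low_frequency_necessary (A w W : R) : 0 < w ->
  (forall s, 0 < s <= 1 -> forall x, s < x < 2 * s ->
     w * s `^ A <= (x ^+ 2 + zeta ^+ 2) `^ (- (kappa / 2)) <= W * s `^ A) ->
  3 * (1 / p + 1 / q - 1) <= sigma + A.
Proof.
move=> w0 Hw.
have [n [N [n0 N0 Hn]]] := n_weight_dyadic_small hab hb ha.
have [k k0 Hk] := m_weight_mod_large hab hb ha.
have M0 : 0 < k / 64 by rewrite divr_gt0.
have [C' HC] := @scaling_inequality 3 A w W n N _ w0 n0 N0 M0.
suff : 0 <= sigma + A + 3 * (1 - 1 / p - 1 / q) by lra.
apply: (small_power_bounded (C := C')) => s /andP[s0 s8].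
have s2 : s `^ (3 - 1) = s ^+ 2.
  by rewrite -powR_mulrn ?(ltW s0)//; congr (_ `^ _); ring.
have s01 : 0 < s <= 1 by rewrite s0 /=; lra.
apply: HC => //; [exact: Hw | by rewrite s2; exact: Hn |].
move=> t /andP[t1 t2].
have r1 : 1 <= (8 * s)^-1 by rewrite invf_pge ?posrE ?mulr_gt0// invr1; lra.
apply: le_trans (Hk t _); last by lra.
rewrite -opprB powRN s2 -mulrA ler_pM2l//.
have -> : 64^-1 / s ^+ 2 = ((8 * s)^-1) ^+ 2 by field; rewrite gt_eqF.
by rewrite ler_sqr ?nnegrE; lra.
Qed.

(** For a fixed bump the left-hand side is at least a multiple of the integral of
    t^(2 alpha + 1 - sigma q) over ]0, 1 / 4]. If sigma q >= 2 (alpha + 1), every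
    dyadic interval contributes at least a fixed amount to it. *)
Lemma origin_necessary : sigma * q < 2 * (alpha + 1).
Proof.
rewrite ltNge; apply/negP => sq.
have Y0 : 0 < 4 + zeta ^+ 2 by have := sqr_ge0 zeta; lra.
have [n [N [n0 N0 Hn]]] := n_weight_dyadic_small hab hb ha.
have [k k0 Hk] := m_weight_mod_small hab hb ha.
pose w : R := (4 + zeta ^+ 2) `^ (- `|- (kappa / 2)|) * 1 `^ (- kappa).
have w0 : 0 < w by rewrite mulr_gt0// powR_gt0.
pose b := w * n * (expR (- 4) / 4).
have e4 : 0 < expR (- 4) / 4 :> R by rewrite divr_gt0// expR_gt0.
have b0 : 0 < b by rewrite mulr_gt0// mulr_gt0.
(* On the i-th interval ]l i, 2 l i] the integrand is at least e / t, hence at least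
   e / (2 l i), so that the interval contributes e / 2. *)
pose e := b `^ q * k; have e0 : 0 < e by rewrite mulr_gt0// powR_gt0.
pose l (i : nat) : R := 2^-1 ^+ i.+3.
have l0 i : 0 < l i by rewrite exprn_gt0.
have l8 i : 2 * l i <= 1 / 4.
  have h : 2^-1 ^+ i <= 1 :> R by apply: exprn_ile1; lra.
  by rewrite /l -addn3 exprD (_ : 2^-1 ^+ 3 = 8^-1 :> R); [lra | field].
have Hw (j : nat) x : 1 < x < 2 * 1 ->
    w <= (x ^+ 2 + zeta ^+ 2) `^ (- (kappa / 2)) <=
    (4 + zeta ^+ 2) `^ `|- (kappa / 2)| * 1 `^ (- kappa).
  by move=> xI; apply: riesz_weight_homogeneous => //; rewrite expr1n mulr1.
have Hn1 (j : nat) x : 1 < x < 2 * 1 -> n <= n_weight alpha beta x <= N.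
  by move=> xI; have := Hn 1 _ x xI; rewrite ltr01 lexx expr1n !mulr1; apply.
have H1 (i j : nat) (x : R) : (i < 1)%N -> (j < 1)%N -> 1 < x < 2 * 1 -> 1 < x < 2 * 1 -> i = j.
  by case: i j => [|?] [|?].
have test I : (I%:R * (e / 2)) `^ (1 / q) <= `|C| * N `^ (1 / p).
  have := @packet_test 1 (fun=> 1) (fun=> 1) (fun=> w) _ (fun=> n) (fun=> N) (1 / 4)
    (fun=> ltr01) (fun=> ltr01) (fun=> w0) (fun=> n0) Hw Hn1 H1 _ I
    (fun i => e / (2 * l i)) l (fun i => 2 * l i).
  rewrite !big_ord1 powR1 (mul1r w) (mul1r N) !mulr1 -/b.
  have -> : \sum_(i < I) e / (2 * l i) * (2 * l i - l i) = I%:R * (e / 2).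
    apply: sum_ord_const => i.
    by field; rewrite gt_eqF.
  apply => //; [by move=> _; lra | | | |].
  - by move=> i; rewrite ltW// divr_gt0// mulr_gt0.
  - by move=> i; exact: ltW.
  - by move=> i; have := l0 i; lra.
  move=> t /andP[t0 t4]; apply: step_le_disjoint.
  - by rewrite mulr_ge0 ?powR_ge0 ?m_weight_mod_ge0.
  - by move=> i j hi hj; have := half_power_disjoint hi hj => -[].
  move=> i _ /andP[lt tl].
  apply: (@le_trans _ _ ((t `^ (- sigma) * b) `^ q * (k * t `^ (2 * alpha + 1)))); last first.
    by rewrite ler_wpM2l ?powR_ge0//; apply: Hk; rewrite t0 /=; lra.
  rewrite powRM ?powR_ge0 ?(ltW b0)// -powRrM.
  rewrite [leRHS](_ : _ = e * (t `^ (- sigma * q) * t `^ (2 * alpha + 1))); last by rewrite /e; ring.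
  rewrite ler_pM2l// -powRD; last by rewrite (gt_eqF t0) implybT.
  apply: (@le_trans _ _ t^-1); first by rewrite lef_pV2 ?posrE//; exact: mulr_gt0.
  rewrite -[- sigma * q + _]opprK -powRV ?(ltW t0)//.
  have t1 : 1 <= t^-1 by rewrite invf_pge ?posrE// invr1; lra.
  by rewrite -[leLHS]powRr1 ?(le_trans ler01)//; apply: ler_powR => //; move: sq; lra.
have : 1 / q <= 0.
  apply: (@natural_power_bounded _ _ (`|C| * N `^ (1 / p) / (e / 2) `^ (1 / q))) => i.
  have e2 : 0 < e / 2 by rewrite divr_gt0.
  by rewrite ler_pdivlMr ?powR_gt0// -(powRM _ (ler0n _ _) (ltW e2)); exact: test.
by rewrite leNgt divr_gt0.
Qed.

(** Suppose kappa >= 3 (1 - 1 / p). The sum of the bumps of amplitude s_k^(- 3 / p)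
    at the scales s_k = 2^(- k - 1), k < K, has norm of order K^(1 / p) at most. At
    t ~ 1 every bump contributes at least a fixed amount to the operator, whose
    value is thus at least of order K. This is impossible for large K, as p > 1. *)
Lemma logarithmic_necessary : zeta = 0 -> kappa < 3 * (1 - 1 / p).
Proof.
move=> z0; rewrite ltNge; apply/negP => kg.
have [n [N [n0 N0 Hn]]] := n_weight_dyadic_small hab hb ha.
have [m m0 Hm] := m_weight_mod_small hab hb ha.
pose g := 3 * (1 - 1 / p); pose s (k : nat) : R := 2^-1 ^+ k.+1.
pose w : R := (4 + zeta ^+ 2) `^ (- `|- (kappa / 2)|).
pose W : R := (4 + zeta ^+ 2) `^ `|- (kappa / 2)|.
have w0 : 0 < w by rewrite powR_gt0 ?z0 ?expr0n/=; lra.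
have s0 k : 0 < s k by rewrite exprn_gt0.
have s2 k : s k <= 1 / 2.
  by rewrite /s exprS div1r ler_piMr//; apply: exprn_ile1; lra.
have sn k : s k != 0 by rewrite gt_eqF.
have sX k x : 0 < s k `^ x by exact: powR_gt0.
have Hw k x : s k < x < 2 * s k -> w * s k `^ (- g) <=
    (x ^+ 2 + zeta ^+ 2) `^ (- (kappa / 2)) <= W * s k `^ (- kappa).
  move=> xI; have zs : zeta ^+ 2 <= zeta ^+ 2 * s k ^+ 2 by rewrite z0 expr0n mul0r.
  have /andP[h1 ->] := riesz_weight_homogeneous kappa (s0 k) zs xI; rewrite andbT.
  apply: le_trans h1; rewrite ler_pM2l// -!powRV ?(ltW (s0 k))//.
  by apply: ler_powR => //; rewrite invf_pge ?posrE// invr1; have := s2 k; lra.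
have Hn1 k x : s k < x < 2 * s k -> n * s k ^+ 2 <= n_weight alpha beta x <= N * s k ^+ 2.
  by apply: Hn; rewrite s0 /=; have := s2 k; lra.
have H1 (K j k : nat) x : (j < K)%N -> (k < K)%N -> s j < x < 2 * s j -> s k < x < 2 * s k -> j = k.
  move=> _ _ /andP[j1 j2] /andP[k1 k2].
  have := @half_power_disjoint _ j.+1 k.+1 x; rewrite -/(s j) -/(s k) j1 k1 !ltW//.
  by move=> /(_ isT isT) [].
pose M : R := m * (1 / 8) `^ (2 * alpha + 1).
have M0 : 0 < M by rewrite mulr_gt0// powR_gt0.
pose D := 2 `^ (- `|sigma|) * (1 / 4)^-1 `^ sigma * (w * n * (expR (- 4) / 4)) *
  (M * (1 / 4 / 2)) `^ (1 / q).
have D0 : 0 < D.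
  have e4 : 0 < expR (- 4) / 4 :> R by rewrite divr_gt0// expR_gt0.
  have T4 : 0 < (1 / 4)^-1 :> R by rewrite invr_gt0; lra.
  have M8 : 0 < M * (1 / 4 / 2) by rewrite mulr_gt0//; lra.
  rewrite /D; apply: mulr_gt0; last exact: powR_gt0.
  by apply: mulr_gt0; [rewrite mulr_gt0// powR_gt0 | rewrite mulr_gt0// mulr_gt0].
have test K : K%:R * D <= `|C| * (K%:R * N) `^ (1 / p).
  have := @packet_test_shell K s (fun k => s k `^ (- (3 / p))) (fun k => w * s k `^ (- g))
    (fun k => W * s k `^ (- kappa)) (fun k => n * s k ^+ 2) (fun k => N * s k ^+ 2) (1 / 4)
    s0 (fun k => sX k _) (fun k => mulr_gt0 w0 (sX k _)) (fun k => mulr_gt0 n0 (exprn_gt0 _ (s0 k)))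
    Hw Hn1 (H1 K) _ _ M.
  have -> : \sum_(k < K) s k `^ (- (3 / p)) * (w * s k `^ (- g)) * (n * s k ^+ 2) * s k *
     (expR (- 4) / 4) = K%:R * (w * n * (expR (- 4) / 4)).
    apply: sum_ord_const => k.
    have E : s k `^ (- (3 / p)) * s k `^ (- g) * s k ^+ 2 * s k = 1.
      rewrite -mulrA -exprSr -powR_mulrn ?(ltW (s0 k))// -!powRD ?sn ?implybT//.
      by rewrite (_ : _ + _ = 0) ?powRr0// /g; field.
    by rewrite -[RHS]mulr1 -[X in _ = _ * X]E; ring.
  have -> : \sum_(k < K) (s k `^ (- (3 / p))) `^ p * (N * s k ^+ 2) * s k = K%:R * N.
    apply: sum_ord_const => k.
    rewrite -powRrM mulNr divfK// powRN -[3]/(3%:R) powR_mulrn ?(ltW (s0 k))//.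
    by field; rewrite sn.
  rewrite (_ : 2 `^ (- `|sigma|) * _ * (K%:R * _) * _ = K%:R * D); last by rewrite /D; ring.
  apply; [lra | by move=> k; have := s2 k; lra | exact: ltW |].
  move=> t /andP[t1 t2]; apply: le_trans (Hm t _); last by lra.
  rewrite ler_pM2l//; apply: ge0_ler_powR; rewrite ?nnegrE; by [lra | have := ha; lra].
have : 1 - 1 / p <= 0.
  apply: (@natural_power_bounded _ _ (`|C| * N `^ (1 / p) / D)) => i.
  have i0 : 0 < i.+1%:R :> R by rewrite ltr0n.
  rewrite ler_pdivlMr//; have := test i.+1.
  rewrite powRM ?(ltW i0) ?(ltW N0)//.
  have -> : i.+1%:R * D = i.+1%:R `^ (1 / p) * (i.+1%:R `^ (1 - 1 / p) * D).
    rewrite mulrA -powRD; last by rewrite (gt_eqF i0) implybT.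
    by rewrite addrC subrK powRr1// ltW.
  by rewrite (mulrCA `|C|) ler_pM2l// powR_gt0.
by rewrite leNgt subr_gt0 ltr_pdivrMr// mul1r hp.
Qed.

End NecessaryConditions.

Theorem theorem4p9 (R : realType) (alpha beta zeta p q kappa sigma : R)
  (hab : beta <= alpha) (hb : - (1 / 2) <= beta) (ha : - (1 / 2) < alpha)
  (hzeta : 0 <= zeta) (hp : 1 < p) (hq : 1 < q)
  (hbound : exists C : R, forall F : R -> R[i], test_function F ->
     ((\int[lebesgue_measure]_(t in `]0%R, +oo[)
          (cabs (jacobi_op alpha beta zeta kappa sigma F t) `^ q
           * m_weight_mod alpha beta t)%:E) `^ (1 / q)
      <= C%:E *
         (\int[lebesgue_measure]_(lambda in `]0%R, +oo[)
             (cabs (F lambda) `^ p * n_weight alpha beta lambda)%:E)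
           `^ (1 / p))%E) :
  (zeta != 0 ->
     [/\ sigma * q < 2 * (alpha + 1),
         sigma - kappa <= 2 * (alpha + 1) * (1 / p + 1 / q - 1) &
         sigma >= 3 * (1 / p + 1 / q - 1)]) /\
  (zeta = 0 ->
     [/\ sigma * q < 2 * (alpha + 1),
         kappa * (p / (p - 1)) < 3,
         sigma - kappa <= 2 * (alpha + 1) * (1 / p + 1 / q - 1) &
         sigma - kappa >= 3 * (1 / p + 1 / q - 1)]).
Proof.
have [C HC] := hbound.
have hA := origin_necessary hab hb ha hp hq HC.
have hB := high_frequency_necessary hab hb ha hp hq HC.
split=> z0; split=> //.
- rewrite -[leRHS]addr0.
  apply: (low_frequency_necessary hab hb ha hp hq HC
    (w := (1 + 4 / zeta ^+ 2) `^ (- `|- (kappa / 2)|) * (zeta ^+ 2) `^ (- (kappa / 2)))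
    (W := (1 + 4 / zeta ^+ 2) `^ `|- (kappa / 2)| * (zeta ^+ 2) `^ (- (kappa / 2)))).
    have zz : 0 < zeta ^+ 2 by rewrite exprn_even_gt0.
    by rewrite mulr_gt0 ?powR_gt0// addr_gt0// divr_gt0.
  move=> s s01 x xI; rewrite powRr0 !mulr1.
  exact: riesz_weight_constant z0 s01 xI.
- have hC := logarithmic_necessary hab hb ha hp hq HC z0.
  have p1 : 0 < p - 1 by rewrite subr_gt0.
  rewrite mulrA ltr_pdivrMr// -ltr_pdivlMr ?(lt_trans ltr01 hp)//.
  by rewrite (_ : _ / p = 3 * (1 - 1 / p))//; field; rewrite gt_eqF// (lt_trans ltr01 hp).
apply: (low_frequency_necessary hab hb ha hp hq HC (w := (4 + zeta ^+ 2) `^ (- `|- (kappa / 2)|))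
    (W := (4 + zeta ^+ 2) `^ `|- (kappa / 2)|)).
  by rewrite powR_gt0// z0 expr0n/=; lra.
move=> s /andP[s0 s1] x xI; apply: riesz_weight_homogeneous => //.
by rewrite z0 expr0n mul0r.
Qed.
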